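(* Let $U\in\mathcal U$ and let $\vartheta^-,\vartheta^+\in\Theta$ with $\vartheta^-\neq\vartheta^+$. Then: (1) there is at most one value $\bar\alpha=\bar\alpha(\vartheta^-,\vartheta^+,U)\in(0,2)$ of the exponent $\alpha\in(0,2)$ for which the potential $(U,\alpha)$ admits a parabolic trajectory associated with $\vartheta^-,\vartheta^+$; (2) for every $\alpha\in(0,2)$, every parabolic trajectory associated with $\vartheta^-,\vartheta^+$ and $(U,\alpha)$ is a free-time parabolic Morse minimizer; (3) if $|\vartheta^+-\vartheta^-|>\pi$, then there exists exactly one $\bar\alpha\in(0,2)$ such that, for $\alpha\in(0,2)$, the potential $(U,\alpha)$ admits a parabolic Morse minimizer associated with $\vartheta^-,\vartheta^+$ if and only if $\alpha=\bar\alpha$.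
   Context: Fix $0\le\vartheta_1\le\vartheta_2<2\pi$. $\mathcal U=\mathcal U_{\vartheta_1\vartheta_2}$ is the set of $2\pi$-periodic $U\in C^2(\mathbb R)$ with $U(\vartheta)\ge U(\vartheta_1)=U(\vartheta_2)>0$ for all $\vartheta$ and $U''(\vartheta_i)>0$, $i=1,2$. $\Theta=\{\vartheta_i+2n\pi:\ n\in\mathbb Z,\ i\in\{1,2\}\}$. For $\alpha\in(0,2)$, $(U,\alpha)$ denotes the potential $V(x)=U(\vartheta)/r^\alpha$ on $\mathbb R^2\setminus\{0\}$, where $x=(r\cos\vartheta,r\sin\vartheta)$. Planar paths are written in polar coordinates $x=(r,\vartheta)$, with $r=|x|$ and $\vartheta$ a real-valued (lifted) angle, continuous in time on intervals where $r>0$ (so angles differing by $2\pi$ are distinguished, and no relation is imposed between values of the angle before and after an instant where $r=0$). $H^1$ regularity refers to the planar path. The action is $\mathcal A([a,b];x)=\int_a^b\left(\tfrac12|\dot x(t)|^2+V(x(t))\right)dt$, with $V(0)=+\infty$. A path $x=(r,\vartheta)\in H^1_{\rm loc}(\mathbb R)$ is a parabolic trajectory associated with $\vartheta^-,\vartheta^+$ and $V$ if $\ddot x=\nabla V(x)$ and $\tfrac12|\dot x|^2=V(x)$ for all $t\in\mathbb R$, $\min_{t\in\mathbb R}r(t)>0$, and $r(t)\to+\infty$, $\vartheta(t)\to\vartheta^\pm$ as $t\to\pm\infty$. It is a (free-time) parabolic Morse minimizer if moreover for every $t_1<t_2$, $t_1'<t_2'$ and every $z=(\rho,\zeta)\in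 H^1(t_1',t_2')$ with $\rho(t_i')=r(t_i)$, $\zeta(t_i')=\vartheta(t_i)$, $i=1,2$, one has $\mathcal A([t_1,t_2];x)\le\mathcal A([t_1',t_2'];z)$. *)

(* Defs.v *)
From HB Require Import structures.
From mathcomp Require Import all_boot all_order all_algebra.
From mathcomp Require Import all_classical all_reals all_analysis.

Set Implicit Arguments.
Unset Strict Implicit.
Unset Printing Implicit Defensive.

Import Order.TTheory GRing.Theory Num.Theory.
Import numFieldNormedType.Exports.

Local Open Scope ring_scope.
Local Open Scope classical_set_scope.

(* The plane is 'rV[R]_2. The library norm on it is the sup norm, so the
   Euclidean one is introduced separately. *)
Definition sqnorm (R : realType) (p : 'rV[R]_2) : R := \sum_i p 0 i ^+ 2.

Definition enorm (R : realType) (p : 'rV[R]_2) : R := Num.sqrt (sqnorm p).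

Definition polar (R : realType) (r th : R) : 'rV[R]_2 :=
  \row_i (if i == 0 then r * cos th else r * sin th).

Definition gradient (R : realType) (f : 'rV[R]_2 -> R) (p : 'rV[R]_2) :
    'rV[R]_2 :=
  \row_i 'D_(delta_mx 0 i) f p.

Definition classU (R : realType) (th1 th2 : R) (U : R -> R) : Prop :=
  [/\ (forall t, U (t + 2 * pi) = U t),
      [/\ (forall t, derivable U t 1),
          (forall t, derivable U^`() t 1) &
          continuous U^`()^`()],
      (forall t, U th1 <= U t),
      U th1 = U th2 /\ 0 < U th1 &
      0 < U^`()^`() th1 /\ 0 < U^`()^`() th2].

Definition Theta (R : realType) (th1 th2 : R) : set R :=
  [set t | exists n : int,
     t = th1 + (2 * pi) *~ n \/ t = th2 + (2 * pi) *~ n].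

(* Some angle of p. For p != 0 it is determined up to a multiple of 2 pi, which
   is harmless below since it is only used through 2 pi-periodic functions. *)
Definition angle (R : realType) (p : 'rV[R]_2) : R :=
  xget 0 [set th | p = polar (enorm p) th].

(* The value at the origin is irrelevant here: see [potentialE]. *)
Definition potential (R : realType) (U : R -> R) (alpha : R)
    (p : 'rV[R]_2) : R :=
  U (angle p) / enorm p `^ alpha.

Definition potentialE (R : realType) (U : R -> R) (alpha : R)
    (p : 'rV[R]_2) : \bar R :=
  if p == 0 then +oo%E else (potential U alpha p)%:E.

(* v is an L^2 weak derivative of x on [a, b], and x is the (absolutely)
   continuous representative of its class. *)
Definition weak_velocity (R : realType) (a b : R)
    (x v : R -> 'rV[R]_2) : Prop :=
  forall i,
    [/\ measurable_fun `[a, b] (fun t => v t 0 i),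
        (@lebesgue_measure R).-integrable `[a, b]
          (fun t => (v t 0 i ^+ 2)%:E) &
        forall t, t \in `[a, b] ->
          x t 0 i = x a 0 i + \int[@lebesgue_measure R]_(s in `[a, t]) v s 0 i].

Definition H1 (R : realType) (a b : R) (x : R -> 'rV[R]_2) : Prop :=
  exists v, weak_velocity a b x v.

(* Some weak derivative of x on [a, b]. It is unique up to a null set, so
   the action does not depend on the choice. Meaningful only if [H1 a b x]. *)
Definition velocity (R : realType) (a b : R) (x : R -> 'rV[R]_2) :
    R -> 'rV[R]_2 :=
  xget (fun=> 0) [set v | weak_velocity a b x v].

Definition action (R : realType) (U : R -> R) (alpha a b : R)
    (x : R -> 'rV[R]_2) : \bar R :=
  (\int[@lebesgue_measure R]_(t in `[a, b])
     ((2^-1 * sqnorm (velocity a b x t))%:E + potentialE U alpha (x t)))%E.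

Definition planar (R : realType) (r th : R -> R) : R -> 'rV[R]_2 :=
  fun t => polar (r t) (th t).

(* r is a modulus and th a lifted angle on the time interval I; th is
   continuous off the collisions and may jump arbitrarily across them. *)
Definition polar_path (R : realType) (I : set R) (r th : R -> R) : Prop :=
  (forall t, I t -> 0 <= r t) /\
  {within I `&` [set t | 0 < r t], continuous th}.

Definition parabolic_trajectory (R : realType) (U : R -> R) (alpha : R)
    (thm thp : R) (r th : R -> R) : Prop :=
  let x := planar r th in
  let v := x^`() in
  [/\ polar_path setT r th /\ (forall a b, a < b -> H1 a b x),
      (forall t, [/\ derivable x t 1, derivable v t 1 &
                     v^`() t = gradient (potential U alpha) (x t)]),
      (forall t, 2^-1 * sqnorm (v t) = potential U alpha (x t)),
      (exists2 t0, 0 < r t0 & forall t, r t0 <= r t) &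
      [/\ r @ -oo%R --> +oo%R, r @ +oo%R --> +oo%R,
          th @ -oo%R --> thm & th @ +oo%R --> thp]].

Definition parabolic_Morse_minimizer (R : realType) (U : R -> R) (alpha : R)
    (thm thp : R) (r th : R -> R) : Prop :=
  parabolic_trajectory U alpha thm thp r th /\
  forall (t1 t2 s1 s2 : R) (rho zeta : R -> R),
    t1 < t2 -> s1 < s2 ->
    polar_path `[s1, s2] rho zeta ->
    H1 s1 s2 (planar rho zeta) ->
    rho s1 = r t1 -> zeta s1 = th t1 ->
    rho s2 = r t2 -> zeta s2 = th t2 ->
    (action U alpha t1 t2 (planar r th)
       <= action U alpha s1 s2 (planar rho zeta))%E.

(* Main.v *)
(* Put gam = 1 - alpha/2, mu^2 = min U and v = r^(alpha/2) r' / sqrt 2. The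
   energy relation turns the equations of motion into
     v' = gam m (U(th) - v^2),  th'^2 = m^2 (U(th) - v^2),  m = sqrt 2 r^(gam - 2),
   so v is nondecreasing. A parabolic trajectory moves th monotonically from one
   minimum of U to the other while v goes from -mu to mu; hence v = g(th) with
   g' = gam sqrt(U - g^2), up to a time reversal, and conversely every such g on
   the interval between the two angles yields a trajectory.
   (1) Writing g = - mu cos chi, the increment of chi over the interval is
   strictly monotone in gam, whereas it must be pi.
   (2) S = (sqrt 2 / gam) r^gam g(th) satisfies |grad S|^2 <= 2 V, so the action
   of a path is at least the increment of S, with equality on the trajectory. S
   is continuous at the origin and vanishes there, so a path with collisions is
   handled by cutting it just before its first and just after its last one.
   (3) Shooting in gam: with g = -mu at the left end, g stays below mu for
   gam = 0, and reaches mu too early for some gam < 1 since the angular gap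
   exceeds pi. *)

Require Import Defs.
From mathcomp Require Import all_boot all_order all_algebra.
From mathcomp Require Import all_classical all_reals all_analysis.
From mathcomp Require Import measurable_realfun.
From mathcomp Require Import ring lra.
Import Order.TTheory GRing.Theory Num.Theory.
Import numFieldNormedType.Exports.
Set Implicit Arguments.
Unset Strict Implicit.
Unset Printing Implicit Defensive.
Local Open Scope ring_scope.
Local Open Scope classical_set_scope.

(** * Calculus *)

(** The field sqrt(U - g^2) is not known to be Lipschitz where U = g^2, which is the situation at
    both ends of the interval of angles, so no step relies on uniqueness for the profile equation.
    That the wells are not reached in finite time comes from an energy mixing (th - a)^2 with the
    first power of v + mu: together they dominate U - v^2, and Gronwall applies. Uniqueness of the
    exponent is a sign argument on the difference of two angles chi: nonnegative near the left end,
    nonpositive near the right end, and increasing through every interior zero. Shooting is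
    performed on Euler iterates, which depend continuously on gam even if the limit problem does
    not. Nondegeneracy of the wells prevents a solution obtained in the limit from resting at -mu or
    mu for a while. A competitor is only H^1, so S is not differentiated along it: its increments
    are estimated over short chords by the mean value theorem. *)

Lemma is_derive1_ext (R : realType) (V : normedModType R) (f g : R -> V)
    (x : R) (d d' : V) :
  is_derive x 1 f d -> f =1 g -> d = d' -> is_derive x 1 g d'.
Proof. by move=> df /funext <- <-. Qed.

Lemma is_derive1_add (R : realType) (V : normedModType R) (f g : R -> V)
    (x : R) (a b : V) :
  is_derive x 1 f a -> is_derive x 1 g b ->
  is_derive x 1 (fun t => f t + g t) (a + b).
Proof. by move=> df dg; exact: is_deriveD. Qed.

Lemma is_derive1_sub (R : realType) (V : normedModType R) (f g : R -> V)
    (x : R) (a b : V) :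
  is_derive x 1 f a -> is_derive x 1 g b ->
  is_derive x 1 (fun t => f t - g t) (a - b).
Proof. by move=> df dg; exact: is_deriveB. Qed.

Lemma is_derive1_opp (R : realType) (V : normedModType R) (f : R -> V)
    (x : R) (a : V) :
  is_derive x 1 f a -> is_derive x 1 (fun t => - f t) (- a).
Proof. by move=> df; exact: is_deriveN. Qed.

Lemma is_derive1_mul (R : realType) (f g : R -> R) (x a b : R) :
  is_derive x 1 f a -> is_derive x 1 g b ->
  is_derive x 1 (fun t => f t * g t) (a * g x + f x * b).
Proof.
move=> df dg; apply: (is_derive1_ext (is_deriveM df dg)) => //.
by rewrite /GRing.scale /= addrC mulrC.
Qed.

Lemma is_derive1_cmul (R : realType) (c : R) (f : R -> R) (x a : R) :
  is_derive x 1 f a -> is_derive x 1 (fun t => c * f t) (c * a).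
Proof.
move=> df; apply: (is_derive1_ext (is_derive1_mul (is_derive_cst c x 1) df)) => //.
by rewrite mul0r add0r.
Qed.

Lemma is_derive1_chain (R : realType) (f g : R -> R) (x a b : R) :
  is_derive x 1 g b -> is_derive (g x) 1 f a ->
  is_derive x 1 (fun t => f (g t)) (a * b).
Proof. by move=> dg df; exact: (is_derive1_comp df dg). Qed.

Lemma is_derive1_sqr (R : realType) (f : R -> R) (x a : R) :
  is_derive x 1 f a -> is_derive x 1 (fun t => f t ^+ 2) (2 * f x * a).
Proof.
move=> df; apply: (is_derive1_ext (is_derive1_mul df df)) => [t|]; first by rewrite expr2.
ring.
Qed.

Lemma is_derive1_inv (R : realType) (f : R -> R) (x a : R) :
  is_derive x 1 f a -> f x != 0 -> is_derive x 1 (fun t => (f t)^-1) (- a / f x ^+ 2).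
Proof.
move=> df f0; apply: (is_derive1_ext (is_deriveV f0 df)) => //.
by rewrite /GRing.scale /= mulNr mulrC mulNr.
Qed.

Lemma is_derive1_div (R : realType) (f g : R -> R) (x a b : R) :
  is_derive x 1 f a -> is_derive x 1 g b -> g x != 0 ->
  is_derive x 1 (fun t => f t / g t) ((a * g x - f x * b) / g x ^+ 2).
Proof.
move=> df dg g0; apply: (is_derive1_ext (is_derive1_mul df (is_derive1_inv dg g0))) => //.
by field.
Qed.

Lemma is_derive1_id (R : realType) (x : R) : is_derive x 1 (fun t : R => t) 1.
Proof. exact: is_derive_id. Qed.

Lemma is_derive1_cst (R : realType) (V : normedModType R) (c : V) (x : R) :
  is_derive x 1 (fun _ : R => c) 0.
Proof. exact: is_derive_cst. Qed.

Lemma is_derive1_pow (R : realType) (f : R -> R) (p x a : R) :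
  is_derive x 1 f a -> 0 < f x ->
  is_derive x 1 (fun t => f t `^ p) (p * f x `^ (p - 1) * a).
Proof.
by move=> df f0; exact: (is_derive1_chain df (is_derive1_powR p f0)).
Qed.

Lemma is_derive1_cont (R : realType) (V : normedModType R) (f : R -> V)
    (x : R) (d : V) : is_derive x 1 f d -> {for x, continuous f}.
Proof.
by case=> df _; apply/differentiable_continuous/derivable1_diffP.
Qed.

Lemma is_derive1_within (R : realType) (V : normedModType R) (f df : R -> V)
    (I : set R) : (forall x, I x -> is_derive x 1 f (df x)) ->
  {within I, continuous f}.
Proof.
move=> dfI; apply: continuous_in_subspaceT => x /set_mem /dfI.
exact: is_derive1_cont.
Qed.

Lemma is_derive1_near (R : realType) (V : normedModType R) (f g : R -> V)
    (x : R) (d : V) :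
  (\forall y \near x, f y = g y) -> is_derive x 1 f d -> is_derive x 1 g d.
Proof. exact: near_eq_is_derive. Qed.

Lemma derive_ge0_le (R : realType) (f df : R -> R) (a b : R) : a <= b ->
  (forall x, a < x < b -> is_derive x 1 f (df x)) ->
  (forall x, a < x < b -> 0 <= df x) ->
  {within `[a, b], continuous f} -> f a <= f b.
Proof.
rewrite le_eqVlt => /predU1P[->//|ab] Df df0 cf.
have Df' : forall x, x \in `]a, b[%R -> is_derive x 1 f (df x).
  by move=> x; rewrite in_itv /=; exact: Df.
have [c cab fE] := MVT ab Df' cf.
rewrite -subr_ge0 fE mulr_ge0 ?subr_ge0 ?(ltW ab)//.
by apply: df0; move: cab; rewrite in_itv.
Qed.

Lemma derive_gt0_lt (R : realType) (f df : R -> R) (a b : R) : a < b ->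
  (forall x, a < x < b -> is_derive x 1 f (df x)) ->
  (forall x, a < x < b -> 0 < df x) ->
  {within `[a, b], continuous f} -> f a < f b.
Proof.
move=> ab Df df0 cf.
have Df' : forall x, x \in `]a, b[%R -> is_derive x 1 f (df x).
  by move=> x; rewrite in_itv /=; exact: Df.
have [c cab fE] := MVT ab Df' cf.
rewrite -subr_gt0 fE mulr_gt0 ?subr_gt0 //.
by apply: df0; move: cab; rewrite in_itv.
Qed.

Lemma derive_abs_le (R : realType) (f df : R -> R) (M a b : R) :
  (forall x : R, is_derive x 1 f (df x)) -> (forall x, `|df x| <= M) ->
  `|f b - f a| <= M * `|b - a|.
Proof.
move=> Df dfM; wlog ab : a b / a <= b.
  move=> H; have [/H//|/ltW/H] := leP a b.
  by rewrite distrC (distrC a).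
have cf : {within `[a, b], continuous f} by apply: is_derive1_within => x _; exact: Df.
have [c _ ->] := MVT_segment ab (fun x _ => Df x) cf.
by rewrite normrM ler_wpM2r.
Qed.

Lemma within_itv_continuous (R : realType) (f : R -> R) (a b : R) :
  (forall x, a <= x <= b -> {for x, continuous f}) ->
  {within `[a, b], continuous f}.
Proof.
move=> cf; apply: continuous_in_subspaceT => x /set_mem /=.
by rewrite in_itv /=; exact: cf.
Qed.

Lemma is_derive_near_gt (R : realType) (f : R -> R) (x d : R) :
  is_derive x 1 f d -> 0 < d ->
  exists2 e, 0 < e & forall y, 0 < y < e -> f (x - y) < f x < f (x + y).
Proof.
move=> /is_derive1_caratheodory[h [fE hC hx]] d0.
have : \forall y \near x, 0 < h y.
  have h0 : 0 < h x by rewrite hx.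
  exact: (cvgr_gt _ hC 0 h0).
case/nbhs_ballP => e /= e0 He; exists e => // y /andP[y0 ye].
have hp z : `|x - z| < e -> 0 < h z by move=> xz; exact: He.
have E1 := fE (x - y); have E2 := fE (x + y).
have p1 : 0 < h (x - y) by apply: hp; rewrite (_ : _ - _ = y) ?gtr0_norm//; lra.
have p2 : 0 < h (x + y) by apply: hp; rewrite (_ : _ - _ = - y) ?normrN ?gtr0_norm//; lra.
apply/andP; split.
  rewrite -subr_gt0 -opprB E1 (_ : x - y - x = - y); last lra.
  by rewrite mulrN opprK mulr_gt0.
by rewrite -subr_gt0 E2 (_ : x + y - x = y) ?mulr_gt0//; lra.
Qed.

(* [E exp(-Kt)] and [E exp(Kt)] are monotone. *)
Lemma gronwall_eq0 (R : realType) (E dE : R -> R) (K s t : R) :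
  (forall x : R, is_derive x 1 E (dE x)) -> (forall x, 0 <= E x) ->
  (forall x, `|dE x| <= K * E x) -> E s = 0 -> E t = 0.
Proof.
move=> DE E0 dEK Es0.
have Dl (c x : R) : is_derive x 1 (fun t => c * t) c.
  by apply: (is_derive1_ext (is_derive1_cmul c (is_derive1_id x))) => //; rewrite mulr1.
have D (c x : R) : is_derive x 1 (fun t => E t * expR (c * t))
    ((dE x + c * E x) * expR (c * x)).
  apply: (is_derive1_ext (is_derive1_mul (DE x)
     (is_derive1_chain (Dl c x) (is_derive_expR (c * x))))) => //.
  by ring.
have C (c : R) I : {within I, continuous (fun t => E t * expR (c * t))}.
  by apply: is_derive1_within => x _; exact: D.
apply/eqP; rewrite eq_le E0 andbT.
have [st|/ltW ts] := leP s t.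
  rewrite -(pmulr_lle0 _ (expR_gt0 (- K * t))) -oppr_ge0.
  have := @derive_ge0_le _ (fun t => - (E t * expR (- K * t))) _ s t st
    (fun x _ => is_derive1_opp (D (- K) x)).
  rewrite Es0 mul0r oppr0; apply.
    move=> x _; rewrite oppr_ge0 pmulr_lle0 ?expR_gt0 //.
    by have := dEK x; have := ler_norm (dE x); lra.
  by apply: is_derive1_within => x _; exact: is_derive1_opp (D _ x).
rewrite -(pmulr_lle0 _ (expR_gt0 (K * t))).
have := @derive_ge0_le _ (fun t => (E t * expR (K * t))) _ t s ts
  (fun x _ => (D K x)).
rewrite Es0 mul0r; apply => //.
move=> x _; rewrite mulr_ge0 ?expR_ge0 //.
by have := dEK x; have := ler_norm (- dE x); rewrite normrN; lra.
Qed.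

(** * Polar coordinates *)

Lemma sqnormE (R : realType) (p : 'rV[R]_2) :
  sqnorm p = p 0 0 ^+ 2 + p 0 1 ^+ 2.
Proof.
rewrite /sqnorm big_ord_recl big_ord1.
by congr (_ + p _ _ ^+ 2); apply/val_inj.
Qed.

Lemma ord2P (i : 'I_2) : i = 0 \/ i = 1.
Proof. by case: i => [[|[|//]]] H; [left|right]; apply/val_inj. Qed.

Lemma row2P (R : realType) (p q : 'rV[R]_2) :
  p 0 0 = q 0 0 -> p 0 1 = q 0 1 -> p = q.
Proof.
by move=> h0 h1; apply/rowP => i; case: (ord2P i) => ->.
Qed.

Lemma polar_x (R : realType) (r th : R) : polar r th 0 0 = r * cos th.
Proof. by rewrite mxE. Qed.

Lemma polar_y (R : realType) (r th : R) : polar r th 0 1 = r * sin th.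
Proof. by rewrite mxE. Qed.

Lemma sqnorm_polar (R : realType) (r th : R) : sqnorm (polar r th) = r ^+ 2.
Proof.
by rewrite sqnormE polar_x polar_y !exprMn -mulrDr cos2Dsin2 mulr1.
Qed.

Lemma enorm_polar (R : realType) (r th : R) : 0 <= r -> enorm (polar r th) = r.
Proof. by move=> r0; rewrite /enorm sqnorm_polar sqrtr_sqr ger0_norm. Qed.

Lemma periodic_int (R : realType) (f : R -> R) (T : R) :
  (forall t, f (t + T) = f t) -> forall (n : int) t, f (t + T *~ n) = f t.
Proof.
move=> fT [] n t; first by rewrite -pmulrn; exact: (@periodicn _ _ f T).
by rewrite NegzE mulrNz -pmulrn -(@periodicn _ _ f T fT n.+1 (t - _)) subrK.
Qed.

(** Reduce x - y modulo 2 pi to some w in [0, 2 pi). Then cos w = cos^2 + sin^2 = 1, so sin (w / 2)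
    = 0, while w / 2 lies in [0, pi), where the sine vanishes only at 0. *)
Lemma cos_sin_inj (R : realType) (x y : R) : cos x = cos y -> sin x = sin y ->
  exists n : int, x = y + (2 * pi) *~ n.
Proof.
move=> cE sE; pose T : R := 2 * pi.
have T0 : 0 < T by rewrite mulr_gt0 // pi_gt0.
pose n := Num.floor ((x - y) / T); pose w := x - y - T *~ n.
have /andP[n1 n2] := floor_itv ((x - y) / T).
have wE : x - y = w + T *~ n by rewrite subrK.
have w0 : 0 <= w.
  rewrite subr_ge0 -mulrzr mulrC -ler_pdivlMr //.
have wT : w < T.
  rewrite /w -mulrzl; move: n2; rewrite intrD -/n ltr_pdivrMr // mulrDl; lra.
have cw : cos w = 1.
  have -> : cos w = cos (x - y).
    rewrite wE; symmetry; apply: periodic_int => t.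
    by rewrite /T mulrC mulr_natr cosD2pi.
  by rewrite cosB cE sE -!expr2 cos2Dsin2.
have sw : sin (w / 2) = 0.
  have := cosD (w / 2) (w / 2); rewrite -splitr cw.
  have := cos2Dsin2 (w / 2).
  by move=> h1 h2; apply/eqP; rewrite -sqrf_eq0; apply/eqP; lra.
exists n; rewrite -/T; apply/eqP; rewrite -subr_eq0 opprD addrA -/w; apply/eqP.
move: w0; rewrite le_eqVlt => /predU1P[//|w0].
suff : 0 < sin (w / 2) by rewrite sw ltxx.
by apply: sin_gt0_pi; move: wT; rewrite /T; lra.
Qed.

Lemma polar_inj (R : realType) (r s th ph : R) : 0 < r -> 0 < s ->
  polar r th = polar s ph ->
  r = s /\ exists n : int, th = ph + (2 * pi) *~ n.
Proof.
move=> r0 s0 E.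
have rs : r = s by rewrite -(enorm_polar th (ltW r0)) E enorm_polar // ltW.
split=> //; subst s.
have rn0 : r != 0 by rewrite gt_eqF.
apply: cos_sin_inj; apply: (mulfI rn0).
  by have := congr1 (fun p : 'rV[R]_2 => p 0 0) E; rewrite !polar_x.
by have := congr1 (fun p : 'rV[R]_2 => p 0 1) E; rewrite !polar_y.
Qed.

(** The angle selected by [xget] exists because [th] itself qualifies, and any selection differs
    from [th] by a multiple of the period of U. *)
Lemma potential_polar (R : realType) (U : R -> R) (alpha r th : R) :
  (forall t, U (t + 2 * pi) = U t) -> 0 < r ->
  potential U alpha (polar r th) = U th / r `^ alpha.
Proof.
move=> Up r0; rewrite /potential enorm_polar ?ltW //; congr (_ / _).
rewrite /angle enorm_polar ?ltW //.
case: xgetP => [ph _ /= /esym /polar_inj[]// _ [n ->]|/(_ th)[]//].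
by rewrite (periodic_int Up).
Qed.

Lemma polar_eq0 (R : realType) (r th : R) : 0 <= r ->
  (polar r th == 0) = (r == 0).
Proof.
move=> r0; apply/eqP/eqP => [E|->].
  by rewrite -(enorm_polar th r0) E /enorm sqnormE !mxE expr0n addr0 sqrtr0.
by apply: row2P; rewrite !mxE /= mul0r.
Qed.

(** A smooth branch of the angle on the open half-plane around the direction [th]: the reference
    angle plus the angle of [p] in the frame rotated by [th]. Unlike [angle], it can be
    differentiated. *)
Definition lift (R : realType) (th : R) (p : 'rV[R]_2) := th +
  atan ((p 0 1 * cos th - p 0 0 * sin th) / (p 0 0 * cos th + p 0 1 * sin th)).

Lemma polar_lift (R : realType) (p : 'rV[R]_2) (th : R) :
  0 < p 0 0 * cos th + p 0 1 * sin th ->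
  p = polar (enorm p) (lift th p).
Proof.
rewrite /lift; set a := p 0 0; set b := p 0 1.
(* [d] and [c] are the coordinates of [p] in the frame rotated by [th]. *)
set d := a * cos th + b * sin th; set c := b * cos th - a * sin th => d0.
have cs := cos2Dsin2 th.
have dc : d ^+ 2 + c ^+ 2 = a ^+ 2 + b ^+ 2.
  rewrite /d /c -[RHS]mulr1 -cs; ring.
have nE : enorm p = d * Num.sqrt (1 + (c / d) ^+ 2).
  rewrite -[X in X * _](gtr0_norm d0) -sqrtr_sqr -sqrtrM ?sqr_ge0 //.
  rewrite /enorm sqnormE -/a -/b -dc; congr Num.sqrt.
  by field; rewrite gt_eqF.
have s0 : Num.sqrt (1 + (c / d) ^+ 2) != 0.
  by rewrite gt_eqF // sqrtr_gt0 ltr_pwDl // sqr_ge0.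
have ca := cos_atan (c / d).
have sa : sin (atan (c / d)) = c / d * cos (atan (c / d)).
  have [/andP[h1 h2] tE] := atan_def (c / d).
  transitivity (tan (atan (c / d)) * cos (atan (c / d))); last by rewrite tE.
  by rewrite /tan divfK // ca invr_eq0.
have Ec : enorm p * cos (atan (c / d)) = d.
  by rewrite nE ca; field.
have Es : enorm p * sin (atan (c / d)) = c.
  by rewrite sa mulrCA Ec; field; rewrite gt_eqF.
apply: row2P; rewrite ?polar_x ?polar_y ?cosD ?sinD.
  rewrite mulrBr !mulrA [_ * cos th]mulrC [_ * sin th]mulrC -!mulrA Ec Es.
  rewrite /d /c -/a -[LHS]mulr1 -cs; ring.
rewrite mulrDr !mulrA [_ * cos th]mulrC [_ * sin th]mulrC -!mulrA Ec Es.
rewrite /d /c -/b -[LHS]mulr1 -cs; ring.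
Qed.

(** This ties the continuous angle of a path to [lift]: as long as it stays within pi / 2 of a
    reference value, the branch recovers the lifted angle itself, not merely its class modulo 2
    pi. *)
Lemma polar_lift_near (R : realType) (r th ph : R) : 0 < r ->
  `|ph - th| < pi / 2 ->
  ph = lift th (polar r ph).
Proof.
move=> r0 H; rewrite /lift polar_x polar_y.
have -> : (r * sin ph * cos th - r * cos ph * sin th) /
          (r * cos ph * cos th + r * sin ph * sin th) = tan (ph - th).
  rewrite /tan cosB sinB -!mulrA -mulrBr -mulrDr -mulf_div divff ?mul1r //.
  by rewrite gt_eqF.
rewrite tanK; first by rewrite addrC subrK.
by rewrite in_itv /= -ltr_norml.
Qed.

Lemma is_derive1_enorm (R : realType) (x : R -> 'rV[R]_2) (t a b : R) : 0 < enorm (x t) ->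
  is_derive t 1 (fun s => x s 0 0) a -> is_derive t 1 (fun s => x s 0 1) b ->
  is_derive t 1 (fun s => enorm (x s)) ((a * x t 0 0 + b * x t 0 1) / enorm (x t)).
Proof.
move=> e0 Da Db.
have D := is_derive1_add (is_derive1_sqr Da) (is_derive1_sqr Db).
have p : 0 < x t 0 0 ^+ 2 + x t 0 1 ^+ 2 by rewrite -sqnormE -sqrtr_gt0.
apply: (is_derive1_ext (is_derive1_chain D (is_derive1_sqrt p))) => [s|].
  by rewrite /enorm sqnormE.
by rewrite -sqnormE -/(enorm _); field; rewrite gt_eqF.
Qed.

Lemma sqnorm_enorm (R : realType) (p : 'rV[R]_2) : enorm p ^+ 2 = sqnorm p.
Proof. by rewrite sqr_sqrtr // sqnormE addr_ge0 ?sqr_ge0. Qed.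

Lemma is_derive1_lift (R : realType) (th : R) (x : R -> 'rV[R]_2) (t a b : R) :
  0 < x t 0 0 * cos th + x t 0 1 * sin th ->
  is_derive t 1 (fun s => x s 0 0) a -> is_derive t 1 (fun s => x s 0 1) b ->
  is_derive t 1 (fun s => lift th (x s))
    ((b * x t 0 0 - a * x t 0 1) / enorm (x t) ^+ 2).
Proof.
move=> d0 Da Db; have cs := cos2Dsin2 th.
have Dl (c d : R) (f h : R -> R) (a' b' : R) : is_derive t 1 f a' -> is_derive t 1 h b' ->
  is_derive t 1 (fun s => f s * c + h s * d) (a' * c + b' * d).
  move=> Df Dh; apply: (is_derive1_ext (is_derive1_add (is_derive1_cmul c Df) (is_derive1_cmul d Dh))).
    by move=> s; rewrite mulrC [d * _]mulrC.
  by rewrite mulrC [d * _]mulrC.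
have D1 : is_derive t 1 (fun s => x s 0 1 * cos th - x s 0 0 * sin th) (b * cos th - a * sin th).
  by apply: (is_derive1_ext (Dl (cos th) (- sin th) _ _ _ _ Db Da)) => [s|]; ring.
have D2 := Dl (cos th) (sin th) _ _ _ _ Da Db.
have n0 : x t 0 0 * cos th + x t 0 1 * sin th != 0 by rewrite gt_eqF.
have D3 := is_derive1_div D1 D2 n0.
have D4 := is_derive1_chain D3 (is_derive1_atan _).
apply: (is_derive1_ext (is_derive1_add (is_derive1_cst th t) D4)) => //.
rewrite sqnorm_enorm sqnormE.
have E : x t 0 0 ^+ 2 + x t 0 1 ^+ 2 = (x t 0 0 * cos th + x t 0 1 * sin th) ^+ 2 +
    (x t 0 1 * cos th - x t 0 0 * sin th) ^+ 2.
  by rewrite -[LHS]mulr1 -cs; ring.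
have p : 0 < (x t 0 0 * cos th + x t 0 1 * sin th) ^+ 2 +
    (x t 0 1 * cos th - x t 0 0 * sin th) ^+ 2.
  by rewrite ltr_pwDl ?sqr_ge0 // exprn_gt0.
have N : b * x t 0 0 - a * x t 0 1 = (b * cos th - a * sin th) * (x t 0 0 * cos th + x t 0 1 * sin th) -
   (x t 0 1 * cos th - x t 0 0 * sin th) * (a * cos th + b * sin th).
  by rewrite -[LHS]mulr1 -cs; ring.
rewrite E N; move: p n0.
move: (x t 0 0 * cos th + x t 0 1 * sin th) (x t 0 1 * cos th - x t 0 0 * sin th) => d c p n0.
by field; rewrite n0 gt_eqF.
Qed.

Lemma is_derive1_enorm_polar (R : realType) (x : R -> 'rV[R]_2) (t r th a b : R) :
  0 < r -> x t = polar r th ->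
  is_derive t 1 (fun s => x s 0 0) a -> is_derive t 1 (fun s => x s 0 1) b ->
  is_derive t 1 (fun s => enorm (x s)) (a * cos th + b * sin th).
Proof.
move=> r0 xt Da Db; have e0 : 0 < enorm (x t) by rewrite xt enorm_polar // ltW.
apply: (is_derive1_ext (is_derive1_enorm e0 Da Db)) => //.
rewrite xt (enorm_polar _ (ltW r0)) polar_x polar_y.
by field; rewrite gt_eqF.
Qed.

Lemma is_derive1_lift_polar (R : realType) (x : R -> 'rV[R]_2) (t r th a b : R) :
  0 < r -> x t = polar r th ->
  is_derive t 1 (fun s => x s 0 0) a -> is_derive t 1 (fun s => x s 0 1) b ->
  is_derive t 1 (fun s => lift th (x s)) ((b * cos th - a * sin th) / r).
Proof.
move=> r0 xt Da Db.
have d0 : 0 < x t 0 0 * cos th + x t 0 1 * sin th.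
  rewrite xt polar_x polar_y (_ : _ + _ = r) // -[RHS]mulr1 -(cos2Dsin2 th); ring.
apply: (is_derive1_ext (is_derive1_lift d0 Da Db)) => //.
rewrite xt (enorm_polar _ (ltW r0)) polar_x polar_y.
by field; rewrite gt_eqF.
Qed.

Lemma is_derive1_dot_gt0 (R : realType) (x : R -> 'rV[R]_2) (t r th a b : R) :
  0 < r -> x t = polar r th ->
  is_derive t 1 (fun s => x s 0 0) a -> is_derive t 1 (fun s => x s 0 1) b ->
  \forall s \near t, 0 < x s 0 0 * cos th + x s 0 1 * sin th.
Proof.
move=> r0 xt /is_derive1_cont ca /is_derive1_cont cb.
have E2 : x t 0 0 * cos th + x t 0 1 * sin th = r.
  rewrite xt polar_x polar_y -[RHS]mulr1 -(cos2Dsin2 th); ring.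
have C : {for t, continuous (fun s => x s 0 0 * cos th + x s 0 1 * sin th)}.
  exact: (cvgD (cvgM ca (cvg_cst _)) (cvgM cb (cvg_cst _))).
apply: (cvgr_gt _ C); by rewrite /= E2.
Qed.

(** [angle] is a mere choice and may jump, so near [t] the potential is rewritten through the smooth
    branch [lift th]; periodicity of U makes the two expressions agree. *)
Lemma is_derive1_potential (R : realType) (U : R -> R) (alpha : R)
    (x : R -> 'rV[R]_2) (t r th a b : R) :
  (forall t, U (t + 2 * pi) = U t) -> derivable U th 1 ->
  0 < r -> x t = polar r th ->
  is_derive t 1 (fun s => x s 0 0) a -> is_derive t 1 (fun s => x s 0 1) b ->
  is_derive t 1 (fun s => potential U alpha (x s))
    (r `^ (- alpha - 1) * (- alpha * U th * (a * cos th + b * sin th) +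
                           derive1 U th * (b * cos th - a * sin th))).
Proof.
move=> Up dU r0 xt Da Db.
have N := is_derive1_dot_gt0 r0 xt Da Db.
have D1 := is_derive1_enorm_polar r0 xt Da Db.
have D2 := is_derive1_lift_polar r0 xt Da Db.
set L := (fun s => lift th (x s)) in D2.
have Lt : L t = th.
  rewrite /L /lift xt !polar_x !polar_y.
  rewrite (_ : r * sin th * cos th - r * cos th * sin th = 0); last by ring.
  by rewrite mul0r atan0 addr0.
have et : enorm (x t) = r by rewrite xt enorm_polar // ltW.
have et0 : 0 < enorm (x t) by rewrite et.
have DU : is_derive (L t) 1 U (derive1 U th).
  by rewrite Lt derive1E; exact: derivableP.
have D3 := is_derive1_mul (is_derive1_chain D2 DU) (is_derive1_pow (- alpha) D1 et0).
have rn0 : r != 0 by rewrite gt_eqF.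
apply: (@is_derive1_near _ _ (fun s => U (L s) * enorm (x s) `^ (- alpha))).
  near=> s; rewrite powRN.
  have dp : 0 < x s 0 0 * cos th + x s 0 1 * sin th by near: s.
  have xE := polar_lift dp; rewrite -/(L s) in xE.
  have n0 : 0 < enorm (x s).
    rewrite lt_neqAle sqrtr_ge0 andbT eq_sym; apply/eqP => n0.
    move: dp; rewrite {1 2}xE n0 polar_x polar_y !mul0r addr0 ltxx //.
  by rewrite [in RHS]xE potential_polar.
apply: (is_derive1_ext D3) => //.
rewrite et Lt.
have -> : r `^ (- alpha) = r * r `^ (- alpha - 1).
  rewrite -[X in X * _](powRr1 (ltW r0)) -powRD; last by rewrite rn0 implybT.
  by congr (_ `^ _); lra.
by field.
Unshelve. all: by end_near. Qed.

Lemma derive_line (R : realType) (V W : normedModType R) (f : V -> W) (p e : V) (l : W) :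
  is_derive (0 : R) 1 (fun h : R => f (h *: e + p)) l -> 'D_e f p = l.
Proof.
move=> [H <-]; rewrite /derive; congr (lim _).
have -> : (fun h : R => h^-1 *: (f (h *: e + p) - f p)) =
  (fun h : R => h^-1 *: (f ((h *: (1 : R) + 0 : R) *: e + p) - f ((0 : R) *: e + p))).
  by apply/funext => h /=; rewrite addr0 scale0r add0r [_%:A]mulr1.
by [].
Qed.

Lemma is_derive1_line (R : realType) (p e : 'rV[R]_2) (t : R) i :
  is_derive t 1 (fun h : R => (h *: e + p) 0 i) (e 0 i).
Proof.
apply: (is_derive1_ext (is_derive1_add (is_derive1_cmul (e 0 i) (is_derive1_id t))
   (is_derive1_cst (p 0 i) t))) => [s|]; first by rewrite !mxE mulrC.
by rewrite mulr1 addr0.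
Qed.

Lemma gradient_polar (R : realType) (U : R -> R) (alpha r th : R) :
  (forall t, U (t + 2 * pi) = U t) -> derivable U th 1 -> 0 < r ->
  gradient (potential U alpha) (polar r th) = \row_i (r `^ (- alpha - 1) *
    (if i == 0 then - alpha * U th * cos th - derive1 U th * sin th
     else - alpha * U th * sin th + derive1 U th * cos th)).
Proof.
move=> Up dU r0.
apply/rowP => i; rewrite !mxE; apply: derive_line.
have E : (0 : R) *: (delta_mx 0 i : 'rV[R]_2) + polar r th = polar r th.
  by rewrite scale0r add0r.
apply: (is_derive1_ext (is_derive1_potential alpha Up dU r0 E
  (is_derive1_line _ _ _ _) (is_derive1_line _ _ _ _))) => //.
by rewrite !mxE; case: (ord2P i) => -> /=; ring.
Qed.

(** * The reduced system *)

(* For x = polar (r t) (th t) the unknown [v] is r^(alpha/2) r' / sqrt 2, and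
   gam = 1 - alpha / 2. *)
Definition reduced (R : realType) (U : R -> R) (gam : R) (r th v : R -> R) :=
  let m := fun t => Num.sqrt 2 * r t `^ (gam - 2) in
  [/\ exists2 r0, 0 < r0 & forall t, r0 <= r t,
      forall t : R, is_derive t 1 r (m t * r t * v t),
      forall t : R, is_derive t 1 v (gam * m t * (U (th t) - v t ^+ 2)) &
      exists2 w : R -> R, continuous w & forall t : R,
        is_derive t 1 th (w t) /\ w t ^+ 2 = m t ^+ 2 * (U (th t) - v t ^+ 2)].

Lemma powR_shift (R : realType) (r a b c : R) : 0 < r -> a = b + c ->
  r `^ a = r `^ b * r `^ c.
Proof. by move=> r0 ->; rewrite powRD // (gt_eqF r0) implybT. Qed.

Lemma powR_nat2 (R : realType) (r : R) : 0 < r -> r `^ 2 = r ^+ 2.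
Proof. by move=> r0; rewrite -powR_mulrn // ltW. Qed.

Section powers.
Variables (R : realType) (r gam : R).
Hypothesis r0 : 0 < r.
Let P := r `^ (gam - 2).

(** All powers of [r] that occur are expressed through the single quantity [P], so that identities
    between them become rational identities in r and P. *)
Lemma powR_gam : r `^ gam = r ^+ 2 * P.
Proof. by rewrite (@powR_shift _ r gam 2 (gam - 2)) ?powR_nat2 //; lra. Qed.

Lemma powR_gam1 : r `^ (gam - 1) = r * P.
Proof.
by rewrite (@powR_shift _ r (gam - 1) 1 (gam - 2)) ?powRr1 ?ltW //; lra.
Qed.

Lemma powR_alpha alpha : gam = 1 - alpha / 2 -> (r `^ alpha)^-1 = r ^+ 2 * P ^+ 2.
Proof.
move=> gE; rewrite -powRN (@powR_shift _ r (- alpha) 2 (- alpha - 2)) //; last by lra.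
rewrite powR_nat2 // [P ^+ 2]expr2.
by rewrite (@powR_shift _ r (- alpha - 2) (gam - 2) (gam - 2)) //; lra.
Qed.

Lemma powR_alpha1 alpha : gam = 1 - alpha / 2 -> r `^ (- alpha - 1) = r * P ^+ 2.
Proof.
move=> gE; rewrite expr2 (@powR_shift _ r (- alpha - 1) 1 (- alpha - 2)) //; last by lra.
rewrite powRr1 ?ltW //.
by rewrite (@powR_shift _ r (- alpha - 2) (gam - 2) (gam - 2)) //; lra.
Qed.

End powers.

Lemma is_derive1_coord (R : realType) (x : R -> 'rV[R]_2) (t : R) i :
  derivable x t 1 -> is_derive t 1 (fun s => x s 0 i) (derive1 x t 0 i).
Proof.
move=> dx; rewrite derive1E derive_mx // mxE.
by apply: derivableP; move/derivable_mxP: dx => /(_ 0 i).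
Qed.

Section trajectory_reduced.
Variables (R : realType) (U : R -> R) (alpha thm thp : R) (r th : R -> R).
Hypothesis Up : forall t, U (t + 2 * pi) = U t.
Hypothesis dU : forall t, derivable U t 1.
Hypothesis tr : parabolic_trajectory U alpha thm thp r th.

Let x := planar r th.
Let a t := derive1 x t 0 0.
Let b t := derive1 x t 0 1.

Lemma traj_r_gt0 : exists2 r0, 0 < r0 & forall t, r0 <= r t.
Proof. by case: tr => _ _ _ [t0 r0 rt0] _; exists (r t0). Qed.

Let r_gt0 t : 0 < r t.
Proof. by have [r0 r00 /(_ t)] := traj_r_gt0; exact: lt_le_trans. Qed.

Let Da (t : R) : is_derive t 1 (fun s => x s 0 0) (a t).
Proof. by case: tr => _ /(_ t)[dx _ _] _ _ _; exact: is_derive1_coord. Qed.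

Let Db (t : R) : is_derive t 1 (fun s => x s 0 1) (b t).
Proof. by case: tr => _ /(_ t)[dx _ _] _ _ _; exact: is_derive1_coord. Qed.

Let D2 (t : R) i : is_derive t 1 (fun s => derive1 x s 0 i)
  (gradient (potential U alpha) (x t) 0 i).
Proof.
by case: tr => _ /(_ t)[_ dv <-] _ _ _; exact: is_derive1_coord.
Qed.

Lemma traj_th_continuous : continuous th.
Proof.
case: tr => [[[_ cth] _] _ _ _ _].
have E : setT `&` [set t | 0 < r t] = setT.
  by apply/seteqP; split => // t _; split => //=.
by move: cth; rewrite E => cth; apply/(@continuous_subspace_setT _ _ th).
Qed.

Lemma traj_derive_r (t : R) : is_derive t 1 r (a t * cos (th t) + b t * sin (th t)).
Proof.
have E : x t = polar (r t) (th t) by [].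
apply: (is_derive1_ext (is_derive1_enorm_polar (r_gt0 t) E (Da t) (Db t))) => // s.
by rewrite enorm_polar // ltW.
Qed.

Lemma traj_derive_th (t : R) :
  is_derive t 1 th ((b t * cos (th t) - a t * sin (th t)) / r t).
Proof.
have E : x t = polar (r t) (th t) by [].
apply: is_derive1_near (is_derive1_lift_polar (r_gt0 t) E (Da t) (Db t)).
have pi0 : 0 < (pi : R) / 2 by rewrite divr_gt0 // pi_gt0.
near=> s; symmetry; apply: polar_lift_near => //.
rewrite distrC; near: s.
exact: (cvgr_dist_lt _ _ (@traj_th_continuous t) _ pi0).
Unshelve. all: by end_near. Qed.

(** Here p = x . x' = r r'. As V is homogeneous of degree -alpha, the Lagrange-Jacobi identity
    together with the energy relation gives p' = 2 V - alpha V = 2 gam V, and v = p / (sqrt 2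
    r^gam). The angular equation is the energy relation again, in the form r^2 th'^2 = 2 V -
    r'^2. *)
Lemma traj_reduced (gam : R) : gam = 1 - alpha / 2 ->
  exists v, reduced U gam r th v.
Proof.
move=> gE.
pose s2 : R := Num.sqrt 2.
have s20 : 0 < s2 by rewrite sqrtr_gt0.
have s22 : s2 ^+ 2 = 2 by rewrite sqr_sqrtr.
pose p t := x t 0 0 * a t + x t 0 1 * b t.
have pE t : p t = r t * (a t * cos (th t) + b t * sin (th t)).
  by rewrite /p /x /planar polar_x polar_y; ring.
have en t : a t ^+ 2 + b t ^+ 2 = 2 * (U (th t) / r t `^ alpha).
  case: tr => _ _ /(_ t) + _ _; rewrite sqnormE -/(a t) -/(b t) potential_polar // => <-.
  by rewrite mulrA divff ?mul1r ?gt_eqF.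
have Dp (t : R) : is_derive t 1 p (2 * gam * (U (th t) / r t `^ alpha)).
  apply: (is_derive1_ext (is_derive1_add (is_derive1_mul (Da t) (D2 t 0))
    (is_derive1_mul (Db t) (D2 t 1)))) => //.
  rewrite gradient_polar // !mxE /= -/(a t) -/(b t).
  rewrite (powR_alpha1 (r_gt0 t) gE).
  have -> : forall A B C D : R, A * A + B + (C * C + D) = (A ^+ 2 + C ^+ 2) + (B + D).
    by move=> *; ring.
  rewrite en (powR_alpha (r_gt0 t) gE) gE.
  have cs : cos (th t) ^+ 2 = 1 - sin (th t) ^+ 2 by rewrite -(cos2Dsin2 (th t)) addrK.
  move: cs; move: (r t) (derive1 U (th t)) (U (th t)) (sin (th t)) (cos (th t)) (r t `^ (1 - alpha / 2 - 2)).
  by move=> rr u' u s c P cs; field: cs.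
exists (fun t => p t * r t `^ (- gam) / s2).
have rgam t : r t `^ (- gam) = (r t ^+ 2 * r t `^ (gam - 2))^-1.
  by rewrite powRN powR_gam.
have P0 t : r t `^ (gam - 2) != 0 by rewrite gt_eqF // powR_gt0.
have rn0 t : r t != 0 by rewrite gt_eqF.
have s2n0 : s2 != 0 by rewrite gt_eqF.
split.
- exact: traj_r_gt0.
- move=> t; apply: (is_derive1_ext (traj_derive_r t)) => //.
  rewrite pE rgam -/s2; field; by rewrite s2n0 rn0 P0.
- move=> t; have D := is_derive1_mul (is_derive1_mul (Dp t)
     (is_derive1_pow (- gam) (traj_derive_r t) (r_gt0 t))) (is_derive1_cst s2^-1 t).
  apply: (is_derive1_ext D) => //.
  have -> : r t `^ (- gam - 1) = (r t ^+ 3 * r t `^ (gam - 2))^-1.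
    apply: (mulIf (rn0 t)).
    rewrite -[X in _ * X = _](powRr1 (ltW (r_gt0 t))).
    rewrite -(@powR_shift _ _ (- gam)) //; last by lra.
    by rewrite rgam; field; rewrite rn0 P0.
  rewrite /= !rgam pE -/s2 (powR_alpha (r_gt0 t) gE).
  move: (s2n0) (rn0 t) (P0 t) s22.
  move: (r t) (U (th t)) (b t) (a t) (sin (th t)) (cos (th t)) (r t `^ (gam - 2)) => rr u B A s c P n1 n2 n3 s22.
  have -> : gam * (s2 * P) = gam * P * 2 / s2 by rewrite -s22; field.
  field: s22; by rewrite n1 n2 n3.
exists (fun t => (b t * cos (th t) - a t * sin (th t)) / r t).
  move=> t; apply: cvgM; last first.
    apply: cvgV; first exact: rn0.
    exact: is_derive1_cont (traj_derive_r t).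
  have cth := @traj_th_continuous t.
  by apply: cvgB; apply: cvgM; [exact: is_derive1_cont (D2 t _)| |exact: is_derive1_cont (D2 t _)|];
    apply: continuous_comp => //; [exact: continuous_cos|exact: continuous_sin].
move=> t; split; first exact: traj_derive_th.
have E := en t; rewrite (powR_alpha (r_gt0 t) gE) in E.
have cs := cos2Dsin2 (th t).
rewrite /= pE rgam -/s2.
move: E cs (s2n0) (rn0 t) (P0 t) s22.
move: (r t) (U (th t)) (b t) (a t) (sin (th t)) (cos (th t)) (r t `^ (gam - 2)) => rr u B A s c P E cs n1 n2 n3 s22.
have -> : u = (A ^+ 2 + B ^+ 2) * (c ^+ 2 + s ^+ 2) / (2 * rr ^+ 2 * P ^+ 2).
  by rewrite cs E; field; rewrite n2 n3.
field: s22; by rewrite n1 n2 n3.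
Qed.
End trajectory_reduced.

Lemma derive1_uniq (R : realType) (f : R -> R) (x d e : R) :
  is_derive x 1 f d -> is_derive x 1 f e -> d = e.
Proof. by move=> [_ <-] [_ <-]. Qed.

Lemma is_derive1_opparg (R : realType) (f : R -> R) (x d : R) :
  is_derive (- x) 1 f d -> is_derive x 1 (fun t => f (- t)) (- d).
Proof.
move=> Df; have D := is_derive1_opp (is_derive1_id x).
by apply: (is_derive1_ext (is_derive1_chain D Df)) => //; rewrite mulrN mulr1.
Qed.

Lemma within_derive_itv (R : realType) (f df : R -> R) (a b : R) :
  (forall x : R, is_derive x 1 f (df x)) -> {within `[a, b], continuous f}.
Proof. by move=> Df; apply: is_derive1_within => x _; exact: Df. Qed.

Lemma derive_ge0_homo (R : realType) (f df : R -> R) (s t : R) :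
  (forall x : R, is_derive x 1 f (df x)) -> (forall x, s <= x -> 0 <= df x) ->
  s <= t -> f s <= f t.
Proof.
move=> Df df0 st; apply: (derive_ge0_le st (fun x _ => Df x)).
  by move=> x /andP[sx _]; apply: df0; exact: ltW.
exact: within_derive_itv Df.
Qed.

(* [U - mu^2] vanishing to second order at [a] makes th = a, v = +-mu an
   equilibrium which is not reached in finite time (Gronwall). *)
Record well (R : realType) (U : R -> R) (mu C M a : R) : Prop := Well {
  well_cont : continuous U;
  well_mu : 0 < mu;
  well_ge : forall x, mu ^+ 2 <= U x;
  well_at : U a = mu ^+ 2;
  well_C : 0 <= C;
  well_quad : forall x, U x - mu ^+ 2 <= C * (x - a) ^+ 2;
  well_M : forall x, U x <= M
}.

(* [m] stands for sqrt 2 * r^(gam - 2); only its bounds matter. *)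
Record transition (R : realType) (U : R -> R) (gam K0 a b : R)
    (r th v w m : R -> R) : Prop := Transition {
  tr_gam : 0 < gam;
  tr_m : forall t, 0 < m t <= K0;
  tr_r : forall t, 0 < r t;
  tr_dr : forall t : R, is_derive t 1 r (m t * r t * v t);
  tr_dv : forall t : R, is_derive t 1 v (gam * m t * (U (th t) - v t ^+ 2));
  tr_dth : forall t : R, is_derive t 1 th (w t);
  tr_w : forall t, w t ^+ 2 = m t ^+ 2 * (U (th t) - v t ^+ 2);
  tr_wc : continuous w;
  tr_rm : r @ -oo%R --> +oo%R;
  tr_rp : r @ +oo%R --> +oo%R;
  tr_thm : th @ -oo%R --> a;
  tr_thp : th @ +oo%R --> b
}.

(** Time reversal exchanges the two ends and changes the sign of [v], so what is proved at +oo
    becomes available at -oo. *)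
Lemma transition_rev (R : realType) (U : R -> R) (gam K0 a b : R) r th v w m :
  transition U gam K0 a b r th v w m ->
  transition U gam K0 b a (fun t => r (- t)) (fun t => th (- t))
    (fun t => - v (- t)) (fun t => - w (- t)) (fun t => m (- t)).
Proof.
case=> g0 m0 r0 dr dv dth ww wc rm rp thm thp; split => //.
- move=> t; apply: (is_derive1_ext (is_derive1_opparg (dr (- t)))) => //.
  by rewrite mulrN.
- move=> t; apply: (is_derive1_ext (is_derive1_opp (is_derive1_opparg (dv (- t))))) => //.
  by rewrite opprK sqrrN.
- by move=> t; apply: (is_derive1_ext (is_derive1_opparg (dth (- t)))).
- by move=> t; rewrite !sqrrN ww.
- move=> t; apply: cvgN.
  by apply: (@continuous_comp _ _ _ (-%R) w); [exact: opp_continuous|exact: wc].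
- exact/cvgy_compNP.
- exact/cvgNy_compNP.
- exact/cvgy_compNP.
- exact/cvgNy_compNP.
Qed.

(** * Asymptotics of v along a transition *)

Lemma near_pinfty_after (R : realType) (P : R -> Prop) (s : R) :
  (\forall t \near +oo%R, P t) -> exists2 t, s <= t & P t.
Proof.
case=> N [_ HN]; exists (Num.max s (N + 1)); first by rewrite le_max lexx.
by apply: HN; rewrite lt_max ltrDl ltr01 orbT.
Qed.

Section transition_limits.
Variables (R : realType) (U : R -> R) (mu C M gam K0 a b : R) (r th v w m : R -> R).
Hypothesis Ub : well U mu C M b.
Hypothesis T : transition U gam K0 a b r th v w m.

Let m0 t : 0 < m t. Proof. by case/andP: (tr_m T t). Qed.

Lemma tr_Uv t : v t ^+ 2 <= U (th t).
Proof.
rewrite -subr_ge0; have := sqr_ge0 (w t); rewrite (tr_w T) pmulr_rge0 //.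
by rewrite exprn_gt0.
Qed.

Lemma tr_v_homo s t : s <= t -> v s <= v t.
Proof.
apply: derive_ge0_homo (tr_dv T) _ => x _.
by rewrite mulr_ge0 ?subr_ge0 ?tr_Uv // mulr_ge0 // ltW ?(tr_gam T).
Qed.

Lemma tr_U_near e : 0 < e -> \forall t \near +oo%R, U (th t) < mu ^+ 2 + e.
Proof.
move=> e0.
have cU : U (th t) @[t --> +oo%R] --> U b.
  by apply: (cvg_comp _ _ (tr_thp T)); exact: (well_cont Ub).
apply: (cvgr_lt _ cU); by rewrite (well_at Ub) ltrDl.
Qed.

(** A value of [v] above [mu] would persist, [v] being nondecreasing; but v^2 <= U(th), and U(th)
    tends to mu^2. *)
Lemma tr_v_le_mu t : v t <= mu.
Proof.
have mu0 := well_mu Ub.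
rewrite leNgt; apply/negP => H.
have e0 : 0 < v t ^+ 2 - mu ^+ 2.
  by rewrite subr_gt0 ltr_pXn2r // ?nnegrE ?ltW // (lt_trans mu0).
have [s ts Hs] := near_pinfty_after t (tr_U_near e0).
have h1 := tr_Uv s; have h2 := tr_v_homo ts.
have : v t ^+ 2 <= v s ^+ 2.
  by rewrite ler_pXn2r // ?nnegrE ltW // ?(lt_trans mu0) // (lt_le_trans _ h2) // (lt_trans mu0).
lra.
Qed.

(** Suppose v stays below mu - e. If v <= -mu throughout, r is nonincreasing and cannot tend to +oo.
    Otherwise |v| is eventually at most some A < mu, hence U - v^2 >= kap > 0 and v' >= gam m kap,
    whereas (ln r)' = m v <= m mu. So ln r grows at most [c] times as fast as the bounded [v], again
    against r -> +oo. *)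
Lemma tr_v_sup e : 0 < e -> exists t, mu - e < v t.
Proof.
move=> e0; have mu0 := well_mu Ub; apply: contrapT => /forallNP H.
have {}H t : v t <= mu - e by rewrite leNgt; apply/negP/H.
have rlt t N : exists2 s, t <= s & N <= r s.
  by apply: near_pinfty_after; move/cvgryPge: (tr_rp T); apply.
have [[t vt]|/forallNP V] := pselect (exists t, - mu < v t); last first.
  have [s s0 rs] := rlt 0 (r 0 + 1).
  have : - r 0 <= - r s.
    apply: (@derive_ge0_homo _ (fun t => - r t) _ 0 s (fun x => is_derive1_opp (tr_dr T x))) => // x _.
    rewrite oppr_ge0 pmulr_rle0 ?mulr_gt0 ?(tr_r T) //.
    have := V x; move/negP; rewrite -leNgt; lra.
  lra.
pose A := Num.max (- v t) (mu - e).
have Amu : A < mu by rewrite /A gt_max; apply/andP; split; lra.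
have vA s : t <= s -> `|v s| <= A.
  move=> /tr_v_homo ts; rewrite ler_norml /A le_max lerNl le_max H orbT.
  by rewrite lerN2 ts.
pose kap := mu ^+ 2 - A ^+ 2.
have A0 : 0 <= A by have := vA _ (lexx t); apply: le_trans.
have kap0 : 0 < kap by rewrite subr_gt0 ltr_pXn2r // nnegrE // ltW.
have Uk s : t <= s -> kap <= U (th s) - v s ^+ 2.
  move=> ts; have := well_ge Ub (th s).
  suff : v s ^+ 2 <= A ^+ 2 by rewrite /kap; lra.
  by rewrite -(real_normK (num_real (v s))) ler_pXn2r // ?nnegrE // vA.
pose c := mu / (gam * kap).
have c0 : 0 < c by rewrite divr_gt0 // mulr_gt0 // (tr_gam T).
(* At this [s] the increase of ln r is at least 1 + c (mu + |v t|), more than c (v s - v t)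
   allows. *)
have [s ts rs] := rlt t (r t * expR (1 + c * (mu + `|v t|))).
have : ln (r s) <= ln (r t) + c * (v s - v t).
  rewrite mulrBr.
  have D x := is_derive1_sub (is_derive1_cmul c (tr_dv T x))
    (is_derive1_chain (tr_dr T x) (is_derive1_ln (tr_r T x))).
  have := derive_ge0_homo D _ ts.
  suff : forall x, t <= x -> 0 <= c * (gam * m x * (U (th x) - v x ^+ 2)) - (r x)^-1 * (m x * r x * v x).
    by move=> h /(_ h); lra.
  move=> x tx.
  have -> : (r x)^-1 * (m x * r x * v x) = m x * v x.
    by field; rewrite gt_eqF // (tr_r T).
  have -> : c * (gam * m x * (U (th x) - v x ^+ 2)) = m x * (c * gam * (U (th x) - v x ^+ 2)) by ring.
  rewrite -mulrBr; apply: mulr_ge0; [exact: ltW|rewrite subr_ge0].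
  apply: (le_trans (tr_v_le_mu x)).
  have {1}-> : mu = c * gam * kap.
    by rewrite /c; field; rewrite !gt_eqF // (tr_gam T).
  by rewrite ler_pM2l ?Uk // mulr_gt0 // (tr_gam T).
have rt := tr_r T t.
have : ln (r t * expR (1 + c * (mu + `|v t|))) <= ln (r s).
  by rewrite ler_ln // posrE ?mulr_gt0 ?expR_gt0 ?(tr_r T).
rewrite lnM ?posrE ?expR_gt0 // expRK => h1 h2.
have h3 : c * (v s - v t) <= c * (mu + `|v t|).
  rewrite ler_pM2l //; have := ler_norm (- v t); rewrite normrN.
  by have := tr_v_le_mu s; lra.
lra.
Qed.

End transition_limits.

Section transition_strict.
Variables (R : realType) (U : R -> R) (mu Ca Cb M gam K0 a b : R) (r th v w m : R -> R).
Hypothesis Ua : well U mu Ca M a.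
Hypothesis Ub : well U mu Cb M b.
Hypothesis T : transition U gam K0 a b r th v w m.
Hypothesis ab : a != b.

Let m0 t : 0 < m t. Proof. by case/andP: (tr_m T t). Qed.

Lemma tr_v_ge_mu t : - mu <= v t.
Proof.
by have := tr_v_le_mu Ua (transition_rev T) (- t); rewrite opprK lerNl.
Qed.

(** If v = -mu at [t0], monotonicity makes v constant before [t0]; then v' and w vanish there, and
    th is constant, equal to its limit [a]. The trajectory sits at the equilibrium, and the Gronwall
    bound on [E] keeps it there for all times, which contradicts th -> b. *)
Lemma tr_v_gt_mu t0 : - mu < v t0.
Proof.
have mu0 := well_mu Ua.
rewrite lt_neqAle tr_v_ge_mu andbT; apply/negP => /eqP H.
have vE t : t <= t0 -> v t = - mu.
  move=> tt; apply/eqP; rewrite eq_le tr_v_ge_mu andbT H.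
  by rewrite (tr_v_homo T).
have wE t : t < t0 -> w t = 0.
  move=> tt; apply/eqP; rewrite -sqrf_eq0 (tr_w T).
  have D : is_derive t 1 v 0.
    apply: is_derive1_near (is_derive1_cst (- mu) t).
    near=> s; rewrite vE //; apply: ltW.
    by near: s; exact: lt_nbhsl.
  have := derive1_uniq (tr_dv T t) D => /eqP; rewrite !mulf_eq0.
  by rewrite (gt_eqF (tr_gam T)) (gt_eqF (m0 t)) /= => /eqP h; rewrite h eqxx.
have thE t : t < t0 -> th t = a.
  move=> tt; have cE s : s <= t -> th s = th t.
    move=> st; apply/eqP; rewrite eq_le; apply/andP; split.
      apply: (derive_ge0_le st (fun x _ => tr_dth T x) _ (within_derive_itv (tr_dth T))).
      by move=> x /andP[_ xt]; rewrite wE // (lt_trans xt).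
    rewrite -lerN2.
    have DN x := is_derive1_opp (tr_dth T x).
    apply: (derive_ge0_le st (fun x _ => DN x) _ (within_derive_itv DN)).
    by move=> x /andP[_ xt]; rewrite wE ?oppr0 // (lt_trans xt).
  have L : th s @[s --> -oo%R] --> th t.
    apply: cvg_near_cst.
    exists t; split; first exact: num_real.
    by move=> s st; apply: cE; exact: ltW.
  exact: (cvg_unique _ L (tr_thm T)).
(* Quadratic in th - a but linear in v + mu, to match U - v^2 <= Ca (th - a)^2 + (mu - v)(mu + v),
   in which mu - v is at most 2 mu. *)
pose E t := (th t - a) ^+ 2 + (v t + mu).
pose dE t := 2 * (th t - a) * w t + gam * m t * (U (th t) - v t ^+ 2).
have DE (t : R) : is_derive t 1 E (dE t).
  apply: (is_derive1_ext (is_derive1_add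
    (is_derive1_sqr (is_derive1_sub (tr_dth T t) (is_derive1_cst a t)))
    (is_derive1_add (tr_dv T t) (is_derive1_cst mu t)))) => //.
  by rewrite subr0 addr0.
have v0 t : 0 <= v t + mu by have := tr_v_ge_mu t; lra.
have E0 t : 0 <= E t by rewrite addr_ge0 ?sqr_ge0.
have g0 := tr_gam T; have C0 := well_C Ua.
(* With q = U - v^2 and w^2 = m^2 q, the first term of [dE] is at most m ((th - a)^2 + q) and the
   second is gam m q; then q <= (Ca + 2 mu) E and m <= K0. *)
pose K := K0 * (1 + (1 + gam) * (Ca + 2 * mu)).
have dEK t : `|dE t| <= K * E t.
  have mt := m0 t.
  have /andP[_ mK] := tr_m T t.
  set q := U (th t) - v t ^+ 2.
  have q0 : 0 <= q by rewrite subr_ge0 (tr_Uv T).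
  have qE : q <= Ca * (th t - a) ^+ 2 + 2 * mu * (v t + mu).
    have := well_quad Ua (th t); have := tr_v_le_mu Ub T t; have := v0 t.
    rewrite /q; nra.
  have h1 : `|2 * (th t - a) * w t| <= m t * ((th t - a) ^+ 2 + q).
    have W := tr_w T t; rewrite -/q in W.
    have S1 := sqr_ge0 (m t * (th t - a) - w t).
    have S2 := sqr_ge0 (m t * (th t - a) + w t).
    by rewrite ler_norml; apply/andP; split; rewrite -(ler_pM2l mt); lra.
  have h2 : `|gam * m t * q| = gam * m t * q.
    by rewrite ger0_norm // mulr_ge0 // mulr_ge0 // ltW.
  apply: (le_trans (ler_normD _ _)); rewrite h2.
  apply: (@le_trans _ _ (m t * ((1 + (1 + gam) * (Ca + 2 * mu)) * E t))).
    apply: (@le_trans _ _ (m t * ((th t - a) ^+ 2 + (1 + gam) * q))); first by nra.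
    rewrite ler_pM2l //.
    have hq : q <= (Ca + 2 * mu) * E t.
      apply: (le_trans qE); rewrite /E; have := v0 t; have := sqr_ge0 (th t - a); nra.
    have : (1 + gam) * q <= (1 + gam) * ((Ca + 2 * mu) * E t).
      by rewrite ler_pM2l //; lra.
    have : (th t - a) ^+ 2 <= E t by rewrite /E; have := v0 t; lra.
    lra.
  rewrite /K -mulrA; apply: ler_wpM2r => //.
  by rewrite mulr_ge0 // addr_ge0 // mulr_ge0 //; lra.
(* Evaluated strictly before [t0], since [thE] is available only there. *)
have Es : E (t0 - 1) = 0.
  by rewrite /E thE ?vE ?subrr ?expr0n ?addNr ?addr0 //; lra.
have thA t : th t = a.
  have : E t = 0 := gronwall_eq0 t DE E0 dEK Es.
  rewrite /E => h; apply/eqP; rewrite -subr_eq0 -sqrf_eq0; apply/eqP.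
  by have := v0 t; have := sqr_ge0 (th t - a); lra.
have L : th s @[s --> +oo%R] --> a.
  rewrite (_ : th = (fun=> a)); first exact: cvg_cst.
  by apply/funext.
by move: ab; rewrite (cvg_unique _ L (tr_thp T)) // eqxx.
Unshelve. all: by end_near. Qed.

End transition_strict.

Lemma tr_v_bounds (R : realType) (U : R -> R) (mu Ca Cb M gam K0 a b : R) r th v w m :
  well U mu Ca M a -> well U mu Cb M b -> a != b ->
  transition U gam K0 a b r th v w m -> forall t, - mu < v t < mu.
Proof.
move=> Ua Ub ab T t; rewrite (tr_v_gt_mu Ua Ub T ab) /=.
rewrite eq_sym in ab.
by have := tr_v_gt_mu Ub Ua (transition_rev T) ab (- t); rewrite opprK ltrN2.
Qed.

(** * Profiles *)

Lemma is_derive1_eps (R : realType) (V : normedModType R) (f : R -> V) (x : R) (d : V) :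
  (forall e, 0 < e -> exists2 del, 0 < del &
     forall h, `|h| < del -> `|f (x + h) - f x - h *: d| <= e * `|h|) ->
  is_derive x 1 f d.
Proof.
move=> H.
have C : h^-1 *: (f (h *: (1 : R) + x) - f x) @[h --> (0 : R)^'] --> d.
  apply/cvgrPdist_le => e e0.
  have [del del0 Hd] := H e e0.
  near=> h.
  have h0 : h != 0 by near: h; exact: nbhs_dnbhs_neq.
  have hd : `|h| < del by near: h; exact: dnbhs0_lt.
  have := Hd h hd.
  rewrite [h *: _]mulr1 (addrC h x) => le1.
  rewrite -(ler_pM2l (_ : 0 < `|h|)) ?normr_gt0 // -normrZ.
  rewrite scalerBr scalerA divff // scale1r -normrN opprB mulrC //.
by split; [exact: cvgP C|exact: cvg_lim C].
Unshelve. all: by end_near. Qed.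

(** By the mean value theorem the difference quotients at [x] are values of [df] at nearby points,
    which are close to [l]. It serves at the ends of a profile, where only the limit of the slope is
    known. *)
Lemma is_derive1_extend (R : realType) (f df : R -> R) (x l r : R) :
  0 < r -> {for x, continuous f} ->
  (forall y, 0 < `|y - x| < r -> is_derive y 1 f (df y)) ->
  (forall e, 0 < e -> exists2 del, 0 < del &
     forall y, 0 < `|y - x| < del -> `|df y - l| <= e) ->
  is_derive x 1 f l.
Proof.
move=> r0 cf Df dfl; apply: is_derive1_eps => e e0.
have [del del0 Hd] := dfl e e0.
exists (Num.min r del); first by rewrite lt_min r0.
move=> h; rewrite lt_min => /andP[hr hd].
have [->|h0] := eqVneq h 0; first by rewrite addr0 subrr scale0r subr0 normr0 mulr0.
have near_x y : y != x -> `|y - x| <= `|h| -> is_derive y 1 f (df y).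
  by move=> yx yh; apply: Df; rewrite normr_gt0 subr_eq0 yx (le_lt_trans yh).
have key a b : a < b -> (forall y, a <= y <= b -> `|y - x| <= `|h|) ->
    (forall y, a < y < b -> y != x) -> b - a = `|h| ->
    `|f b - f a - (b - a) * l| <= e * `|h|.
  move=> ab Hy yx ba.
  have Dy y : y \in `]a, b[%R -> is_derive y 1 f (df y).
    rewrite in_itv /= => yab; apply: near_x; first exact: yx.
    by case/andP: yab => ? ?; apply: Hy; rewrite !ltW.
  have cy : {within `[a, b], continuous f}.
    apply: within_itv_continuous => y yab; have [->//|yx'] := eqVneq y x.
    by apply: is_derive1_cont (near_x y yx' (Hy y yab)).
  have [c cab ->] := MVT ab Dy cy.
  move: cab; rewrite in_itv /= => cab.
  rewrite [df c * _]mulrC -mulrBr normrM ba normr_id mulrC ler_wpM2r //.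
  case/andP: (cab) => ca cb; apply: Hd.
  rewrite normr_gt0 subr_eq0 yx //= (le_lt_trans _ hd) //.
  by apply: Hy; rewrite !ltW.
have [hp|hn] := ltP 0 h.
  have := key x (x + h); rewrite [x + h]addrC addrK gtr0_norm //; apply => //.
  - by rewrite ltrDr.
  - by move=> y yab; rewrite ger0_norm; lra.
  - by move=> y /andP[xy _]; rewrite gt_eqF.
have {}hn : h < 0 by rewrite lt_neqAle h0.
have := key (x + h) x; rewrite [x + h]addrC ltr0_norm //.
rewrite (_ : x - (h + x) = - h); last by ring.
move=> K; rewrite -normrN.
have -> : - (f (h + x) - f x - h *: l) = f x - f (h + x) - - h * l.
  by rewrite /GRing.scale /=; ring.
apply: K => //; first by lra.
- by move=> y yab; rewrite ler_norml; lra.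
- by move=> y /andP[_ yx]; rewrite lt_eqF.
Qed.

(* The phase curve v = g(th) of a trajectory going from [a] to [b], extended by
   constants. *)
Record profile (R : realType) (U : R -> R) (mu gam a b : R) (g : R -> R) : Prop :=
  Profile {
    pf_lt : a < b;
    pf_le : forall x, x <= a -> g x = - mu;
    pf_ge : forall x, b <= x -> g x = mu;
    pf_in : forall x, a < x < b -> - mu < g x < mu;
    pf_cont : continuous g;
    pf_derive : forall x : R, a < x < b ->
      is_derive x 1 g (gam * Num.sqrt (U x - g x ^+ 2))
  }.

Definition pslope (R : realType) (U : R -> R) (gam a b : R) (g : R -> R) (x : R) :=
  if a < x < b then gam * Num.sqrt (U x - g x ^+ 2) else 0.

(** At [a] and [b] the slope gam sqrt(U - g^2) tends to 0, because U = mu^2 = g^2 there; hence the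
    extension by constants is differentiable on the whole line. *)
Lemma profile_derive (R : realType) (U : R -> R) (mu Ca Cb M gam a b : R) g :
  well U mu Ca M a -> well U mu Cb M b -> profile U mu gam a b g ->
  forall x : R, is_derive x 1 g (pslope U gam a b g x).
Proof.
move=> Ua Ub P x; have ab := pf_lt P.
have D y : y != a -> y != b -> is_derive y 1 g (pslope U gam a b g y).
  move=> ya yb; rewrite /pslope; case: ifPn => [/(pf_derive P)//|].
  rewrite negb_and -!leNgt => /orP[h|h].
    apply: is_derive1_near (is_derive1_cst (- mu) y).
    have {}h : y < a by rewrite lt_neqAle ya.
    near=> z; rewrite (pf_le P) // ltW //.
    by near: z; exact: lt_nbhsl.
  apply: is_derive1_near (is_derive1_cst mu y).
  have {}h : b < y by rewrite lt_neqAle eq_sym yb.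
  near=> z; rewrite (pf_ge P) // ltW //.
  by near: z; exact: lt_nbhsr.
have r0 : 0 < b - a by rewrite subr_gt0.
have key z (W : exists C, well U mu C M z) : g z ^+ 2 = mu ^+ 2 ->
    (forall y, 0 < `|y - z| < b - a -> y != a /\ y != b) ->
    is_derive z 1 g 0.
  have cg := pf_cont P.
  move=> gz Hz; apply: (@is_derive1_extend R g (pslope U gam a b g) z 0 (b - a) r0 (cg z)).
    by move=> y /Hz[]; exact: D.
  case: W => C W e e0.
  have cS : {for z, continuous (fun y => gam * Num.sqrt (U y - g y ^+ 2))}.
    apply: continuousM; first exact: cvg_cst.
    apply: continuous_comp; last exact: sqrt_continuous.
    apply: continuousB; first exact: (well_cont W).
    by apply: (@continuous_comp _ _ _ g (fun u => u ^+ 2)); [exact: (pf_cont P)|exact: exprn_continuous].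
  have E0 : gam * Num.sqrt (U z - g z ^+ 2) = 0.
    by rewrite (well_at W) gz subrr sqrtr0 mulr0.
  have N := cvgr_dist_lt _ _ cS _ e0.
  have [del /= del0 Hd] := (nbhs_ballP _ _).1 (N _).
  exists del => // y /andP[_ yd]; rewrite subr0 /pslope.
  case: ifP => _; last by rewrite normr0 ltW.
  have := Hd y; rewrite /ball /= distrC => /(_ yd); rewrite E0 sub0r normrN.
  exact: ltW.
have [->|xa] := eqVneq x a.
  rewrite /pslope ltxx /=; apply: key.
  - by exists Ca.
  - by rewrite (pf_le P) // sqrrN.
  - move=> y /andP[y0 yb]; split; first by rewrite -subr_eq0 -normr_gt0.
    apply/eqP => E; move: yb; rewrite E gtr0_norm ?ltxx //.
have [->|xb] := eqVneq x b.
  rewrite /pslope ltxx andbF /=; apply: key.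
  - by exists Cb.
  - by rewrite (pf_ge P).
  - move=> y /andP[y0 yb]; split; last by rewrite -subr_eq0 -normr_gt0.
    apply/eqP => E; move: yb; rewrite E distrC gtr0_norm ?ltxx //.
exact: D.
Unshelve. all: by end_near. Qed.

Section inverse_time.
Variables (R : realType) (U : R -> R) (mu Ca Cb M gam K0 a b : R) (r th v w m : R -> R).
Hypothesis Ua : well U mu Ca M a.
Hypothesis Ub : well U mu Cb M b.
Hypothesis T : transition U gam K0 a b r th v w m.
Hypothesis ab : a < b.

Let m0 t : 0 < m t. Proof. by case/andP: (tr_m T t). Qed.
Let vmu t : - mu < v t < mu.
Proof. by apply: (tr_v_bounds Ua Ub _ T); rewrite lt_eqF. Qed.

Lemma tr_U_gt t : 0 < U (th t) - v t ^+ 2.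
Proof.
have := well_ge Ub (th t); have /andP[h1 h2] := vmu t.
have : v t ^+ 2 < mu ^+ 2 by rewrite -subr_gt0 subr_sqr mulr_gt0; lra.
lra.
Qed.

(** U - v^2 > 0 prevents [w] from vanishing, so its sign is constant by the intermediate value
    theorem; a negative sign would make th decrease from [a] to the larger value [b]. *)
Lemma tr_w_gt0 t : 0 < w t.
Proof.
have wn0 s : w s != 0.
  by rewrite -sqrf_eq0 (tr_w T) gt_eqF // mulr_gt0 ?tr_U_gt // exprn_gt0.
rewrite ltNge le_eqVlt (negbTE (wn0 t)) /=; apply/negP => wt.
have wneg s : w s < 0.
  rewrite ltNge le_eqVlt eq_sym (negbTE (wn0 s)) /=; apply/negP => ws.
  have [|||c _ /eqP] := @IVT _ w (Num.min s t) (Num.max s t) 0; last by rewrite (negbTE (wn0 c)).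
  - by rewrite ge_min !le_max lexx.
  - by apply: continuous_subspaceT; exact: (tr_wc T).
  - have [st|ts] := leP s t; rewrite ge_min le_max; apply/andP; split; apply/orP;
      by [left; exact: ltW|right; exact: ltW].
have DN x := is_derive1_opp (tr_dth T x).
have dec s u : s <= u -> th u <= th s.
  move=> su; rewrite -lerN2; apply: (derive_ge0_homo DN) su => x _.
  by rewrite oppr_ge0 ltW.
have h1 : th 0 <= a.
  apply: (cvgr_to_ge (tr_thm T)); exists 0; split => // x x0.
  by apply: dec; exact: ltW.
have h2 : b <= th 0.
  apply: (cvgr_to_le (tr_thp T)); exists 0; split => // x x0.
  by apply: dec; exact: ltW.
by have := lt_le_trans ab (le_trans h2 h1); rewrite ltxx.
Qed.

Lemma tr_wE t : w t = m t * Num.sqrt (U (th t) - v t ^+ 2).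
Proof.
rewrite -[LHS](gtr0_norm (tr_w_gt0 t)) -sqrtr_sqr (tr_w T) sqrtrM ?sqr_ge0 //.
by rewrite sqrtr_sqr gtr0_norm.
Qed.

Lemma tr_th_lt s t : s < t -> th s < th t.
Proof.
move=> st; apply: (derive_gt0_lt st (fun x _ => tr_dth T x) _ (within_derive_itv (tr_dth T))).
by move=> x _; exact: tr_w_gt0.
Qed.

Lemma tr_th_le s t : (th s <= th t) = (s <= t).
Proof.
have [|/tr_th_lt h] := leP s t; last by rewrite leNgt h.
by rewrite le_eqVlt => /predU1P[->|/tr_th_lt/ltW //]; rewrite lexx.
Qed.

Lemma tr_th_inj : injective th.
Proof.
by move=> s t E; apply/eqP; rewrite eq_le -(tr_th_le s t) -(tr_th_le t s) E lexx.
Qed.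

Lemma tr_th_in t : a < th t < b.
Proof.
apply/andP; split.
  apply: (@le_lt_trans _ _ (th (t - 1))); last by apply: tr_th_lt; lra.
  apply: (cvgr_to_le (tr_thm T)); exists (t - 1); split=> [|x x0]; first exact: num_real.
  by rewrite tr_th_le ltW.
apply: (@lt_le_trans _ _ (th (t + 1))); first by apply: tr_th_lt; lra.
apply: (cvgr_to_ge (tr_thp T)); exists (t + 1); split=> [|x x0]; first exact: num_real.
by rewrite tr_th_le ltW.
Qed.

Lemma tr_th_onto x : a < x < b -> exists t, th t = x.
Proof.
move=> /andP[ax xb].
have [N1 [_ H1]] : \forall t \near -oo%R, th t < x by exact: (cvgr_lt _ (tr_thm T)).
have [N2 [_ H2]] : \forall t \near +oo%R, x < th t by exact: (cvgr_gt _ (tr_thp T)).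
have h1 := H1 (N1 - 1) (ltac:(lra)); have h2 := H2 (N2 + 1) (ltac:(lra)).
have le12 : N1 - 1 <= N2 + 1 by rewrite -tr_th_le ltW // (lt_trans h1).
have [||c _ cE] := @IVT _ th (N1 - 1) (N2 + 1) x le12; last by exists c.
  exact: within_derive_itv (tr_dth T).
by rewrite ge_min le_max (ltW h1) (ltW h2) orbT.
Qed.

Let S x := xget 0 [set t | th t = x].

Let thS x : a < x < b -> th (S x) = x.
Proof. by move=> /tr_th_onto[t tx]; rewrite /S; case: xgetP => [//|/(_ t)]. Qed.

Let Sth t : S (th t) = t.
Proof. exact/tr_th_inj/thS/tr_th_in. Qed.

(** The profile is v composed with the inverse of th. In v' / th' the factor [m] cancels, which
    removes r from the phase equation. Continuity at the two ends combines the monotonicity of v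
    with [tr_v_sup], applied to the transition and to its reversal. *)
Lemma transition_profile : exists g, profile U mu gam a b g /\ forall t, g (th t) = v t.
Proof.
pose g x := if x <= a then - mu else if b <= x then mu else v (S x).
have mu0 := well_mu Ua.
have gin x : a < x < b -> g x = v (S x).
  by move=> /andP[ax xb]; rewrite /g leNgt ax leNgt xb.
have gth t : g (th t) = v t by rewrite gin ?Sth // tr_th_in.
have DS x : a < x < b -> is_derive x 1 g (gam * Num.sqrt (U x - g x ^+ 2)).
  move=> xab; rewrite -(thS xab); set t := S x.
  have DT : is_derive (th t) 1 S (w t)^-1.
    apply: (is_derive_inverse (f := th)).
    - by near=> s; exact: Sth.
    - by near=> s; exact: is_derive1_cont (tr_dth T s).
    - exact: (tr_dth T).
    - by rewrite gt_eqF // tr_w_gt0.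
  have Dv : is_derive (S (th t)) 1 v (gam * m t * (U (th t) - v t ^+ 2)).
    by rewrite Sth; exact: (tr_dv T).
  have D := is_derive1_chain DT Dv.
  apply: (@is_derive1_near _ _ (fun x => v (S x))).
    have /andP[h1 h2] := tr_th_in t.
    near=> y; rewrite gin //; apply/andP; split; near: y.
      exact: lt_nbhsr.
    exact: lt_nbhsl.
  apply: (is_derive1_ext D) => //.
  rewrite gth tr_wE; have q0 := tr_U_gt t.
  have s0 : 0 < Num.sqrt (U (th t) - v t ^+ 2) by rewrite sqrtr_gt0.
  rewrite -[X in _ * X / _ = _](sqr_sqrtr (ltW q0)).
  by field; rewrite !gt_eqF.
have gb x : - mu <= g x <= mu.
  rewrite /g; case: ifP => _; first by lra.
  by case: ifP => _; [lra|case/andP: (vmu (S x)) => ? ?; rewrite !ltW].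
have gle x : x <= a -> g x = - mu by rewrite /g => ->.
have gge x : b <= x -> g x = mu.
  by move=> bx; rewrite /g bx leNgt (lt_le_trans ab bx).
exists g; split => //; split => //.
- by move=> x /gin ->; exact: vmu.
- move=> x; have [xa|ax] := leP x a; last have [bx|xb] := leP b x.
  + apply/cvgrPdist_lt => e e0; rewrite (gle x xa).
    have [t] := tr_v_sup Ua (transition_rev T) e0; rewrite ltrNr opprB => vt.
    have /andP[at' _] := tr_th_in (- t).
    near=> y.
    have : y <= th (- t).
      apply: ltW; near: y; exact: (lt_nbhsl (le_lt_trans xa at')).
    have /andP[g1 g2] := gb y.
    rewrite distrC ger0_norm opprK; last by lra.
    have [ya _|ay yt] := leP y a; first by rewrite (gle y) // addNr.
    have yin : a < y < b.
      by rewrite ay (le_lt_trans yt) //; case/andP: (tr_th_in (- t)).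
    rewrite gin // -ltrBrDr; apply: le_lt_trans vt.
    by apply: (tr_v_homo T); rewrite -tr_th_le thS.
  + apply/cvgrPdist_lt => e e0; rewrite (gge x bx).
    have [t vt] := tr_v_sup Ub T e0.
    have /andP[_ tb] := tr_th_in t.
    near=> y.
    have : th t <= y.
      apply: ltW; near: y; exact: (lt_nbhsr (lt_le_trans tb bx)).
    have /andP[g1 g2] := gb y.
    rewrite ger0_norm; last by lra.
    have [yb _|yb ty] := leP b y; first by rewrite (gge y) // subrr.
    have yin : a < y < b.
      by rewrite yb andbT (lt_le_trans _ ty) //; case/andP: (tr_th_in t).
    rewrite gin // ltrBlDr -ltrBlDl; apply: (lt_le_trans vt).
    by apply: (tr_v_homo T); rewrite -tr_th_le thS.
  + by apply: is_derive1_cont (DS x _); rewrite ax.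
Unshelve. all: by end_near. Qed.

End inverse_time.

(** * The wells of a potential in the class *)

Lemma periodic_bounded (R : realType) (f : R -> R) (T : R) : 0 < T ->
  continuous f -> (forall t, f (t + T) = f t) ->
  exists2 M : R, 0 <= M & forall t, `|f t| <= M.
Proof.
move=> T0 cf fT.
have ca : {within `[0, T], continuous (fun t => `|f t|)}.
  apply: continuous_subspaceT => t; apply: continuous_comp; first exact: cf.
  exact: norm_continuous.
have [c _ Hc] := EVT_max (ltW T0) ca.
exists `|f c| => // t.
pose n := Num.floor (t / T).
have /andP[n1 n2] := floor_itv (t / T).
have -> : f t = f (t - T *~ n).
  by rewrite -[in LHS](subrK (T *~ n) t) (periodic_int fT).
apply: Hc; rewrite in_itv /= subr_ge0; apply/andP; split.
  by rewrite -mulrzl -ler_pdivlMr.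
move: n2; rewrite intrD ltr_pdivrMr // -/n -mulrzl mulrDl; lra.
Qed.

Section class_wells.
Variables (R : realType) (th1 th2 : R) (U : R -> R).
Hypothesis hU : classU th1 th2 U.

Let Up t : U (t + 2 * pi) = U t. Proof. by case: hU. Qed.

Lemma classU_derive (t : R) : is_derive t 1 U (derive1 U t).
Proof. by case: hU => _ [dU _ _] _ _ _; rewrite derive1E; exact: derivableP. Qed.

Lemma classU_derive2 (t : R) : is_derive t 1 (derive1 U) (derive1 (derive1 U) t).
Proof. by case: hU => _ [_ dU _] _ _ _; rewrite derive1E; exact: derivableP. Qed.

Lemma derive1_periodic (f : R -> R) (T : R) :
  (forall t, f (t + T) = f t) -> (forall t : R, derivable f t 1) ->
  forall t, derive1 f (t + T) = derive1 f t.
Proof.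
move=> fT df t.
have D (s : R) : is_derive s 1 f (derive1 f s) by rewrite derive1E; exact: derivableP.
have DT : is_derive t 1 (fun s => s + T) 1.
  apply: (is_derive1_ext (is_derive1_add (is_derive1_id t) (is_derive1_cst T t))) => //.
  by rewrite addr0.
apply: (derive1_uniq _ (D t)).
apply: (is_derive1_ext (is_derive1_chain DT (D (t + T)))) => //.
by rewrite mulr1.
Qed.

Let T0 : 0 < 2 * (pi : R). Proof. by rewrite mulr_gt0 // pi_gt0. Qed.

Let D2p : forall t, derive1 (derive1 U) (t + 2 * pi) = derive1 (derive1 U) t.
Proof.
case: hU => _ [d1 d2 _] _ _ _.
by apply: derive1_periodic => //; apply: derive1_periodic.
Qed.

Lemma classU_Theta a : Theta th1 th2 a ->
  U a = U th1 /\ 0 < derive1 (derive1 U) a.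
Proof.
case: hU => _ _ _ [U12 _] [p1 p2] [n [->|->]].
  by rewrite (periodic_int Up) (periodic_int D2p).
by rewrite (periodic_int Up) (periodic_int D2p).
Qed.

Definition umin := Num.sqrt (U th1).

Lemma umin_gt0 : 0 < umin.
Proof. by case: hU => _ _ _ [_ U0] _; rewrite sqrtr_gt0. Qed.

Lemma umin_sqr : umin ^+ 2 = U th1.
Proof. by case: hU => _ _ _ [_ U0] _; rewrite sqr_sqrtr // ltW. Qed.

Lemma classU_cont : continuous U.
Proof. by move=> t; exact: is_derive1_cont (classU_derive t). Qed.

Lemma classU_crit a : Theta th1 th2 a -> derive1 U a = 0.
Proof.
move=> /classU_Theta[Ua _].
have := @derive1_at_min _ U (a - 1) (a + 1) a.
rewrite derive1E => H; apply: derive_val; apply: H.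
- lra.
- by move=> t _; case: hU => _ [].
- by rewrite in_itv /=; apply/andP; split; lra.
- by move=> t _; rewrite Ua; case: hU.
Qed.

(** The quadratic bound comes from two applications of the mean value theorem, starting from U'(a) =
    0, with U'' bounded by periodicity. The bounds are global, so one pair C, M serves all wells. *)
Lemma classU_wells : exists C M, forall a, Theta th1 th2 a -> well U umin C M a.
Proof.
have [C C0 HC] : exists2 C : R, 0 <= C & forall t, `|derive1 (derive1 U) t| <= C.
  by apply: (periodic_bounded T0 _ D2p); case: hU => _ [].
have [M _ HM] := periodic_bounded T0 classU_cont Up.
exists C, M => a Ha; have [Ua _] := classU_Theta Ha.
have Uge t : U th1 <= U t by case: hU.
split => //; rewrite ?umin_sqr //.
- exact: classU_cont.
- exact: umin_gt0.
- move=> x; rewrite -Ua.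
  have dle y : `|derive1 U y| <= C * `|y - a|.
    have := derive_abs_le a y classU_derive2 HC.
    by rewrite (classU_crit Ha) subr0.
  have key s t : s < t -> (forall y, s < y < t -> `|y - a| <= `|x - a|) ->
      t - s = `|x - a| -> `|U t - U s| <= C * (x - a) ^+ 2.
    move=> st Hy ts.
    have [c cin ->] := MVT st (fun y _ => classU_derive y) (within_derive_itv classU_derive).
    rewrite normrM ts normr_id -(real_normK (num_real (x - a))).
    rewrite expr2 mulrA ler_wpM2r // (le_trans (dle c)) // ler_wpM2l // Hy //.
  have [ax|xa|<-] := ltgtP a x.
  + apply: (le_trans (ler_norm _)); apply: key => //.
      by move=> y ?; rewrite !ger0_norm; lra.
    by rewrite gtr0_norm // subr_gt0.
  + apply: (le_trans (ler_norm _)); rewrite distrC; apply: key => //.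
      by move=> y ?; rewrite distrC (distrC x) !ger0_norm; lra.
    by rewrite distrC gtr0_norm // subr_gt0.
  + by rewrite !subrr expr0n mulr0.
- by move=> x; exact: le_trans (ler_norm _) (HM x).
Qed.

(* Nondegeneracy of the wells enters only here. *)
Lemma classU_not_flat a s t : Theta th1 th2 a -> s < t -> s <= a <= t ->
  ~ (forall x, s < x < t -> U x = U th1).
Proof.
move=> /classU_Theta[_ p] st sat H.
have D1 x : s < x < t -> derive1 U x = 0.
  move=> xst; apply: (derive1_uniq (classU_derive x)).
  apply: is_derive1_near (is_derive1_cst (U th1) x).
  case/andP: xst => sx xt; near=> y; rewrite H //; apply/andP; split; near: y.
    exact: lt_nbhsr.
  exact: lt_nbhsl.
have D2 x : s < x < t -> derive1 (derive1 U) x = 0.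
  move=> xst; apply: (derive1_uniq (classU_derive2 x)).
  apply: is_derive1_near (is_derive1_cst 0 x).
  case/andP: xst => sx xt; near=> y; rewrite D1 //; apply/andP; split; near: y.
    exact: lt_nbhsr.
  exact: lt_nbhsl.
have c2 : {for a, continuous (derive1 (derive1 U))} by case: hU => _ [_ _ c2] _ _ _; exact: c2.
have N := cvgr_gt _ c2 _ p.
have [del /= del0 Hd] := (nbhs_ballP _ _).1 (N _).
(* [a] may be an endpoint of [s, t]. With h the minimum of (t - s) / 2 and del / 2, [y] is [a]
   clamped into [s + h, t - h]: strictly inside the interval and within [del] of [a]. *)
pose y := Num.max (s + Num.min ((t - s) / 2) (del / 2)) (Num.min a (t - Num.min ((t - s) / 2) (del / 2))).
have hm : 0 < Num.min ((t - s) / 2) (del / 2) by rewrite lt_min; apply/andP; split; lra.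
have hm1 : Num.min ((t - s) / 2) (del / 2) <= (t - s) / 2 by rewrite ge_min lexx.
have hm2 : Num.min ((t - s) / 2) (del / 2) <= del / 2 by rewrite ge_min lexx orbT.
set h := Num.min ((t - s) / 2) (del / 2) in y hm hm1 hm2.
have yst : s < y < t.
  apply/andP; split; first by rewrite lt_max; apply/orP; left; lra.
  by rewrite gt_max; apply/andP; split; [lra|rewrite gt_min; apply/orP; right; lra].
have := Hd y; rewrite /ball /= (D2 y yst) ltxx => Hx.
suff : `|a - y| < del by move=> /Hx.
rewrite ltr_norml /y.
case/andP: sat => sa at'.
by rewrite /Num.max /Num.min; do 2 case: ifPn; rewrite -?leNgt => *; apply/andP; split; lra.
Unshelve. all: by end_near. Qed.

End class_wells.

(** * Monotonicity in the exponent *)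

Lemma acos_within_continuous (R : realType) :
  {within `[-1 : R, 1], continuous (@acos R)}.
Proof.
have pi0 : 0 <= (pi : R) by apply: ltW; exact: pi_gt0.
have := @segment_can_ge_continuous R 0 pi (@cos R) (@acos R) pi0.
rewrite cospi cos0; apply.
- by apply: continuous_subspaceT; exact: continuous_cos.
- exact: cosK.
Qed.

Lemma acos_comp_continuous (R : realType) (h : R -> R) :
  continuous h -> (forall x, -1 <= h x <= 1) -> continuous (fun x => acos (h x)).
Proof.
move=> ch hb x; apply/cvgrPdist_lt => e e0.
have /subspace_continuousP/(_ (h x)) := @acos_within_continuous R.
rewrite /= in_itv /= hb => /(_ isT) /cvgrPdist_lt /(_ e e0).
rewrite near_withinE => N.
have N2 : \forall y \near x, h y \in `[-1, 1]%R -> `|acos (h x) - acos (h y)| < e.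
  exact: (ch x _ N).
near=> y.
suff : h y \in `[-1, 1]%R -> `|acos (h x) - acos (h y)| < e.
  by rewrite in_itv /= hb; exact.
by near: y.
Unshelve. all: by end_near.
Qed.

Lemma profile_bound (R : realType) (U : R -> R) (mu gam a b : R) g :
  0 < mu -> profile U mu gam a b g -> forall x, - mu <= g x <= mu.
Proof.
move=> mu0 P x.
have [xa|ax] := leP x a; first by rewrite (pf_le P) //; lra.
have [bx|xb] := leP b x; first by rewrite (pf_ge P) //; lra.
by have /andP[h1 h2] := pf_in P (introT andP (conj ax xb)); rewrite !ltW.
Qed.

(* With g = - mu cos chi, the profile equation becomes
   chi' = gam sqrt((U - g^2) / (mu^2 - g^2)), whose right-hand side is
   nondecreasing in g^2; chi runs from 0 to pi. *)
Definition pangle (R : realType) (mu : R) (g : R -> R) (x : R) := acos (- g x / mu).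

Definition pspeed (R : realType) (U : R -> R) (mu : R) (g : R -> R) (x : R) :=
  Num.sqrt ((U x - g x ^+ 2) / (mu ^+ 2 - g x ^+ 2)).

Section pangle_at.
Variables (R : realType) (U : R -> R) (mu gam : R) (g : R -> R) (x : R).
Hypothesis mu0 : 0 < mu.
Hypothesis Uge : mu ^+ 2 <= U x.
Hypothesis gx : - mu < g x < mu.

(** Stated at a single point because the existence proof applies it to shooting solutions before
    they are known to be profiles. *)
Lemma pangle_derive_at : is_derive x 1 g (gam * Num.sqrt (U x - g x ^+ 2)) ->
  is_derive x 1 (pangle mu g) (gam * pspeed U mu g x).
Proof.
move=> Dg; have /andP[g1 g2] := gx.
have h : -1 < - g x / mu < 1 by rewrite ltr_pdivrMr // ltr_pdivlMr //; lra.
have D := is_derive1_mul (is_derive1_opp Dg) (is_derive1_cst mu^-1 x).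
apply: (is_derive1_ext (is_derive1_chain D (is_derive1_acos h))) => //.
have q0 : 0 < mu ^+ 2 - g x ^+ 2 by rewrite subr_sqr mulr_gt0; lra.
have u0 : 0 <= U x - g x ^+ 2 by have := Uge; lra.
have s0 : 0 < Num.sqrt (mu ^+ 2 - g x ^+ 2) by rewrite sqrtr_gt0.
rewrite /pspeed sqrtrM // sqrtrV ?ltW //.
have -> : Num.sqrt (1 - (- g x / mu) ^+ 2) = Num.sqrt (mu ^+ 2 - g x ^+ 2) / mu.
  have -> : mu ^+ 2 - g x ^+ 2 = mu ^+ 2 * (1 - (- g x / mu) ^+ 2).
    by field; rewrite gt_eqF.
  by rewrite sqrtrM ?sqr_ge0 // sqrtr_sqr gtr0_norm // mulrAC divff ?mul1r // gt_eqF.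
by field; rewrite !gt_eqF.
Qed.

Lemma pspeed_ge1_at : 1 <= pspeed U mu g x.
Proof.
have /andP[g1 g2] := gx.
have q0 : 0 < mu ^+ 2 - g x ^+ 2 by rewrite subr_sqr mulr_gt0; lra.
rewrite -[leLHS]sqrtr1 ler_sqrt; last by apply: divr_ge0; [have := Uge; lra|exact: ltW].
by rewrite ler_pdivlMr // mul1r; have := Uge; lra.
Qed.

End pangle_at.

Section pangle.
Variables (R : realType) (U : R -> R) (mu gam a b : R) (g : R -> R).
Hypothesis mu0 : 0 < mu.
Hypothesis Uge : forall x, mu ^+ 2 <= U x.
Hypothesis P : profile U mu gam a b g.

Let gb x : -1 <= - g x / mu <= 1.
Proof.
have := profile_bound mu0 P x; rewrite ler_pdivrMr // ler_pdivlMr //; lra.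
Qed.

Lemma pangle_itv x : 0 <= pangle mu g x <= pi.
Proof. by rewrite acos_ge0 ?acos_lepi // gb. Qed.

Lemma pangle_cont : continuous (pangle mu g).
Proof.
apply: acos_comp_continuous => [x|]; last exact: gb.
by apply: cvgM; [apply: cvgN; exact: (pf_cont P)|exact: cvg_cst].
Qed.

Lemma cos_pangle x : cos (pangle mu g x) = - g x / mu.
Proof. by rewrite acosK // in_itv /= gb. Qed.

Lemma pangle_derive x : a < x < b ->
  is_derive x 1 (pangle mu g) (gam * pspeed U mu g x).
Proof.
by move=> xab; apply: pangle_derive_at => //; [exact: (pf_in P)|exact: (pf_derive P)].
Qed.

Lemma pspeed_ge1 x : a < x < b -> 1 <= pspeed U mu g x.
Proof. by move=> xab; apply: pspeed_ge1_at => //; exact: (pf_in P). Qed.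

End pangle.

Section comparison.
Variables (R : realType) (U : R -> R) (mu gam1 gam2 a b : R) (g1 g2 : R -> R).
Hypothesis mu0 : 0 < mu.
Hypothesis Uge : forall x, mu ^+ 2 <= U x.
Hypothesis gam1_gt0 : 0 < gam1.
Hypothesis gam12 : gam1 < gam2.
Hypothesis P1 : profile U mu gam1 a b g1.
Hypothesis P2 : profile U mu gam2 a b g2.

Let d x := pangle mu g2 x - pangle mu g1 x.

Let dd x := gam2 * pspeed U mu g2 x - gam1 * pspeed U mu g1 x.

Let d_derive x : a < x < b -> is_derive x 1 d (dd x).
Proof.
by move=> xab; apply: is_derive1_sub;
  [exact: (pangle_derive mu0 Uge P2)|exact: (pangle_derive mu0 Uge P1)].
Qed.

Let d_cont : continuous d.
Proof.
by move=> x; apply: cvgB; [exact: (pangle_cont mu0 P2)|exact: (pangle_cont mu0 P1)].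
Qed.

Let dd_gt0 x : a < x < b -> g1 x ^+ 2 <= g2 x ^+ 2 -> 0 < dd x.
Proof.
move=> xab y12; have p2 := pspeed_ge1 Uge P2 xab.
have /andP[h1 h2] := pf_in P1 xab; have /andP[h3 h4] := pf_in P2 xab.
have q1 : 0 < mu ^+ 2 - g1 x ^+ 2 by rewrite subr_sqr mulr_gt0; lra.
have q2 : 0 < mu ^+ 2 - g2 x ^+ 2 by rewrite subr_sqr mulr_gt0; lra.
have L : pspeed U mu g1 x <= pspeed U mu g2 x.
  rewrite /pspeed ler_sqrt; last by apply: divr_ge0; [have := Uge x; lra|exact: ltW].
  rewrite ler_pdivrMr // mulrAC ler_pdivlMr //.
  have h5 : 0 <= U x - mu ^+ 2 by have := Uge x; lra.
  have h6 : 0 <= g2 x ^+ 2 - g1 x ^+ 2 by lra.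
  by have := mulr_ge0 h5 h6; lra.
have h5 := ler_wpM2l (ltW gam1_gt0) L.
have h6 : 0 < (gam2 - gam1) * pspeed U mu g2 x by apply: mulr_gt0; [rewrite subr_gt0|apply: lt_le_trans p2].
by rewrite /dd; lra.
Qed.

Let d_lt0 x : d x < 0 -> g2 x < g1 x.
Proof.
rewrite /d subr_lt0 => H.
have : cos (pangle mu g1 x) < cos (pangle mu g2 x).
  by rewrite ltr_cos // in_itv /= ?(pangle_itv mu0 P1) ?(pangle_itv mu0 P2).
by rewrite (cos_pangle mu0 P1) (cos_pangle mu0 P2) ltr_pM2r ?invr_gt0 // ltrN2.
Qed.

Let d_gt0 x : 0 < d x -> g1 x < g2 x.
Proof.
rewrite /d subr_gt0 => H.
have : cos (pangle mu g2 x) < cos (pangle mu g1 x).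
  by rewrite ltr_cos // in_itv /= ?(pangle_itv mu0 P1) ?(pangle_itv mu0 P2).
by rewrite (cos_pangle mu0 P1) (cos_pangle mu0 P2) ltr_pM2r ?invr_gt0 // ltrN2.
Qed.

Let d_eq0 x : d x = 0 -> g1 x = g2 x.
Proof.
move=> /eqP; rewrite subr_eq0 => /eqP /(congr1 cos).
rewrite (cos_pangle mu0 P1) (cos_pangle mu0 P2) => /mulIf.
by rewrite invr_eq0 gt_eqF // => /(_ isT) /oppr_inj.
Qed.

Let ab := pf_lt P1.

Let d_a : d a = 0.
Proof. by rewrite /d /pangle (pf_le P1) // (pf_le P2) // subrr. Qed.

Let d_b : d b = 0.
Proof. by rewrite /d /pangle (pf_ge P1) // (pf_ge P2) // subrr. Qed.

(** Near [a] both profiles are negative, so d < 0 means g2 < g1 < 0; hence g1^2 < g2^2 and d' > 0. A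
    negative minimum [k] of d on [a, s] is not at [a], where d = 0, and just to the left of [k] the
    function d would be smaller still. *)
Lemma comparison_left : exists2 c, a < c < b & forall s, a < s < c -> 0 <= d s.
Proof.
have N1 : \forall x \near a, g1 x < 0.
  by apply: (cvgr_lt _ (pf_cont P1 (x := a))); rewrite (pf_le P1) // oppr_lt0.
have N2 : \forall x \near a, g2 x < 0.
  by apply: (cvgr_lt _ (pf_cont P2 (x := a))); rewrite (pf_le P2) // oppr_lt0.
have [e /= e0 He] := (nbhs_ballP _ _).1 (filterI N1 N2).
pose c := a + Num.min e (b - a) / 2.
have m0 : 0 < Num.min e (b - a) by rewrite lt_min e0 subr_gt0.
have m1 : Num.min e (b - a) <= e by rewrite ge_min lexx.
have m2 : Num.min e (b - a) <= b - a by rewrite ge_min lexx orbT.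
exists c; first by rewrite /c; apply/andP; split; lra.
move=> s sac; have /andP[as' sc] := sac; rewrite leNgt; apply/negP => ds.
have [k kas kmin] := EVT_min (ltW as') (continuous_subspaceT d_cont).
move: kas; rewrite in_itv /= => /andP[ak ks].
have dk : d k < 0.
  by apply: (le_lt_trans _ ds); apply: kmin; rewrite in_itv /= lexx (ltW as').
have ak' : a < k.
  by rewrite lt_neqAle ak andbT; apply/eqP => E; move: dk; rewrite -E d_a ltxx.
have kab : a < k < b by rewrite ak' /=; rewrite /c in sc; lra.
have [n1 n2] : g1 k < 0 /\ g2 k < 0.
  by apply: He; rewrite /ball /= ltr_norml; rewrite /c in sc; lra.
have p : 0 < dd k by apply: dd_gt0 => //; have := d_lt0 dk; nra.
have [h h0 Hh] := is_derive_near_gt (d_derive kab) p.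
pose y := Num.min (h / 2) (k - a).
have y0 : 0 < y by rewrite lt_min subr_gt0 ak' divr_gt0.
have y1 : y <= h / 2 by rewrite ge_min lexx.
have y2 : y <= k - a by rewrite ge_min lexx orbT.
have /andP[+ _] := Hh y (ltac:(lra)).
rewrite ltNge kmin // in_itv /=; apply/andP; split; lra.
Qed.

(** Near [b] both profiles are positive, so d > 0 means 0 < g1 < g2 and again d' > 0; a positive
    maximum of d on [s, b] would be exceeded just to its right. *)
Lemma comparison_right : exists2 c, a < c < b & forall s, c < s < b -> d s <= 0.
Proof.
have N1 : \forall x \near b, 0 < g1 x.
  by apply: (cvgr_gt _ (pf_cont P1 (x := b))); rewrite (pf_ge P1).
have N2 : \forall x \near b, 0 < g2 x.
  by apply: (cvgr_gt _ (pf_cont P2 (x := b))); rewrite (pf_ge P2).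
have [e /= e0 He] := (nbhs_ballP _ _).1 (filterI N1 N2).
pose c := b - Num.min e (b - a) / 2.
have m0 : 0 < Num.min e (b - a) by rewrite lt_min e0 subr_gt0.
have m1 : Num.min e (b - a) <= e by rewrite ge_min lexx.
have m2 : Num.min e (b - a) <= b - a by rewrite ge_min lexx orbT.
exists c; first by rewrite /c; apply/andP; split; lra.
move=> s sac; have /andP[cs sb] := sac; rewrite leNgt; apply/negP => ds.
have [k kas kmax] := EVT_max (ltW sb) (continuous_subspaceT d_cont).
move: kas; rewrite in_itv /= => /andP[sk kb].
have dk : 0 < d k.
  by apply: (lt_le_trans ds); apply: kmax; rewrite in_itv /= lexx (ltW sb).
have kb' : k < b.
  by rewrite lt_neqAle kb andbT; apply/eqP => E; move: dk; rewrite E d_b ltxx.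
have kab : a < k < b by rewrite kb' andbT; rewrite /c in cs; lra.
have [n1 n2] : 0 < g1 k /\ 0 < g2 k.
  by apply: He; rewrite /ball /= ltr_norml; rewrite /c in cs; lra.
have p : 0 < dd k by apply: dd_gt0 => //; have := d_gt0 dk; nra.
have [h h0 Hh] := is_derive_near_gt (d_derive kab) p.
pose y := Num.min (h / 2) (b - k).
have y0 : 0 < y by rewrite lt_min subr_gt0 kb' divr_gt0.
have y1 : y <= h / 2 by rewrite ge_min lexx.
have y2 : y <= b - k by rewrite ge_min lexx orbT.
have /andP[_ +] := Hh y (ltac:(lra)).
rewrite ltNge kmax // in_itv /=; apply/andP; split; lra.
Qed.

(** At a zero of d the two profiles agree and gam1 < gam2, so d crosses zero upwards. Hence d cannot
    vanish at [s1], since it would become positive to the right of it, so d(s1) < 0 <= d(s0). The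
    supremum [c] of the points of [s0, s1] with d >= 0 is then an interior zero, to the right of
    which d is positive: a contradiction. *)
Lemma profile_gam_lt_absurd : False.
Proof.
have [c1 c1ab L] := comparison_left; have [c2 c2ab Rg] := comparison_right.
have Z x : a < x < b -> d x = 0 -> exists2 h, 0 < h &
    forall y, 0 < y < h -> d (x - y) < 0 < d (x + y).
  move=> xab dx; have p : 0 < dd x by apply: dd_gt0 => //; rewrite (d_eq0 dx).
  by have := is_derive_near_gt (d_derive xab) p; rewrite dx.
pose s0 := a + Num.min (c1 - a) (c2 - a) / 2.
pose s1 := b - Num.min (b - c1) (b - c2) / 2.
have m0 : 0 < Num.min (c1 - a) (c2 - a) by rewrite lt_min; apply/andP; split; lra.
have m1 : Num.min (c1 - a) (c2 - a) <= c1 - a by rewrite ge_min lexx.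
have m2 : Num.min (c1 - a) (c2 - a) <= c2 - a by rewrite ge_min lexx orbT.
have m3 : 0 < Num.min (b - c1) (b - c2) by rewrite lt_min; apply/andP; split; lra.
have m4 : Num.min (b - c1) (b - c2) <= b - c1 by rewrite ge_min lexx.
have m5 : Num.min (b - c1) (b - c2) <= b - c2 by rewrite ge_min lexx orbT.
have s01 : s0 < s1 by rewrite /s0 /s1; lra.
have s0in : a < s0 < c1 by rewrite /s0; lra.
have s1in : c2 < s1 < b by rewrite /s1; lra.
have d0 : 0 <= d s0 by apply: L.
have d1 : d s1 < 0.
  rewrite lt_neqAle (Rg s1 s1in) andbT; apply/eqP => ds.
  have [h h0 Hh] := Z s1 (ltac:(lra)) ds.
  pose y := Num.min (h / 2) ((b - s1) / 2).
  have y0 : 0 < y by rewrite lt_min !divr_gt0 // subr_gt0; lra.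
  have y1 : y <= h / 2 by rewrite ge_min lexx.
  have y2 : y <= (b - s1) / 2 by rewrite ge_min lexx orbT.
  have /andP[_ +] := Hh y (ltac:(lra)); rewrite ltNge Rg //; lra.
pose A := [set x | s0 <= x <= s1 /\ 0 <= d x].
have sA : has_sup A.
  split; first by exists s0; split => //; rewrite lexx ltW.
  by exists s1 => x [/andP[]].
pose c := sup A.
have cub x : A x -> x <= c by move=> Ax; apply: (sup_upper_bound sA).
have s0c : s0 <= c by apply: cub; split => //; rewrite lexx ltW.
have cs1 : c <= s1 by apply: ge_sup => [|x [/andP[]//]]; case: sA.
have cab : a < c < b by lra.
have cneq : d c != d s1 -> c < s1.
  by move=> h; rewrite lt_neqAle cs1 andbT; apply: contra h => /eqP ->.
have right_absurd h : 0 < h -> (forall y, 0 < y < h -> 0 < d (c + y)) -> c < s1 -> False.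
  move=> h0 Hh c1'.
  pose y := Num.min (h / 2) (s1 - c).
  have y0 : 0 < y by rewrite lt_min subr_gt0 c1' divr_gt0.
  have y1 : y <= h / 2 by rewrite ge_min lexx.
  have y2 : y <= s1 - c by rewrite ge_min lexx orbT.
  suff : c + y <= c by lra.
  by apply: cub; split; [lra|apply: ltW; apply: Hh; lra].
have [dc|dc|dc] := ltgtP (d c) 0.
- have N : \forall x \near c, d x < 0 by exact: (cvgr_lt _ (d_cont (x := c))).
  have [e /= e0 He] := (nbhs_ballP _ _).1 N.
  have [x Ax xc] := sup_adherent e0 sA.
  have : d x < 0.
    by apply: He; rewrite /ball /= ger0_norm ?subr_ge0 ?cub // ltrBlDr -ltrBlDl.
  by case: Ax => _; rewrite leNgt => /negP.
- have N : \forall x \near c, 0 < d x by exact: (cvgr_gt _ (d_cont (x := c))).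
  have [e /= e0 He] := (nbhs_ballP _ _).1 N.
  apply: (right_absurd e e0).
    by move=> y /andP[y0 ye]; apply: He; rewrite /ball /= opprD addNKr normrN gtr0_norm.
  by apply: cneq; rewrite gt_eqF // (lt_trans d1).
- have [h h0 Hh] := Z c cab dc.
  apply: (right_absurd h h0).
    by move=> y /Hh /andP[].
  by apply: cneq; rewrite dc gt_eqF.
Qed.

End comparison.

(** * Existence of profiles *)

Lemma ultra_compact_cvg (R : realType) (V : normedModType R) (G : set_system nat)
    (A : set V) (y : nat -> V) :
  UltraFilter G -> compact A -> (forall N, A (y N)) ->
  exists l : V, y x @[x --> G] --> l.
Proof.
move=> UG cA yA.
have FA : G (y @^-1` A).
  by rewrite (_ : y @^-1` A = setT); [exact: filterT|apply/seteqP; split => // N _; exact: yA].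
have [p [_ cl]] := cA (fmap y G) _ FA.
exists (p : V) => B nB.
have [//|H] := @in_ultra_setVsetC _ G (y @^-1` B) UG.
have [z [h1 h2]] := cl (~` B) B H nB.
by [].
Qed.

(** * Peano's theorem through Euler's scheme *)

Section euler.
Variables (R : realType) (V : normedModType R) (f : R -> V -> V) (M : R).
Hypothesis fM : forall t y, `|f t y| <= M.

Fixpoint euler (h : R) (y0 : V) (k : nat) : V :=
  if k is k'.+1 then euler h y0 k' + h *: f (k'%:R * h) (euler h y0 k') else y0.

Lemma euler_lip h y0 k n : 0 <= h ->
  `|euler h y0 (k + n) - euler h y0 k| <= n%:R * h * M.
Proof.
move=> h0; elim: n => [|n IH]; first by rewrite addn0 subrr normr0 !mul0r.
rewrite addnS /= addrAC (le_trans (ler_normD _ _)) //.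
rewrite -[n.+1%:R]natr1 !mulrDl mul1r lerD // normrZ ger0_norm //.
exact: ler_wpM2l.
Qed.

Lemma euler_local h y0 k n c e : 0 <= h ->
  (forall j, (k <= j < k + n)%N -> `|f (j%:R * h) (euler h y0 j) - c| <= e) ->
  `|euler h y0 (k + n) - euler h y0 k - (n%:R * h) *: c| <= n%:R * h * e.
Proof.
move=> h0; elim: n => [|n IH] H.
  by rewrite addn0 subrr sub0r !mul0r scale0r oppr0 normr0.
rewrite addnS /= -[n.+1%:R]natr1 !mulrDl mul1r scalerDl.
set A := euler h y0 (k + n).
have -> : A + h *: f ((k + n)%:R * h) A - euler h y0 k - ((n%:R * h) *: c + h *: c) =
  (A - euler h y0 k - (n%:R * h) *: c) + h *: (f ((k + n)%:R * h) A - c).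
  by rewrite scalerBr opprD (addrAC A) addrACA.
rewrite (le_trans (ler_normD _ _)) // lerD //.
  by apply: IH => j /andP[kj jn]; apply: H; rewrite kj addnS ltnS ltnW.
rewrite normrZ ger0_norm // ler_wpM2l // H //.
by rewrite leq_addr addnS ltnSn.
Qed.

Hypothesis fc : continuous (fun p : R * V => f p.1 p.2).
Hypothesis Vc : forall B : R, compact [set y : V | `|y| <= B].
Variables (B : R) (y0 : nat -> V).
Hypothesis y0B : forall N, `|y0 N| <= B.

Let M0 : 0 <= M. Proof. exact: le_trans (fM 0 0). Qed.

Let h (N : nat) : R := N.+1%:R^-1.
Let h0 N : 0 < h N. Proof. by rewrite invr_gt0 ltr0n. Qed.

(** The scheme with step 1 / (N + 1), frozen between nodes; the jumps account for the extra terms in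
    [h N] below. The initial value may depend on N, as the shooting argument requires. *)
Definition euler_step (N : nat) (t : R) : V :=
  euler (N.+1%:R^-1) (y0 N) (Num.truncn (t * N.+1%:R)).

Let idx N (t : R) := Num.truncn (t * N.+1%:R).

Let idxP N t : 0 <= t -> (idx N t)%:R * h N <= t < (idx N t)%:R * h N + h N.
Proof.
move=> t0; have Np : 0 < N.+1%:R :> R by rewrite ltr0n.
have /andP[h1 h2] := truncn_itv (mulr_ge0 t0 (ltW Np)).
rewrite /h -[X in _ + X]mul1r -mulrDl natr1.
by rewrite ler_pdivrMr // ltr_pdivlMr // h1.
Qed.

Let idx_le N s t : s <= t -> (idx N s <= idx N t)%N.
Proof. by move=> st; apply: le_truncn; rewrite ler_pM2r // ltr0n. Qed.

Lemma euler_step_lip N s t : 0 <= s -> s <= t ->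
  `|euler_step N t - euler_step N s| <= (t - s + h N) * M.
Proof.
move=> s0 st; have t0 := le_trans s0 st.
rewrite /euler_step -/(idx N s) -/(idx N t) -(subnKC (idx_le N st)).
apply: (le_trans (euler_lip _ _ _ (ltW (h0 N)))); apply: ler_wpM2r => //.
rewrite natrB ?idx_le // mulrBl.
have /andP[? ?] := idxP N s0; have /andP[? ?] := idxP N t0; lra.
Qed.

Lemma euler_step_bound N t : 0 <= t -> `|euler_step N t| <= B + (t + 1) * M.
Proof.
move=> t0; have := euler_step_lip N (lexx 0) t0.
rewrite /euler_step mul0r truncn0 /= subr0 => H.
rewrite -[X in `|X|](subrK (y0 N)) (le_trans (ler_normD _ _)) // addrC lerD //.
apply: (le_trans H); rewrite ler_wpM2r // lerD2l /h invf_le1 ?ler1n ?ltr0n //.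
Qed.

(** The node preceding [s] may lie up to [h N] before it, whence the enlarged range of times in the
    hypothesis on [f]. *)
Lemma euler_step_local N s t (c : V) e : 0 <= s -> s <= t -> 0 <= e ->
  (forall u z, s - h N <= u <= t -> `|z - euler_step N s| <= (t - s + h N) * M ->
     `|f u z - c| <= e) ->
  `|euler_step N t - euler_step N s - (t - s) *: c| <=
     (t - s) * e + h N * (e + `|c|).
Proof.
move=> s0 st e0 H; have t0 := le_trans s0 st.
set k := idx N s; set n := (idx N t - idx N s)%N.
have kn : (k + n)%N = idx N t by rewrite subnKC // idx_le.
have nE : n%:R = (idx N t)%:R - k%:R :> R by rewrite natrB // idx_le.
have /andP[s1 s2] := idxP N s0; have /andP[t1 t2] := idxP N t0.
have L := @euler_local (h N) (y0 N) k n c e (ltW (h0 N)).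
have {}L : `|euler_step N t - euler_step N s - (n%:R * h N) *: c| <= n%:R * h N * e.
  rewrite /euler_step -/(idx N t) -/(idx N s) -kn; apply: L => j /andP[kj jn].
  have jt : (j%:R : R) * h N <= t.
    apply: le_trans t1; rewrite ler_pM2r // ler_nat -kn; exact: ltnW.
  have js : (k%:R : R) * h N <= j%:R * h N by rewrite ler_pM2r // ler_nat.
  apply: H; first by apply/andP; split; [rewrite -/k in s2; lra|].
  rewrite /euler_step -/(idx N s) -(subnKC kj).
  apply: (le_trans (euler_lip _ _ _ (ltW (h0 N)))); apply: ler_wpM2r => //.
  rewrite natrB // mulrBl; rewrite -/k in s2; lra.
have nh : `|n%:R * h N - (t - s)| <= h N.
  by rewrite nE mulrBl ler_norml /k; apply/andP; split; lra.
have -> : euler_step N t - euler_step N s - (t - s) *: c =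
   (euler_step N t - euler_step N s - (n%:R * h N) *: c) + (n%:R * h N - (t - s)) *: c.
  by rewrite [X in _ = _ + X]scalerBl addrA subrK.
rewrite (le_trans (ler_normD _ _)) // normrZ.
have := ler_wpM2r (normr_ge0 c) nh.
have : n%:R * h N * e <= (t - s + h N) * e.
  apply: ler_wpM2r => //; move: nh; rewrite ler_norml => /andP[]; lra.
lra.
Qed.

(* Euler polygons converge along an ultrafilter, which replaces
   Arzela-Ascoli. *)
Lemma peano : exists (G : set_system nat) (y : R -> V),
  [/\ ProperFilter G, forall A, \oo A -> G A,
      forall t, 0 <= t -> euler_step N t @[N --> G] --> y t &
      forall t : R, 0 <= t -> is_derive t 1 y (f t (y t))].
Proof.
have [G [UG GO]] := ultraFilterLemma eventually_filter.
have PG : ProperFilter G by exact: ultra_proper.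
have L t : exists l : V, 0 <= t -> euler_step N t @[N --> G] --> l.
  have [t0|tn] := leP 0 t; last by exists 0.
  have [l Hl] := @ultra_compact_cvg R V G _ (fun N => euler_step N t) UG
    (@Vc (B + (t + 1) * M)) (fun N => euler_step_bound N t0).
  by exists l.
have {L}[yl Hyl] := choice L.
(* Continued by its tangent for negative times, so that the derivative at 0 is two-sided. *)
pose y t := if 0 <= t then yl t else yl 0 + t *: f 0 (yl 0).
have Hy t : 0 <= t -> euler_step N t @[N --> G] --> y t.
  by move=> t0; rewrite /y t0; exact: Hyl.
exists G, y; split => // t t0; apply: is_derive1_eps => e e0.
set c := f t (y t).
have fct := @fc (t, y t).
have [rho /= rho0 Hrho] := (nbhs_ballP _ _).1 ((cvgrPdist_le _ _).1 fct e e0).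
(* Over a time less than del + h N, with h N < del, Euler values move by at most 2 del (M + 1) = rho
   / 4. Two such moves and an error rho / 4 between scheme and limit stay within [rho] of y t. *)
pose del := rho / (8 * (M + 1)).
have M1 : 0 < M + 1 by rewrite ltr_wpDl.
have del0 : 0 < del by rewrite divr_gt0 // mulr_gt0.
have delM : 8 * (del * (M + 1)) = rho by rewrite /del; field; rewrite gt_eqF.
have del4 : 4 * del <= rho.
  by have := mulr_ge0 (ltW del0) M0; rewrite -delM; lra.
have key s u : 0 <= s -> s <= u -> (s = t \/ u = t) -> u - s < del ->
    `|y u - y s - (u - s) *: c| <= e * (u - s).
  move=> s0 su stu usd; have u0 := le_trans s0 su.
  apply/ler_addgt0Pr => eta eta0.
  have ch : 0 < e + `|c| + 1 by rewrite ltr_wpDl // addr_ge0 // ltW.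
  have GS (x : R) : 0 < x -> G [set N | h N < x].
    by move=> x0; apply: GO; exact: (near_infty_natSinv_lt (PosNum x0)).
  have F3 : 0 < eta / 3 by rewrite divr_gt0.
  have q0 : 0 < eta / 3 / (e + `|c| + 1) by rewrite divr_gt0.
  have r2 : 0 < rho / 4 by rewrite divr_gt0.
  (* A single [N] meets all the requirements because [G] is a proper filter containing each of them.
     The slack [eta] is split in three: the limits at [s] and at [u], and the term in [h N]. *)
  have [N] := @filter_ex _ G _ _ (filterI (filterI (GS _ del0) (GS _ q0))
     (filterI (filterI ((cvgrPdist_le _ _).1 (Hy s s0) _ r2) ((cvgrPdist_le _ _).1 (Hy u u0) _ r2))
     (filterI ((cvgrPdist_le _ _).1 (Hy s s0) _ F3) ((cvgrPdist_le _ _).1 (Hy u u0) _ F3)))).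
  move=> [[/= hd hq] [[/= ys4 yu4] [/= ys3 yu3]]].
  have hN := h0 N.
  have hM : (u - s + h N) * M <= 2 * (del * (M + 1)) by nra.
  have local := @euler_step_local N s u c e s0 su (ltW e0).
  have {}local : `|euler_step N u - euler_step N s - (u - s) *: c| <=
     (u - s) * e + h N * (e + `|c|).
    apply: local => v z /andP[v1 v2] zs.
    rewrite distrC; apply: (Hrho (v, z)); split => /=.
      rewrite /ball /= ltr_norml.
      by case: stu => <-; apply/andP; split; lra.
    rewrite -[X in X _]/(ball (y t) rho) -ball_normE /=.
    have zlt : `|z - euler_step N s| <= 2 * (del * (M + 1)) by exact: le_trans zs hM.
    have sz : `|y s - z| < rho.
      have -> : y s - z = (y s - euler_step N s) - (z - euler_step N s).
        by rewrite opprB addrA subrK.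
      by rewrite (le_lt_trans (ler_normB _ _)) //; lra.
    case: stu => <- //.
    have -> : y u - z = (y u - euler_step N u) + ((euler_step N u - euler_step N s) - (z - euler_step N s)).
      by rewrite opprB [X in _ = _ + X]addrA subrK addrA subrK.
    rewrite (le_lt_trans (ler_normD _ _)) // (le_lt_trans (lerD (lexx _) (ler_normB _ _))) //.
    have := euler_step_lip N s0 su.
    have : (u - s + h N) * M <= 2 * del * M.
      by rewrite ler_wpM2r //; lra.
    lra.
  have -> : y u - y s - (u - s) *: c = (euler_step N u - euler_step N s - (u - s) *: c) +
     ((y u - euler_step N u) - (y s - euler_step N s)).
    rewrite [RHS]addrAC; congr (_ - _).
    by rewrite [- (y s - _)]opprD opprK addrACA (addrC (euler_step N u)) subrK (addrC (- y s)) addKr.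
  rewrite (le_trans (ler_normD _ _)) // (le_trans (lerD (lexx _) (ler_normB _ _))) //.
  have : h N * (e + `|c|) <= eta / 3.
    rewrite ltr_pdivlMr // in hq; lra.
  lra.
exists (if t == 0 then del else Num.min del t).
  by case: ifPn => // tn0; rewrite lt_min del0 lt_neqAle eq_sym tn0.
move=> k kdt.
have kd : `|k| < del by move: kdt; case: ifP => // _; rewrite lt_min => /andP[].
have [tk|tk] := leP 0 (t + k); last first.
  have t00 : t = 0.
    apply/eqP; apply: contraT => tn0; move: kdt; rewrite (negbTE tn0) lt_min.
    by move=> /andP[_]; rewrite ltr_norml => /andP[? _]; lra.
  rewrite /c /y t00 lexx add0r; move: tk; rewrite t00 add0r ltNge => /negbTE ->.
  by rewrite [yl 0 + _]addrC addrK subrr normr0 mulr_ge0 // ltW.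
have [k0|k0] := leP 0 k.
  have := key t (t + k) t0; rewrite [t + k]addrC addrK ger0_norm //; apply => //.
  - by rewrite lerDr.
  - by left.
  - by rewrite -(ger0_norm k0).
have := key (t + k) t tk; rewrite (_ : t - (t + k) = - k); last by ring.
move=> K; rewrite -normrN ltr0_norm //.
have -> : - (y (t + k) - y t - k *: c) = y t - y (t + k) - (- k) *: c.
  by rewrite scaleNr opprK !opprB addrC.
apply: K; first by lra.
- by right.
- by rewrite -(ltr0_norm k0).
Qed.

End euler.

Lemma continuous_pair (T A B : topologicalType) (f : T -> A) (g : T -> B) (x : T) :
  {for x, continuous f} -> {for x, continuous g} ->
  {for x, continuous (fun t => (f t, g t))}.
Proof. by move=> cf cg; exact: (cvg_pair cf cg). Qed.

Lemma normr_pair_le (R : realType) (p : R * R) (B : R) :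
  (`|p| <= B) = (`|p.1| <= B) && (`|p.2| <= B).
Proof. by rewrite prod_normE ge_max. Qed.

Lemma compact_pair_ball (R : realType) (B : R) : compact [set p : R * R | `|p| <= B].
Proof.
have -> : [set p : R * R | `|p| <= B] = `[- B, B]%classic `*` `[- B, B]%classic.
  apply/seteqP; split => p /=; rewrite normr_pair_le !in_itv /= !ler_norml.
    by move=> /andP[].
  by move=> [-> ->].
by apply: compact_setX; exact: segment_compact.
Qed.

Lemma is_derive1_fst (R : realType) (y : R -> R * R) (t : R) (d : R * R) :
  is_derive t 1 y d -> is_derive t 1 (fun s => (y s).1) d.1.
Proof.
move=> [Dy dE].
have C : h^-1 *: (y (h *: (1 : R) + t) - y t) @[h --> (0 : R)^'] --> d.
  by rewrite -dE; exact: Dy.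
have C1 : h^-1 *: ((y (h *: (1 : R) + t)).1 - (y t).1) @[h --> (0 : R)^'] --> d.1.
  exact: (cvg_comp _ _ C cvg_fst).
by split; [exact: cvgP C1|exact: cvg_lim C1].
Qed.

Lemma is_derive1_snd (R : realType) (y : R -> R * R) (t : R) (d : R * R) :
  is_derive t 1 y d -> is_derive t 1 (fun s => (y s).2) d.2.
Proof.
move=> [Dy dE].
have C : h^-1 *: (y (h *: (1 : R) + t) - y t) @[h --> (0 : R)^'] --> d.
  by rewrite -dE; exact: Dy.
have C1 : h^-1 *: ((y (h *: (1 : R) + t)).2 - (y t).2) @[h --> (0 : R)^'] --> d.2.
  exact: (cvg_comp _ _ C cvg_snd).
by split; [exact: cvgP C1|exact: cvg_lim C1].
Qed.

(** * Shooting in the exponent *)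

Definition clamp (R : realType) (lo hi x : R) := Num.max lo (Num.min x hi).

Lemma clamp_continuous (R : realType) (T : topologicalType) (lo hi : R) (f : T -> R) (x : T) :
  {for x, continuous f} -> {for x, continuous (fun t => clamp lo hi (f t))}.
Proof.
move=> cf; rewrite /clamp.
apply: (@continuous_max R T (cst lo) (fun t => Num.min (f t) hi)); first exact: cvg_cst.
by apply: (@continuous_min R T f (cst hi)) => //; exact: cvg_cst.
Qed.

Lemma clamp_id (R : realType) (lo hi x : R) : lo <= x <= hi -> clamp lo hi x = x.
Proof. by move=> /andP[h1 h2]; rewrite /clamp min_l // max_r. Qed.

Lemma clamp_itv (R : realType) (lo hi x : R) : lo <= hi -> lo <= clamp lo hi x <= hi.
Proof. by move=> h; rewrite /clamp le_max lexx ge_max h ge_min lexx orbT. Qed.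

Section shooting.
Variables (R : realType) (U : R -> R) (mu Ca Cb M a b : R).
Hypothesis Ua : well U mu Ca M a.
Hypothesis Ub : well U mu Cb M b.

(** Time is the angle measured from [a]. The parameter gam is carried as a second coordinate with
    zero velocity, so that varying it means varying the initial value; the clamp and the truncated
    radicand keep the field bounded and continuous everywhere. *)
Definition shoot_field (t : R) (y : R * R) : R * R :=
  (clamp 0 1 y.2 * Num.sqrt (Num.max (U (a + t) - y.1 ^+ 2) 0), 0).

Lemma shoot_field_bound t y : `|shoot_field t y| <= Num.sqrt M.
Proof.
rewrite normr_pair_le /= normr0 sqrtr_ge0 andbT.
have /andP[c0 c1] := @clamp_itv R 0 1 y.2 ler01.
rewrite ger0_norm ?mulr_ge0 ?sqrtr_ge0 //.
rewrite -[leRHS]mul1r ler_pM ?sqrtr_ge0 // ler_wsqrtr // ge_max.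
have := well_M Ua (a + t); have := sqr_ge0 y.1; have := well_ge Ua (a + t); have := sqr_ge0 mu.
by move=> *; apply/andP; split; lra.
Qed.

Lemma shoot_field_cont : continuous (fun p : R * (R * R) => shoot_field p.1 p.2).
Proof.
move=> p; apply: (@continuous_pair _ _ _ (fun p : R * (R * R) => clamp 0 1 p.2.2 *
  Num.sqrt (Num.max (U (a + p.1) - p.2.1 ^+ 2) 0)) (fun=> 0)); last exact: cvg_cst.
have c22 : continuous (fun p : R * (R * R) => p.2.2).
  move=> q; apply: (@continuous_comp _ _ _ (fun p : R * (R * R) => p.2) snd);
    [exact: cvg_snd|exact: cvg_snd].
have c21 : continuous (fun p : R * (R * R) => p.2.1).
  move=> q; apply: (@continuous_comp _ _ _ (fun p : R * (R * R) => p.2) fst);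
    [exact: cvg_snd|exact: cvg_fst].
apply: cvgM; first exact: (@clamp_continuous R _ 0 1 (fun p : R * (R * R) => p.2.2) p (c22 p)).
apply: (@continuous_comp _ _ _ (fun q : R * (R * R) => Num.max (U (a + q.1) - q.2.1 ^+ 2) 0) Num.sqrt);
  last exact: sqrt_continuous.
apply: (@continuous_max R _ (fun q : R * (R * R) => U (a + q.1) - q.2.1 ^+ 2) (cst 0)); last exact: cvg_cst.
apply: cvgB.
  apply: (@continuous_comp _ _ _ (fun q : R * (R * R) => a + q.1) U); last exact: (well_cont Ua).
  by apply: cvgD; [exact: cvg_cst|exact: cvg_fst].
by apply: (@continuous_comp _ _ _ (fun q : R * (R * R) => q.2.1) (fun u => u ^+ 2)); [exact: c21|exact: exprn_continuous].
Qed.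

Lemma euler_shoot_cont h k : continuous (fun gam => euler shoot_field h (- mu, gam) k).
Proof.
elim: k => [|k IH] gam /=.
  by apply: (@continuous_pair _ _ _ (fun=> - mu) id); [exact: cvg_cst|exact: cvg_id].
apply: cvgD; first exact: IH.
apply: cvgZr.
apply: (@continuous_comp _ _ _ (fun g => (k%:R * h, euler shoot_field h (- mu, g) k))
  (fun p : R * (R * R) => shoot_field p.1 p.2)); last exact: shoot_field_cont.
by apply: (@continuous_pair _ _ _ (fun=> k%:R * h) (fun g => euler shoot_field h (- mu, g) k)); [exact: cvg_cst|exact: IH].
Qed.

Lemma euler_shoot0 h k : (euler shoot_field h (- mu, 0) k).1 = - mu /\
  (euler shoot_field h (- mu, 0) k).2 = 0.
Proof.
elim: k => [//|k [IH1 IH2]] /=.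
rewrite IH1 IH2 clamp_id ?lexx ?ler01 // mul0r.
by rewrite /GRing.scale /= mulr0 !addr0.
Qed.

(** The intermediate value theorem between gam = 0, where the iterate stays at -mu, and [gam1]. It
    is applied to Euler iterates because they depend continuously on gam, while the limit equation
    may have several solutions. The alternative, gam = gam1 or end value mu, is written as a
    vanishing product: a closed condition, which survives the limit in N. *)
Lemma shoot_gam (gam1 : R) N : 0 <= gam1 -> exists gam,
  [/\ 0 <= gam <= gam1,
      (euler_step shoot_field (fun=> (- mu, gam)) N (b - a)).1 <= mu &
      (gam - gam1) * ((euler_step shoot_field (fun=> (- mu, gam)) N (b - a)).1 - mu) = 0].
Proof.
move=> g1.
pose phi gam := (euler_step shoot_field (fun=> (- mu, gam)) N (b - a)).1.
have [h|h] := leP mu (phi gam1); last first.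
  by exists gam1; rewrite lexx g1 (ltW h) subrr mul0r.
have cphi : continuous phi.
  move=> g; apply: (@continuous_comp _ _ _ (fun gam => euler_step shoot_field (fun=> (- mu, gam)) N (b - a)) fst);
   [exact: euler_shoot_cont|exact: cvg_fst].
have p0 : phi 0 = - mu by rewrite /phi /euler_step (euler_shoot0 _ _).1.
have mu0 := well_mu Ua.
have [||c] := @IVT _ phi 0 gam1 mu g1.
- exact: continuous_subspaceT.
- by rewrite p0 ge_min le_max h; apply/andP; split; [apply/orP; left; lra|rewrite orbT].
rewrite in_itv /= => cg cE; exists c; split => //; rewrite -/(phi c) cE ?lexx //.
by rewrite subrr mulr0.
Qed.
End shooting.

Lemma derive_cst_on (R : realType) (f df : R -> R) (s t : R) :
  (forall x : R, s <= x -> is_derive x 1 f (df x)) ->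
  (forall x, s <= x <= t -> df x = 0) -> s <= t -> f t = f s.
Proof.
move=> Df df0; rewrite le_eqVlt => /predU1P[->//|st].
have Df' x : x \in `]s, t[%R -> is_derive x 1 f (df x).
  by rewrite in_itv /= => /andP[sx _]; apply: Df; exact: ltW.
have [|c] := MVT st Df'.
  by apply: within_itv_continuous => x /andP[sx _]; exact: is_derive1_cont (Df x sx).
rewrite in_itv /= => /andP[h1 h2] E.
by apply/eqP; rewrite -subr_eq0 E df0 ?mul0r // !ltW.
Qed.

Section profile_exists.
Variables (R : realType) (U : R -> R) (mu Ca Cb M a b : R).
Hypothesis Ua : well U mu Ca M a.
Hypothesis Ub : well U mu Cb M b.
Hypothesis ab : a < b.
Hypothesis flat_a : forall t, a < t -> ~ (forall x, a < x < t -> U x = mu ^+ 2).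
Hypothesis flat_b : forall t, t < b -> ~ (forall x, t < x < b -> U x = mu ^+ 2).

(* [v L - mu] vanishes unless the shooting parameter reached its upper bound. *)
Lemma shooting_limit (gam1 : R) : 0 <= gam1 <= 1 -> exists (gam : R) (v : R -> R),
  [/\ 0 <= gam <= gam1, v 0 = - mu,
      forall t : R, 0 <= t ->
        is_derive t 1 v (gam * Num.sqrt (Num.max (U (a + t) - v t ^+ 2) 0)),
      v (b - a) <= mu &
      (gam - gam1) * (v (b - a) - mu) = 0].
Proof.
move=> /andP[g0 g1]; have mu0 := well_mu Ua.
have L0 : 0 <= b - a by rewrite subr_ge0 ltW.
have [gN HgN] := choice (fun N => @shoot_gam R U mu Ca M a b Ua gam1 N g0).
have y0B N : `|(- mu, gN N)| <= mu + 1.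
  have [/andP[h1 h2] _ _] := HgN N.
  rewrite normr_pair_le /= normrN (ger0_norm (ltW mu0)) (ger0_norm h1).
  by apply/andP; split; lra.
have [G [y [PG GO Hy Dy]]] := peano (shoot_field_bound Ua) (shoot_field_cont Ua)
   (@compact_pair_ball R) y0B.
have D1 (t : R) : 0 <= t -> is_derive t 1 (fun s => (y s).1)
    (clamp 0 1 (y t).2 * Num.sqrt (Num.max (U (a + t) - (y t).1 ^+ 2) 0)).
  by move=> t0; exact: (is_derive1_fst (Dy t t0)).
have D2 (t : R) : 0 <= t -> is_derive t 1 (fun s => (y s).2) 0.
  by move=> t0; exact: (is_derive1_snd (Dy t t0)).
have c2 t : 0 <= t -> (y t).2 = (y 0).2 by apply: (derive_cst_on (df := fun=> 0)) => // x _.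
have E0 N : euler_step (shoot_field U a) (fun N => (- mu, gN N)) N 0 = (- mu, gN N).
  by rewrite /euler_step mul0r truncn0.
have L1 : gN N @[N --> G] --> (y 0).2.
  rewrite (_ : gN = snd \o (fun N => euler_step (shoot_field U a) (fun N => (- mu, gN N)) N 0)).
    exact: cvg_comp _ _ (Hy 0 (lexx 0)) cvg_snd.
  by apply/funext => N /=; rewrite E0.
have y01 : (y 0).1 = - mu.
  have H : fst \o (fun N => euler_step (shoot_field U a) (fun N => (- mu, gN N)) N 0) @ G --> (y 0).1.
    exact: cvg_comp _ _ (Hy 0 (lexx 0)) cvg_fst.
  have C : fst \o (fun N => euler_step (shoot_field U a) (fun N => (- mu, gN N)) N 0) @ G --> - mu.
    rewrite (_ : _ \o _ = cst (- mu)); first exact: cvg_cst.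
    by apply/funext => N /=; rewrite E0.
  exact: (cvg_unique _ H C).
have L2 : fst \o (fun N => euler_step (shoot_field U a) (fun N => (- mu, gN N)) N (b - a)) @ G --> (y (b - a)).1.
  exact: cvg_comp _ _ (Hy (b - a) L0) cvg_fst.
have gb : 0 <= (y 0).2 <= gam1.
  apply/andP; split.
    by apply: (cvgr_to_ge L1); apply: nearW => N; have [/andP[h1 h2] _ _] := HgN N.
  by apply: (cvgr_to_le L1); apply: nearW => N; have [/andP[h1 h2] _ _] := HgN N.
have EN N : euler_step (shoot_field U a) (fun N => (- mu, gN N)) N (b - a) =
  euler_step (shoot_field U a) (fun=> (- mu, gN N)) N (b - a) by [].
exists (y 0).2, (fun t => (y t).1); split => //.
- move=> t t0; have := D1 t t0; rewrite c2 // clamp_id //.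
  by case/andP: gb => -> h; rewrite (le_trans h).
- apply: (cvgr_to_le L2); apply: nearW => N /=; rewrite EN.
  by have [] := HgN N.
- have C : (gN N - gam1) * ((euler_step (shoot_field U a) (fun N => (- mu, gN N)) N (b - a)).1 - mu)
      @[N --> G] --> ((y 0).2 - gam1) * ((y (b - a)).1 - mu).
    by apply: cvgM; apply: cvgB => //; exact: cvg_cst.
  have Z : (gN N - gam1) * ((euler_step (shoot_field U a) (fun N => (- mu, gN N)) N (b - a)).1 - mu)
      @[N --> G] --> (0 : R).
    under eq_fun => N do [rewrite EN; have [_ _ ->] := HgN N].
    exact: cvg_cst.
  exact: (cvg_unique _ C Z).
Qed.

(** The angle chi of the shooting solution has speed at least gam and takes values in [0, pi], so
    gam L <= pi < gam1 L. This rules out gam = gam1, and the shooting alternative then yields v(L) =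
    mu. *)
Lemma profile_exists : pi < b - a ->
  exists2 gam, 0 < gam < 1 & exists g, profile U mu gam a b g.
Proof.
move=> Lpi; have pi0 := pi_gt0 R; have mu0 := well_mu Ua; have ba := ab.
pose L := b - a.
have L0 : 0 < L by rewrite subr_gt0.
(* The midpoint of pi / L and 1, so that gam1 < 1 and gam1 L > pi. *)
pose gam1 := (pi / L + 1) / 2.
have piL : pi / L < 1 by rewrite ltr_pdivrMr // mul1r.
have piL0 : 0 < pi / L by rewrite divr_gt0.
have g11 : gam1 < 1 by rewrite /gam1; lra.
have g10 : 0 < gam1 by rewrite /gam1; lra.
have g1L : pi < gam1 * L by rewrite -ltr_pdivrMr // /gam1; lra.
have [|gam [v [/andP[h1 h2] v0 Dv vL vE]]] := @shooting_limit gam1.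
  by rewrite !ltW.
rewrite -/L in vL vE.
have vle s t : 0 <= s -> s <= t -> v s <= v t.
  move=> s0 st; apply: (derive_ge0_le st (f := v)).
  - by move=> x /andP[sx _]; apply: Dv; apply: (le_trans s0); exact: ltW.
  - by move=> x _; rewrite mulr_ge0 ?sqrtr_ge0.
  - apply: within_itv_continuous => x /andP[sx _].
    exact: is_derive1_cont (Dv x (le_trans s0 sx)).
have gam0 : 0 < gam.
  rewrite lt_neqAle h1 andbT; apply/eqP => gE.
  have vc : v L = - mu.
    rewrite -v0; apply: (derive_cst_on Dv) => [x _|]; last exact: ltW.
    by rewrite -gE mul0r.
  move: vE => /eqP; rewrite mulf_eq0 vc -gE => /orP[|] /eqP; lra.
(* If v rested at -mu or mu, its slope would vanish and U would equal mu^2 on an interval adjacent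
   to a well, against [flat_a] or [flat_b]. This forces the limit solution to leave -mu at once and
   not to reach mu early. *)
have flat s t c : 0 <= s -> s < t -> (forall x, s <= x <= t -> v x = c) -> c ^+ 2 = mu ^+ 2 ->
    forall x, s < x < t -> U (a + x) = mu ^+ 2.
  move=> s0 st vc c2 x xst; have /andP[sx xt] := xst.
  have D : is_derive x 1 v 0.
    apply: is_derive1_near (is_derive1_cst c x).
    near=> z; rewrite vc //; apply/andP; split; apply: ltW; near: z; [exact: lt_nbhsr|exact: lt_nbhsl].
  have x0 : 0 <= x by rewrite (le_trans s0) // ltW.
  have := derive1_uniq (Dv x x0) D => /eqP; rewrite mulf_eq0 (gt_eqF gam0) /=.
  rewrite sqrtr_eq0 ge_max lexx andbT (vc x) ?(ltW sx) ?(ltW xt) // c2 => h.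
  by apply/eqP; rewrite eq_le (well_ge Ua) andbT; lra.
have vgt t : 0 < t -> - mu < v t.
  move=> t0; rewrite ltNge; apply/negP => vt.
  have vc x : 0 <= x <= t -> v x = - mu.
    move=> /andP[x0 xt]; apply/eqP; rewrite eq_le (le_trans (vle _ _ x0 xt) vt) /=.
    by rewrite -v0 vle.
  apply: (@flat_a (a + t)) => [|x xat]; first by lra.
  have := flat 0 t (- mu) (lexx 0) t0 vc _ (x - a).
  by rewrite [a + _]addrC subrK; apply; [rewrite sqrrN|lra].
have vlt t : 0 <= t -> t < L -> v t < mu.
  move=> t0 tL; rewrite ltNge; apply/negP => vt.
  have vc x : t <= x <= L -> v x = mu.
    move=> /andP[tx xL]; apply/eqP; rewrite eq_le.
    by rewrite (le_trans (vle _ _ (le_trans t0 tx) xL)) // (le_trans vt) // vle.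
  apply: (@flat_b (a + t)) => [|x xat]; first by rewrite /L in tL; lra.
  have := flat t L mu t0 tL vc _ (x - a).
  by rewrite [a + _]addrC subrK; apply => //; rewrite /L; lra.
have vin t : 0 < t < L -> - mu < v t < mu.
  by move=> /andP[t0 tL]; rewrite vgt // vlt // ltW.
have Dv' (t : R) : 0 < t < L ->
    is_derive t 1 v (gam * Num.sqrt (U (a + t) - v t ^+ 2)).
  move=> tL; have /andP[t0 _] := tL.
  have := Dv t (ltW t0); rewrite max_l //.
  have /andP[n1 n2] := vin t tL; have := well_ge Ua (a + t).
  have : 0 < (mu - v t) * (mu + v t) by rewrite mulr_gt0; lra.
  lra.
have gL : gam * L <= pi.
  rewrite leNgt; apply/negP => gLpi.
  (* chi is differentiated only away from the ends. Cutting off [e] on each side leaves gam (L - 2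
     e) = (gam L + pi) / 2, still more than pi. *)
  pose e := (gam * L - pi) / (4 * gam).
  have e0 : 0 < e by rewrite divr_gt0 ?subr_gt0 // mulr_gt0.
  have eg : 4 * (gam * e) = gam * L - pi by rewrite /e; field; rewrite gt_eqF.
  have eL : e < L - e.
    by rewrite -(ltr_pM2l gam0); lra.
  have DA (t : R) : 0 < t < L -> is_derive t 1 (pangle mu v) (gam * pspeed (fun t => U (a + t)) mu v t).
    move=> tL; apply: pangle_derive_at => //; [exact: (well_ge Ua)|exact: vin|exact: Dv'].
  have DB t : e <= t <= L - e -> is_derive t 1 (fun t => pangle mu v t - gam * t)
      (gam * pspeed (fun t => U (a + t)) mu v t - gam).
    move=> te; apply: is_derive1_sub; first by apply: DA; lra.
    by apply: (is_derive1_ext (is_derive1_cmul gam (is_derive1_id t))) => //; rewrite mulr1.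
  have := derive_ge0_le (ltW eL) (f := fun t => pangle mu v t - gam * t)
    (df := fun t => gam * pspeed (fun t => U (a + t)) mu v t - gam).
  have A1 : forall t, 0 < t < L -> 0 <= pangle mu v t <= pi.
    move=> t /vin/andP[n1 n2].
    by rewrite acos_ge0 ?acos_lepi // ler_pdivlMr // ler_pdivrMr //; lra.
  have := A1 e (ltac:(lra)); have := A1 (L - e) (ltac:(lra)).
  move=> A2 A3 H.
  have : pangle mu v e - gam * e <= pangle mu v (L - e) - gam * (L - e).
    apply: H.
    - by move=> x ?; apply: DB; lra.
    - move=> x xe; rewrite subr_ge0 -[X in X <= _]mulr1 ler_pM2l //.
      by apply: pspeed_ge1_at; [exact: (well_ge Ua)|apply: vin; lra].
    - by apply: within_itv_continuous => x xe; exact: is_derive1_cont (DB x xe).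
  lra.
have vLE : v L = mu.
  move/eqP: vE; rewrite mulf_eq0 => /orP[] /eqP E; last by lra.
  have : gam = gam1 by lra.
  by move=> E'; move: gL; rewrite E' leNgt g1L.
exists gam; first by rewrite gam0 (le_lt_trans h2).
exists (fun x => v (clamp 0 L (x - a))); split => //.
- by move=> x xa; rewrite /clamp max_l // ge_min; apply/orP; left; lra.
- move=> x bx; rewrite /clamp min_r; last by rewrite /L; lra.
  by rewrite max_r // ltW.
- by move=> x xab; rewrite clamp_id; [apply: vin; rewrite /L; lra|rewrite /L; lra].
- move=> x; apply: (@continuous_comp _ _ _ (fun x => clamp 0 L (x - a)) v).
    by apply: (@clamp_continuous _ _ 0 L (fun x => x - a)); apply: cvgB; [exact: cvg_id|exact: cvg_cst].
  have /andP[c0 _] := clamp_itv (x - a) (ltW L0).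
  exact: is_derive1_cont (Dv _ c0).
- move=> x xab; have xL : 0 < x - a < L by rewrite /L; lra.
  rewrite clamp_id; last by rewrite /L in xL *; lra.
  apply: (@is_derive1_near _ _ (fun x => v (x - a))).
    have /andP[? ?] := xab.
    near=> z; rewrite clamp_id //.
    have : a < z by near: z; exact: lt_nbhsr.
    have : z < b by near: z; exact: lt_nbhsl.
    by rewrite /L; lra.
  have DS : is_derive x 1 (fun x => x - a) 1.
    apply: (is_derive1_ext (is_derive1_sub (is_derive1_id x) (is_derive1_cst a x))) => //.
    by rewrite subr0.
  apply: (is_derive1_ext (is_derive1_chain DS (Dv' _ xL))) => //.
  by rewrite mulr1 [a + _]addrC subrK.
Unshelve. all: by end_near. Qed.

End profile_exists.

(** * From profiles to trajectories *)

Lemma is_derive1_glue (R : realType) (f g : R -> R) (c d : R) :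
  is_derive c 1 f d -> is_derive c 1 g d -> f c = g c ->
  is_derive c 1 (fun t => if c <= t then f t else g t) d.
Proof.
move=> /is_derive1_caratheodory[h1 [E1 C1 h1c]].
move=> /is_derive1_caratheodory[h2 [E2 C2 h2c]] fg.
apply/is_derive1_caratheodory; exists (fun t => if c <= t then h1 t else h2 t).
split; last by rewrite lexx.
- by move=> z; rewrite lexx; case: ifP => _; [exact: E1|rewrite fg; exact: E2].
- apply/cvgrPdist_lt => e e0; rewrite lexx.
  have N1 := cvgr_dist_lt _ _ C1 _ e0; have N2 := cvgr_dist_lt _ _ C2 _ e0.
  near=> t; case: ifP => _; first by near: t; exact: N1.
  by rewrite h1c -h2c; near: t; exact: N2.
Unshelve. all: by end_near. Qed.

Lemma is_derive1_glue_opp (R : realType) (f g df dg : R -> R) :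
  (forall t : R, 0 <= t -> is_derive t 1 f (df t)) ->
  (forall t : R, 0 <= t -> is_derive t 1 g (dg t)) ->
  f 0 = g 0 -> df 0 = - dg 0 ->
  forall t : R, is_derive t 1 (fun t => if 0 <= t then f t else g (- t))
    (if 0 <= t then df t else - dg (- t)).
Proof.
move=> Df Dg fg dfg t.
have [t0|t0|<-] := ltgtP 0 t.
- apply: is_derive1_near (Df t (ltW t0)).
  near=> s; rewrite ltW //; near: s; exact: lt_nbhsr.
- have D : is_derive (- t) 1 g (dg (- t)) by apply: Dg; rewrite oppr_ge0 ltW.
  apply: is_derive1_near (is_derive1_opparg D).
  near=> s; rewrite leNgt ifN // negbK; near: s; exact: lt_nbhsl.
- apply: (@is_derive1_glue _ f (fun s => g (- s))).
  + exact: Df.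
  + rewrite dfg; apply: is_derive1_opparg; rewrite oppr0; exact: Dg.
  + by rewrite oppr0.
Unshelve. all: by end_near. Qed.

(** For a profile this is sqrt(U - g^2) on [a, b] and 0 outside, in a form that is visibly
    continuous: beyond the ends U is frozen at its end value mu^2 = g^2. *)
Definition speed (R : realType) (U : R -> R) (a b : R) (g : R -> R) (x : R) :=
  Num.sqrt (Num.max (U (clamp a b x) - g x ^+ 2) 0).

Section flow.
Variables (R : realType) (U : R -> R) (mu Ca Cb M gam a b : R) (g : R -> R).
Hypothesis Ua : well U mu Ca M a.
Hypothesis Ub : well U mu Cb M b.
Hypothesis gam01 : 0 < gam < 1.
Hypothesis P : profile U mu gam a b g.

Let Q := speed U a b g.
Let s2 : R := Num.sqrt 2.
Let s2_gt0 : 0 < s2. Proof. by rewrite sqrtr_gt0. Qed.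

Lemma profile_gap x : a < x < b -> 0 < U x - g x ^+ 2.
Proof.
move=> /(pf_in P) /andP[h1 h2]; have := well_ge Ua x.
have : 0 < (mu - g x) * (mu + g x) by rewrite mulr_gt0; lra.
lra.
Qed.

Lemma speed_in x : a < x < b -> Q x = Num.sqrt (U x - g x ^+ 2).
Proof.
move=> xab; rewrite /Q /speed clamp_id; last by case/andP: xab => ? ?; rewrite !ltW.
by rewrite max_l // ltW // profile_gap.
Qed.

Lemma speed_sqr x : a < x < b -> Q x ^+ 2 = U x - g x ^+ 2.
Proof. by move=> xab; rewrite speed_in // sqr_sqrtr // ltW // profile_gap. Qed.

Lemma speed_out x : ~~ (a < x < b) -> Q x = 0.
Proof.
have ab := pf_lt P.
rewrite negb_and -!leNgt /Q /speed => /orP[h|h].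
  have -> : clamp a b x = a by rewrite /clamp max_l // ge_min h.
  by rewrite (well_at Ua) (pf_le P) // sqrrN subrr max_l ?lexx // sqrtr0.
have -> : clamp a b x = b by rewrite /clamp min_r // max_r // ltW.
by rewrite (well_at Ub) (pf_ge P) // subrr max_l ?lexx // sqrtr0.
Qed.

Lemma speed_ge0 x : 0 <= Q x. Proof. exact: sqrtr_ge0. Qed.

Lemma speed_gt0 x : a < x < b -> 0 < Q x.
Proof. by move=> xab; rewrite speed_in // sqrtr_gt0 profile_gap. Qed.

Lemma speed_cont : continuous Q.
Proof.
move=> x; apply: (@continuous_comp _ _ _ (fun x => Num.max (U (clamp a b x) - g x ^+ 2) 0) Num.sqrt);
  last exact: sqrt_continuous.
apply: (@continuous_max R _ (fun x => U (clamp a b x) - g x ^+ 2) (cst 0)); last exact: cvg_cst.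
apply: cvgB.
  apply: (@continuous_comp _ _ _ (fun x => clamp a b x) U); last exact: (well_cont Ua).
  by apply: (@clamp_continuous _ _ a b id); exact: cvg_id.
by apply: (@continuous_comp _ _ _ g (fun u => u ^+ 2)); [exact: (pf_cont P)|exact: exprn_continuous].
Qed.

Lemma speed_bound x : Q x <= Num.sqrt M.
Proof.
rewrite ler_wsqrtr // ge_max.
have := well_M Ua (clamp a b x); have := sqr_ge0 (g x).
have := well_ge Ua (clamp a b x); have := sqr_ge0 mu.
by move=> *; apply/andP; split; lra.
Qed.

Lemma profile_slope (x : R) : is_derive x 1 g (gam * Q x).
Proof.
have := profile_derive Ua Ub P x; rewrite /pslope.
by case: ifPn => [h|h]; [rewrite speed_in|rewrite speed_out // mulr0].
Qed.

Lemma profile_homo x y : x <= y -> g x <= g y.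
Proof.
apply: derive_ge0_homo profile_slope _ => z _.
by rewrite mulr_ge0 ?speed_ge0 // ltW //; case/andP: gam01.
Qed.

(* r is truncated below at 1 to have a bounded field; the truncation is inactive
   on the solutions considered, which start at r = 1 where g = 0. *)
Definition flow_field (sg : R) (y : R * R) : R * R :=
  (sg * (s2 * Num.max y.2 1 `^ (gam - 2) * Q y.1),
   sg * (s2 * Num.max y.2 1 `^ (gam - 1) * g y.1)).

Let max1 (x : R) : 1 <= Num.max x 1. Proof. by rewrite le_max lexx orbT. Qed.

Let powR_le1 (x e : R) : 1 <= x -> e <= 0 -> 0 <= x `^ e <= 1.
Proof.
move=> x1 e0; rewrite powR_ge0 /=.
by have := ler_powR x1 e0; rewrite powRr0.
Qed.

Lemma flow_field_bound sg y : `|sg| <= 1 -> `|flow_field sg y| <= s2 * (Num.sqrt M + mu).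
Proof.
move=> sg1; have mu0 := well_mu Ua; have /andP[ga0 ga1] := gam01.
have key (p z B : R) : 0 <= p <= 1 -> `|z| <= B -> `|sg * (s2 * p * z)| <= s2 * B.
  move=> /andP[p0 p1] zB; rewrite !normrM (ger0_norm (ltW s2_gt0)) (ger0_norm p0).
  have B0 : 0 <= B by exact: le_trans zB.
  rewrite -[leRHS]mul1r; apply: ler_pM => //; first by rewrite !mulr_ge0 // ltW.
  by apply: ler_pM => //; [rewrite mulr_ge0 // ltW|rewrite -[leRHS]mulr1 ler_wpM2l // ltW].
have M0 : 0 <= Num.sqrt M by exact: sqrtr_ge0.
rewrite normr_pair_le /=; apply/andP; split; apply: key.
- by apply: powR_le1 => //; lra.
- by rewrite (ger0_norm (speed_ge0 _)) (le_trans (speed_bound _)) // lerDl ltW.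
- by apply: powR_le1 => //; lra.
- rewrite (@le_trans _ _ mu) // ?lerDr //.
  by rewrite ler_norml; exact: profile_bound P _.
Qed.

Lemma max1_pow_cont (e : R) : continuous (fun x : R => Num.max x 1 `^ e).
Proof.
move=> x.
have c1 : {for x, continuous (fun x : R => Num.max x 1)}.
  by apply: (@continuous_max R _ id (cst 1)); [exact: cvg_id|exact: cvg_cst].
have p : 0 < Num.max x 1 by exact: lt_le_trans ltr01 (max1 x).
have c2 : {for Num.max x 1, continuous (fun y : R => y `^ e)}.
  exact: is_derive1_cont (is_derive1_powR e p).
exact: (continuous_comp c1 c2).
Qed.

Lemma flow_field_cont sg : continuous (fun p : R * (R * R) => flow_field sg p.2).
Proof.
move=> p.
have c22 : continuous (fun p : R * (R * R) => p.2.2).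
  move=> q; apply: (@continuous_comp _ _ _ (fun p : R * (R * R) => p.2) snd);
    [exact: cvg_snd|exact: cvg_snd].
have c21 : continuous (fun p : R * (R * R) => p.2.1).
  move=> q; apply: (@continuous_comp _ _ _ (fun p : R * (R * R) => p.2) fst);
    [exact: cvg_snd|exact: cvg_fst].
apply: (@continuous_pair _ _ _
  (fun p : R * (R * R) => sg * (s2 * Num.max p.2.2 1 `^ (gam - 2) * Q p.2.1))
  (fun p : R * (R * R) => sg * (s2 * Num.max p.2.2 1 `^ (gam - 1) * g p.2.1)));
 apply: cvgM; first [exact: cvg_cst|apply: cvgM; [apply: cvgM; first exact: cvg_cst|]].
- exact: (@continuous_comp _ _ _ (fun p : R * (R * R) => p.2.2) (fun x : R => Num.max x 1 `^ (gam - 2)) p (c22 p) (@max1_pow_cont (gam - 2) p.2.2)).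
- exact: (@continuous_comp _ _ _ (fun p : R * (R * R) => p.2.1) Q p (c21 p) (@speed_cont p.2.1)).
- exact: (@continuous_comp _ _ _ (fun p : R * (R * R) => p.2.2) (fun x : R => Num.max x 1 `^ (gam - 1)) p (c22 p) (@max1_pow_cont (gam - 1) p.2.2)).
- exact: (@continuous_comp _ _ _ (fun p : R * (R * R) => p.2.1) g p (c21 p) (pf_cont P (x := p.2.1))).
Qed.

(** [sg] is the direction of time. From a point where g = 0, the angle moves so that sg g(th) stays
    nonnegative; then r is nondecreasing along the half-line, and r >= 1. *)
Lemma half_flow (sg th0 : R) : sg = 1 \/ sg = -1 -> g th0 = 0 ->
  exists th r : R -> R,
    [/\ th 0 = th0, r 0 = 1, forall t, 0 <= t -> 1 <= r t,
     forall t : R, 0 <= t -> is_derive t 1 th (sg * (s2 * r t `^ (gam - 2) * Q (th t))) &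
     forall t : R, 0 <= t -> is_derive t 1 r (sg * (s2 * r t `^ (gam - 1) * g (th t)))].
Proof.
move=> sgE g0.
have sg1 : `|sg| <= 1 by case: sgE => ->; rewrite ?normrN normr1.
have [G [y [PG GO Hy Dy]]] := peano (fun t y => flow_field_bound y sg1) (flow_field_cont (sg := sg))
  (@compact_pair_ball R) (fun N => lexx `|(th0, 1)|).
have y0 : y 0 = (th0, 1).
  have C : euler_step (fun t y => flow_field sg y) (fun=> (th0, 1)) N 0 @[N --> G] --> (th0, 1 : R).
    rewrite (_ : (fun N => _) = cst (th0, 1 : R)); first exact: cvg_cst.
    by apply/funext => N; rewrite /euler_step mul0r truncn0.
  exact: (cvg_unique _ (Hy 0 (lexx 0)) C).
pose th t := (y t).1; pose r t := (y t).2.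
have D1 (t : R) : 0 <= t -> is_derive t 1 th (sg * (s2 * Num.max (r t) 1 `^ (gam - 2) * Q (th t))).
  by move=> t0; exact: (is_derive1_fst (Dy t t0)).
have D2 (t : R) : 0 <= t -> is_derive t 1 r (sg * (s2 * Num.max (r t) 1 `^ (gam - 1) * g (th t))).
  by move=> t0; exact: (is_derive1_snd (Dy t t0)).
have P0 x e : 0 <= s2 * Num.max x 1 `^ e by rewrite mulr_ge0 ?powR_ge0 // ltW.
have th00 : th 0 = th0 by rewrite /th y0.
have gsg t : 0 <= t -> 0 <= sg * g (th t).
  move=> t0; case: sgE => sE; rewrite sE in D1 *.
    rewrite mul1r -g0 -th00; apply: profile_homo.
    apply: (derive_ge0_le t0 (fun x xt => D1 x _)).
    - by move=> x /andP[x0 _]; rewrite ltW.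
    - by move=> x _; rewrite mul1r mulr_ge0 ?speed_ge0.
    - by apply: within_itv_continuous => x /andP[x0 _]; exact: is_derive1_cont (D1 x x0).
  rewrite mulN1r oppr_ge0 -g0 -th00; apply: profile_homo.
  rewrite -lerN2; apply: (derive_ge0_le t0 (fun x xt => is_derive1_opp (D1 x _))).
  - by move=> x /andP[x0 _]; rewrite ltW.
  - by move=> x _; rewrite mulN1r opprK mulr_ge0 ?speed_ge0.
  - by apply: within_itv_continuous => x /andP[x0 _]; exact: is_derive1_cont (is_derive1_opp (D1 x x0)).
have r1 t : 0 <= t -> 1 <= r t.
  move=> t0; have -> : 1 = r 0 by rewrite /r y0.
  apply: (derive_ge0_le t0 (fun x xt => D2 x _)).
  - by move=> x /andP[x0 _]; rewrite ltW.
  - by move=> x /andP[x0 _]; rewrite mulrCA mulr_ge0 // gsg // ltW.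
  - by apply: within_itv_continuous => x /andP[x0 _]; exact: is_derive1_cont (D2 x x0).
exists th, r; split => //; first by rewrite /r y0.
- by move=> t t0; have := D1 t t0; rewrite (max_l (r1 t t0)).
- by move=> t t0; have := D2 t t0; rewrite (max_l (r1 t t0)).
Qed.

Lemma flow_exists : exists th r : R -> R,
  [/\ a < th 0 < b, g (th 0) = 0, forall t, 1 <= r t,
     forall t : R, is_derive t 1 th (s2 * r t `^ (gam - 2) * Q (th t)) &
     forall t : R, is_derive t 1 r (s2 * r t `^ (gam - 2) * r t * g (th t))].
Proof.
have ab := pf_lt P; have mu0 := well_mu Ua.
have [th0 th0ab gth0] : exists2 x, a < x < b & g x = 0.
  have [||c] := @IVT _ g a b 0 (ltW ab).
  - by apply: continuous_subspaceT; exact: (pf_cont P).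
  - by rewrite (pf_le P) // (pf_ge P) // ge_min le_max; apply/andP; split; apply/orP; [left; lra|right; lra].
  rewrite in_itv /= => /andP[ac cb] gc; exists c => //.
  rewrite !lt_neqAle ac cb !andbT; apply/andP; split; apply/eqP => E; move: gc.
    by rewrite -E (pf_le P) //; lra.
  by rewrite E (pf_ge P) //; lra.
have [th1 [r1 [a1 b1 c1 d1 e1]]] := half_flow (or_introl erefl) gth0.
have [th2 [r2 [a2 b2 c2 d2 e2]]] := half_flow (or_intror erefl) gth0.
exists (fun t => if 0 <= t then th1 t else th2 (- t)), (fun t => if 0 <= t then r1 t else r2 (- t)).
have rr t : 1 <= (if 0 <= t then r1 t else r2 (- t)).
  case: ifPn => [/c1//|]; rewrite -ltNge => t0; apply: c2; lra.
split => //; rewrite ?lexx ?a1 //.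
- move=> t; have := is_derive1_glue_opp d1 d2; rewrite a1 a2 b1 b2 => /(_ erefl).
  move=> /(_ (ltac:(ring)) t) D; apply: (is_derive1_ext D) => //.
  by case: ifP => _; rewrite ?mul1r // mulN1r opprK.
- move=> t; have := is_derive1_glue_opp e1 e2; rewrite a1 a2 b1 b2 => /(_ erefl).
  move=> /(_ (ltac:(ring)) t) D; apply: (is_derive1_ext D) => //.
  have pw : 0 < (if 0 <= t then r1 t else r2 (- t)) by exact: lt_le_trans (rr t).
  by move: pw; case: ifP => _ pw; rewrite (powR_gam1 gam pw); ring.
Qed.

End flow.

(** * Confinement and limits of the flow *)

Lemma continuous_avoid_lt (R : realType) (f : R -> R) (c s t : R) :
  continuous f -> (forall x, f x != c) -> f s < c -> f t < c.
Proof.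
move=> cf fc fs; rewrite ltNge; apply/negP => ft.
have [|||x _ /eqP] := @IVT _ f (Num.min s t) (Num.max s t) c; last by rewrite (negbTE (fc x)).
- by rewrite ge_min !le_max lexx.
- exact: continuous_subspaceT.
- have [st|ts] := leP s t; rewrite ge_min le_max (ltW fs) ft ?orbT //.
Qed.

Section flow_trapped.
Variables (R : realType) (U : R -> R) (mu Ca Cb M gam a b : R) (g : R -> R).
Hypothesis Ua : well U mu Ca M a.
Hypothesis Ub : well U mu Cb M b.
Hypothesis gam01 : 0 < gam < 1.
Hypothesis P : profile U mu gam a b g.
Variables (th r : R -> R).
Hypothesis th0 : a < th 0 < b.
Hypothesis r1 : forall t, 1 <= r t.
Let Q := speed U a b g.
Let s2 : R := Num.sqrt 2.
Hypothesis Dth : forall t : R, is_derive t 1 th (s2 * r t `^ (gam - 2) * Q (th t)).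

Let s2_gt0 : 0 < s2. Proof. by rewrite sqrtr_gt0. Qed.

(** The Gronwall energy of [tr_v_gt_mu] again, with g(th) in place of v and [eps] the sign for which
    mu + eps g is nonnegative and vanishes at [z]. Including this term replaces a Lipschitz bound on
    Q at [z]. *)
Lemma flow_avoids (z C eps : R) : well U mu C M z -> th 0 != z -> eps = 1 \/ eps = -1 ->
  eps * g z = - mu -> forall t, th t != z.
Proof.
move=> Uz thz epsE gz t1; apply/eqP => E1.
have mu0 := well_mu Ua; have /andP[ga0 ga1] := gam01; have C0 := well_C Uz.
have gb x := profile_bound mu0 P x.
have eg0 x : 0 <= mu + eps * g x.
  by have := gb x; case: epsE => ->; rewrite ?mul1r ?mulN1r; lra.
have eg2 x : (eps * g x) ^+ 2 = g x ^+ 2.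
  by case: epsE => ->; rewrite ?mul1r ?mulN1r ?sqrrN.
pose m t := s2 * r t `^ (gam - 2).
have m0 t : 0 <= m t by rewrite mulr_ge0 ?powR_ge0 // ltW.
have ms t : m t <= s2.
  rewrite -[leRHS]mulr1 ler_pM2l //.
  have le0 : gam - 2 <= 0 by lra.
  by have := ler_powR (r1 t) le0; rewrite powRr0.
pose E t := (th t - z) ^+ 2 + (mu + eps * g (th t)).
pose dE t := 2 * (th t - z) * (m t * Q (th t)) + eps * (gam * Q (th t) * (m t * Q (th t))).
have DE (t : R) : is_derive t 1 E (dE t).
  have D1 := is_derive1_sqr (is_derive1_sub (Dth t) (is_derive1_cst z t)).
  have D2 := is_derive1_cmul eps (is_derive1_chain (Dth t) (profile_slope Ua Ub P (th t))).
  apply: (is_derive1_ext (is_derive1_add D1 (is_derive1_add (is_derive1_cst mu t) D2))) => //.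
  by rewrite subr0 add0r.
have E0 t : 0 <= E t by rewrite addr_ge0 ?sqr_ge0.
have qE x : Q x ^+ 2 <= C * (x - z) ^+ 2 + 2 * mu * (mu + eps * g x).
  have rhs0 : 0 <= C * (x - z) ^+ 2 + 2 * mu * (mu + eps * g x).
    by rewrite addr_ge0 // mulr_ge0 ?sqr_ge0 // mulr_ge0 // ltW.
  have [xab|xab] := boolP (a < x < b); last by rewrite /Q (speed_out Ua Ub P) // expr0n.
  rewrite /Q (speed_sqr Ua P) // -eg2.
  have := well_quad Uz x; have e0 := eg0 x.
  have e1 : eps * g x <= mu.
    by have := gb x; case: epsE => ->; rewrite ?mul1r ?mulN1r; lra.
  have : 0 <= (mu + eps * g x) * (mu + eps * g x) by rewrite mulr_ge0.
  lra.
pose K := s2 * (1 + (1 + gam) * (C + 2 * mu)).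
have dEK t : `|dE t| <= K * E t.
  have q0 : 0 <= Q (th t) := speed_ge0 _ _ _ _ _.
  have h1 : `|2 * (th t - z) * (m t * Q (th t))| <= m t * ((th t - z) ^+ 2 + Q (th t) ^+ 2).
    have S1 := mulr_ge0 (m0 t) (sqr_ge0 ((th t - z) - Q (th t))).
    have S2 := mulr_ge0 (m0 t) (sqr_ge0 ((th t - z) + Q (th t))).
    by rewrite ler_norml; apply/andP; split; lra.
  have h2 : `|eps * (gam * Q (th t) * (m t * Q (th t)))| = gam * (m t * Q (th t) ^+ 2).
    rewrite normrM (_ : `|eps| = 1); last by case: epsE => ->; rewrite ?normrN normr1.
    rewrite mul1r ger0_norm; first by ring.
    by apply: mulr_ge0; [apply: mulr_ge0 => //; exact: ltW|exact: mulr_ge0].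
  apply: (le_trans (ler_normD _ _)); rewrite h2.
  apply: (@le_trans _ _ (m t * ((1 + (1 + gam) * (C + 2 * mu)) * E t))).
    apply: (@le_trans _ _ (m t * ((th t - z) ^+ 2 + (1 + gam) * Q (th t) ^+ 2))); first by lra.
    apply: ler_wpM2l => //.
    have hq : Q (th t) ^+ 2 <= (C + 2 * mu) * E t.
      apply: (le_trans (qE _)); rewrite /E.
      have := mulr_ge0 C0 (eg0 (th t)); have := mulr_ge0 (ltW mu0) (sqr_ge0 (th t - z)); lra.
    have : (1 + gam) * Q (th t) ^+ 2 <= (1 + gam) * ((C + 2 * mu) * E t).
      by rewrite ler_pM2l //; lra.
    have : (th t - z) ^+ 2 <= E t by rewrite /E; have := eg0 (th t); lra.
    lra.
  rewrite /K -mulrA; apply: ler_wpM2r => //.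
  by rewrite mulr_ge0 // addr_ge0 // mulr_ge0 //; lra.
have Es : E t1 = 0 by rewrite /E E1 subrr expr0n /= gz addrN addr0.
have := gronwall_eq0 0 DE E0 dEK Es.
have p : 0 < (th 0 - z) ^+ 2 by rewrite lt_neqAle sqr_ge0 eq_sym sqrf_eq0 subr_eq0 thz.
by rewrite /E; have := eg0 (th 0); lra.
Qed.

Lemma flow_trapped t : a < th t < b.
Proof.
have mu0 := well_mu Ua.
have cth : continuous th by move=> s; exact: is_derive1_cont (Dth s).
have Na : forall t, th t != a.
  apply: (@flow_avoids a Ca 1 Ua); [by case/andP: th0 => h _; rewrite gt_eqF|by left|].
  by rewrite mul1r (pf_le P).
have Nb : forall t, th t != b.
  apply: (@flow_avoids b Cb (-1) Ub); [by case/andP: th0 => _ h; rewrite lt_eqF|by right|].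
  by rewrite mulN1r (pf_ge P).
have /andP[h1 h2] := th0.
apply/andP; split; last exact: (continuous_avoid_lt t cth Nb h2).
have cN : continuous (fun s => - th s) by move=> s; apply: cvgN; exact: cth.
have := @continuous_avoid_lt _ (fun s => - th s) (- a) 0 t cN.
rewrite !ltrN2; apply => //.
by move=> s; rewrite eqr_opp.
Qed.

End flow_trapped.

Section flow_limit.
Variables (R : realType) (mu gam a b : R) (Q g th r : R -> R).
Let s2 : R := Num.sqrt 2.
Hypothesis gam1 : gam < 1.
Hypothesis mu0 : 0 < mu.
Hypothesis gmu : forall x, g x <= mu.
Hypothesis gmono : forall x y, x <= y -> g x <= g y.
Hypothesis Qc : continuous Q.
Hypothesis Qpos : forall x, a < x < b -> 0 < Q x.
Hypothesis r1 : forall t, 1 <= r t.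
Hypothesis Dth : forall t : R, is_derive t 1 th (s2 * r t `^ (gam - 2) * Q (th t)).
Hypothesis Dr : forall t : R, is_derive t 1 r (s2 * r t `^ (gam - 2) * r t * g (th t)).
Hypothesis thab : forall t, a < th t < b.
Hypothesis gth : exists t0, 0 < g (th t0).

Let s2_gt0 : 0 < s2. Proof. by rewrite sqrtr_gt0. Qed.
Let r0 t : 0 < r t. Proof. exact: lt_le_trans (r1 t). Qed.
Let m0 t : 0 < s2 * r t `^ (gam - 2). Proof. by rewrite mulr_gt0 // powR_gt0. Qed.

Lemma flow_th_homo s t : s <= t -> th s <= th t.
Proof.
apply: derive_ge0_homo Dth _ => x _.
by apply: mulr_ge0; [exact: ltW|apply/ltW/Qpos].
Qed.

(** The power 2 - gam removes r from the equation: (r^(2 - gam))' = (2 - gam) sqrt 2 g(th), which is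
    bounded below by a positive constant from [t0] on. *)
Lemma flow_r_cvg : r t @[t --> +oo%R] --> +oo%R.
Proof.
have [t0 gt0] := gth; set c := g (th t0) in gt0.
have e0 : 0 < 2 - gam by have := gam1; lra.
have D t := is_derive1_pow (2 - gam) (Dr t) (r0 t).
have dE t : (2 - gam) * r t `^ (2 - gam - 1) * (s2 * r t `^ (gam - 2) * r t * g (th t)) =
    (2 - gam) * s2 * g (th t).
  have h : r t `^ (2 - gam - 1) * r t `^ (gam - 2) * r t = 1.
    rewrite -{3}(powRr1 (ltW (r0 t))) -!powRD ?(gt_eqF (r0 t)) ?implybT //.
    by rewrite (_ : 2 - gam - 1 + (gam - 2) + 1 = 0) ?powRr0 //; ring.
  transitivity ((2 - gam) * s2 * g (th t) * (r t `^ (2 - gam - 1) * r t `^ (gam - 2) * r t)).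
    by ring.
  by rewrite h mulr1.
pose k := (2 - gam) * s2 * c.
have k0 : 0 < k by rewrite !mulr_gt0.
have grow t : t0 <= t -> k * (t - t0) <= r t `^ (2 - gam).
  move=> tt.
  have D2 (x : R) : is_derive x 1 (fun x => r x `^ (2 - gam) - k * x) ((2 - gam) * s2 * g (th x) - k).
    have Dk : is_derive x 1 (fun t : R => k * t) k.
      by apply: (is_derive1_ext (is_derive1_cmul k (is_derive1_id x))) => //; rewrite mulr1.
    by apply: (is_derive1_ext (is_derive1_sub (D x) Dk)) => //; rewrite dE.
  have := derive_ge0_homo D2 _ tt.
  suff : forall x, t0 <= x -> 0 <= (2 - gam) * s2 * g (th x) - k.
    by move=> h /(_ h); have := powR_ge0 (r t0) (2 - gam); lra.
  move=> x tx; rewrite subr_ge0 /k ler_pM2l ?mulr_gt0 //.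
  by apply: gmono; exact: flow_th_homo.
apply/cvgryPge => A.
near=> t.
have tt : t0 <= t by near: t; by apply: nbhs_pinfty_ge; exact: num_real.
rewrite leNgt; apply/negP => rA.
have h1 : r t `^ (2 - gam) <= A `^ (2 - gam).
  by apply: ge0_ler_powR; rewrite ?nnegrE ?ltW // (lt_trans (r0 t)).
have h2 : A `^ (2 - gam) < k * (t - t0).
  rewrite -ltr_pdivrMl // ltrBrDl; near: t; by apply: nbhs_pinfty_gt; exact: num_real.
have := grow t tt; lra.
Unshelve. all: by end_near. Qed.

(** If th stayed below b - e, then Q(th) would be bounded below by Q(c) > 0, and (ln r)' = m g(th)
    <= (mu / Q(c)) th'. As th is bounded, so would be ln r, against [flow_r_cvg]. *)
Lemma flow_th_cvg : th t @[t --> +oo%R] --> b.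
Proof.
have key e : 0 < e -> exists t, b - e < th t.
  move=> e0; apply: contrapT => /forallNP H.
  have {}H t : th t <= b - e by rewrite leNgt; apply/negP/H.
  have th0e := H 0; have /andP[ath0 th0b] := thab 0.
  have [c cin cmin] := EVT_min th0e (continuous_subspaceT Qc).
  rewrite in_itv /= in cin.
  have kap0 : 0 < Q c by apply: Qpos; lra.
  have bound t : 0 <= t -> ln (r t) <= ln (r 0) + mu / Q c * (th t - th 0).
    move=> t0.
    have Dl x := is_derive1_sub (is_derive1_cmul (mu / Q c) (Dth x))
      (is_derive1_chain (Dr x) (is_derive1_ln (r0 x))).
    have := derive_ge0_homo Dl _ t0.
    suff : forall x, 0 <= x -> 0 <= mu / Q c * (s2 * r x `^ (gam - 2) * Q (th x)) -
        (r x)^-1 * (s2 * r x `^ (gam - 2) * r x * g (th x)).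
      by move=> h /(_ h); lra.
    move=> x x0.
    have -> : (r x)^-1 * (s2 * r x `^ (gam - 2) * r x * g (th x)) = s2 * r x `^ (gam - 2) * g (th x).
      by field; rewrite gt_eqF.
    rewrite [mu / Q c * _]mulrCA -mulrBr; apply: mulr_ge0; first exact: ltW.
    rewrite subr_ge0 (le_trans (gmu _)) // mulrAC ler_pdivlMr // ler_pM2l //.
    by apply: cmin; rewrite in_itv /= H andbT flow_th_homo.
  have [N HN] : exists2 t, 0 <= t & expR (ln (r 0) + mu / Q c * (b - th 0)) + 1 <= r t.
    apply: near_pinfty_after; move/cvgryPge: flow_r_cvg; exact.
  move=> hr.
  have l1 : ln (expR (ln (r 0) + mu / Q c * (b - th 0))) < ln (r N).
    by rewrite ltr_ln ?posrE ?expR_gt0 //; lra.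
  rewrite expRK in l1; have := bound N HN.
  have : mu / Q c * (th N - th 0) <= mu / Q c * (b - th 0).
    rewrite ler_pM2l ?divr_gt0 // lerD2r ltW //; by case/andP: (thab N).
  lra.
apply/cvgrPdist_lt => e e0; have [t0 H] := key e e0.
near=> t; have tt : t0 <= t by near: t; by apply: nbhs_pinfty_ge; exact: num_real.
have := flow_th_homo tt; have /andP[h1 h2] := thab t.
by rewrite gtr0_norm ?subr_gt0 //; lra.
Unshelve. all: by end_near. Qed.

End flow_limit.

(** * From the flow to parabolic trajectories *)

Lemma C1_weak_velocity (R : realType) (a b : R) (x v : R -> 'rV[R]_2) :
  (forall (t : R) i, is_derive t 1 (fun s => x s 0 i) (v t 0 i)) ->
  (forall i, continuous (fun t => v t 0 i)) -> weak_velocity a b x v.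
Proof.
move=> Dx cv i; split.
- by apply: measurable_funTS; apply: continuous_measurable_fun; exact: cv.
- apply: continuous_compact_integrable; first exact: segment_compact.
  apply: continuous_subspaceT => t.
  by apply: (@continuous_comp _ _ _ (fun s => v s 0 i) (fun u => u ^+ 2)); [exact: cv|exact: exprn_continuous].
- move=> t /set_mem /=; rewrite in_itv /= => /andP[at' tb].
  have [->|nta] := eqVneq t a.
    by rewrite set_itv1 Rintegral_set1 addr0.
  have {}at' : a < t by rewrite lt_neqAle eq_sym nta.
  rewrite /Rintegral (@continuous_FTC2 _ _ (fun s => x s 0 i) a t at').
  + by rewrite -EFinB /= addrC subrK.
  + by apply: continuous_subspaceT; exact: cv.
  + split.
    * by move=> s _; case: (Dx s i).
    * by apply: cvg_at_right_filter; exact: is_derive1_cont (Dx a i).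
    * by apply: cvg_at_left_filter; exact: is_derive1_cont (Dx t i).
  + by move=> s _; rewrite derive1E; case: (Dx s i).
Qed.

Section flow_trajectory.
Variables (R : realType) (U : R -> R) (mu Ca Cb M alpha gam a b : R) (g : R -> R).
Hypothesis Up : forall t, U (t + 2 * pi) = U t.
Hypothesis dU : forall t : R, derivable U t 1.
Hypothesis Ua : well U mu Ca M a.
Hypothesis Ub : well U mu Cb M b.
Hypothesis gamE : gam = 1 - alpha / 2.
Hypothesis P : profile U mu gam a b g.
Let Q := speed U a b g.
Let s2 : R := Num.sqrt 2.
Variables (eps thm thp : R) (th r : R -> R).
Hypothesis epsE : eps = 1 \/ eps = -1.
Hypothesis thab : forall t, a < th t < b.
Hypothesis r1 : forall t, 1 <= r t.
Hypothesis Dth : forall t : R, is_derive t 1 th (eps * (s2 * r t `^ (gam - 2) * Q (th t))).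
Hypothesis Dr : forall t : R, is_derive t 1 r (eps * (s2 * r t `^ (gam - 2) * r t * g (th t))).
Hypothesis rm : r t @[t --> -oo%R] --> +oo%R.
Hypothesis rp : r t @[t --> +oo%R] --> +oo%R.
Hypothesis tm : th t @[t --> -oo%R] --> thm.
Hypothesis tp : th t @[t --> +oo%R] --> thp.

Let r0 t : 0 < r t. Proof. exact: lt_le_trans (r1 t). Qed.
Let x := planar r th.

Let phi0 t := s2 * r t `^ (gam - 1) * (g (th t) * cos (th t) - Q (th t) * sin (th t)).
Let phi1 t := s2 * r t `^ (gam - 1) * (g (th t) * sin (th t) + Q (th t) * cos (th t)).

Let Dcos (t : R) : is_derive t 1 (fun s => cos (th s))
  (- sin (th t) * (eps * (s2 * r t `^ (gam - 2) * Q (th t)))).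
Proof. exact: is_derive1_chain (Dth t) (is_derive_cos _). Qed.

Let Dsin (t : R) : is_derive t 1 (fun s => sin (th s))
  (cos (th t) * (eps * (s2 * r t `^ (gam - 2) * Q (th t)))).
Proof. exact: is_derive1_chain (Dth t) (is_derive_sin _). Qed.

Let Dx0 (t : R) : is_derive t 1 (fun s => x s 0 0) (eps * phi0 t).
Proof.
apply: (is_derive1_ext (is_derive1_mul (Dr t) (Dcos t))) => [s|]; first by rewrite polar_x.
rewrite /phi0 (powR_gam1 gam (r0 t)); ring.
Qed.

Let Dx1 (t : R) : is_derive t 1 (fun s => x s 0 1) (eps * phi1 t).
Proof.
apply: (is_derive1_ext (is_derive1_mul (Dr t) (Dsin t))) => [s|]; first by rewrite polar_y.
rewrite /phi1 (powR_gam1 gam (r0 t)); ring.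
Qed.

Let V t : 'rV[R]_2 := \row_i (if i == 0 then eps * phi0 t else eps * phi1 t).

Let Dx (t : R) i : is_derive t 1 (fun s => x s 0 i) (V t 0 i).
Proof. by case: (ord2P i) => ->; rewrite mxE; [exact: Dx0|exact: Dx1]. Qed.

Lemma is_derive1_row (y w : R -> 'rV[R]_2) (t : R) :
  (forall i, is_derive t 1 (fun s => y s 0 i) (w t 0 i)) ->
  derivable y t 1 /\ derive1 y t = w t.
Proof.
move=> Dy; have dy : derivable y t 1.
  by apply/derivable_mxP => i j; rewrite (ord1 i); case: (Dy j).
split => //; rewrite derive1E derive_mx //; apply/rowP => j; rewrite mxE.
by case: (Dy j).
Qed.

Let derive_x : derive1 x = V.
Proof. by apply/funext => t; have [] := is_derive1_row (fun i => Dx t i). Qed.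

Let Q_derive (z : R) : a < z < b ->
  is_derive z 1 Q (derive1 U z / (2 * Q z) - gam * g z).
Proof.
move=> zab; have gap := profile_gap Ua P zab.
have Q0 := speed_gt0 Ua P zab; rewrite -/Q in Q0.
apply: (@is_derive1_near _ _ (fun z => Num.sqrt (U z - g z ^+ 2))).
  have /andP[? ?] := zab.
  near=> y; rewrite /Q (speed_in Ua P) //; apply/andP; split; near: y.
    exact: lt_nbhsr.
  exact: lt_nbhsl.
have DU : is_derive z 1 U (derive1 U z) by rewrite derive1E; exact: derivableP.
have D := is_derive1_sub DU (is_derive1_sqr (pf_derive P zab)).
apply: (is_derive1_ext (is_derive1_chain D (is_derive1_sqrt gap))) => //.
by rewrite -(speed_in Ua P zab) -/Q; field; rewrite gt_eqF.
Unshelve. all: by end_near. Qed.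

Let DQ (t : R) : is_derive t 1 (fun s => Q (th s))
  ((derive1 U (th t) / (2 * Q (th t)) - gam * g (th t)) * (eps * (s2 * r t `^ (gam - 2) * Q (th t)))).
Proof. exact: is_derive1_chain (Dth t) (Q_derive (thab t)). Qed.

Let Dg (t : R) : is_derive t 1 (fun s => g (th s))
  (gam * Q (th t) * (eps * (s2 * r t `^ (gam - 2) * Q (th t)))).
Proof. exact: is_derive1_chain (Dth t) (profile_slope Ua Ub P (th t)). Qed.

Let DN (t : R) : is_derive t 1 (fun s => s2 * r s `^ (gam - 1))
  (s2 * ((gam - 1) * r t `^ (gam - 2) * (eps * (s2 * r t `^ (gam - 2) * r t * g (th t))))).
Proof.
apply: (is_derive1_ext (is_derive1_cmul s2 (is_derive1_pow (gam - 1) (Dr t) (r0 t)))) => //.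
by rewrite (_ : gam - 1 - 1 = gam - 2) //; ring.
Qed.

Let eps2 : eps * eps = 1.
Proof. by case: epsE => ->; rewrite ?mulr1 // mulrNN mulr1. Qed.

Let s22 : s2 * s2 = 2. Proof. by rewrite -expr2 sqr_sqrtr. Qed.

Let DV (t : R) i : is_derive t 1 (fun s => V s 0 i) (gradient (potential U alpha) (x t) 0 i).
Proof.
have Q0 : 0 < Q (th t) := speed_gt0 Ua P (thab t).
have QE : Q (th t) * Q (th t) = U (th t) - g (th t) ^+ 2.
  by rewrite -expr2 (speed_sqr Ua P (thab t)).
have alphaE : alpha = 2 - 2 * gam by rewrite gamE; field.
rewrite gradient_polar // !mxE (powR_alpha1 (r0 t) gamE).
case: (ord2P i) => -> /=.
- have D := is_derive1_cmul eps (is_derive1_mul (DN t)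
    (is_derive1_sub (is_derive1_mul (Dg t) (Dcos t)) (is_derive1_mul (DQ t) (Dsin t)))).
  apply: (is_derive1_ext D) => [s|]; first by rewrite mxE.
  rewrite (powR_gam1 gam (r0 t)) (_ : U (th t) = Q (th t) * Q (th t) + g (th t) ^+ 2); last by rewrite QE subrK.
  rewrite alphaE; move: s22 eps2 Q0.
  move: (r t) (Q (th t)) (g (th t)) (cos (th t)) (sin (th t)) (derive1 U (th t)) => rr q gg c s u' h1 h2 q0.
  move: (rr `^ (gam - 2)) => p.
  (* The first equality holds identically in eps and s2; the relations eps^2 = 1 and s2^2 = 2 enter
     only afterwards. *)
  transitivity ((eps * eps) * (s2 * s2) / 2 * (rr * p ^+ 2 * (- (2 - 2 * gam) * (q * q + gg ^+ 2) * c - u' * s))).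
    by field; rewrite gt_eqF.
  by rewrite h1 h2; field.
- have D := is_derive1_cmul eps (is_derive1_mul (DN t)
    (is_derive1_add (is_derive1_mul (Dg t) (Dsin t)) (is_derive1_mul (DQ t) (Dcos t)))).
  apply: (is_derive1_ext D) => [s|]; first by rewrite mxE.
  rewrite (powR_gam1 gam (r0 t)) (_ : U (th t) = Q (th t) * Q (th t) + g (th t) ^+ 2); last by rewrite QE subrK.
  rewrite alphaE; move: s22 eps2 Q0.
  move: (r t) (Q (th t)) (g (th t)) (cos (th t)) (sin (th t)) (derive1 U (th t)) => rr q gg c s u' h1 h2 q0.
  move: (rr `^ (gam - 2)) => p.
  transitivity ((eps * eps) * (s2 * s2) / 2 * (rr * p ^+ 2 * (- (2 - 2 * gam) * (q * q + gg ^+ 2) * s + u' * c))).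
    by field; rewrite gt_eqF.
  by rewrite h1 h2; field.
Qed.

Lemma flow_parabolic : parabolic_trajectory U alpha thm thp r th.
Proof.
rewrite /parabolic_trajectory -/x.
have cV i : continuous (fun t => V t 0 i) by move=> t; exact: is_derive1_cont (DV t i).
have cth : continuous th by move=> t; exact: is_derive1_cont (Dth t).
have cr : continuous r by move=> t; exact: is_derive1_cont (Dr t).
rewrite derive_x; split => //.
- split.
    split; first by move=> t _; exact: ltW.
    by apply: continuous_subspaceT.
  by move=> s t _; exists V; apply: C1_weak_velocity => // u i; exact: Dx.
- move=> t; split.
  + by have [] := is_derive1_row (fun i => Dx t i).
  + by have [] := @is_derive1_row V (fun t => gradient (potential U alpha) (x t)) t (fun i => DV t i).
  + by have [] := @is_derive1_row V (fun t => gradient (potential U alpha) (x t)) t (fun i => DV t i).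
- move=> t; rewrite potential_polar // (powR_alpha (r0 t) gamE) sqnormE !mxE /=.
  have QE : U (th t) = Q (th t) ^+ 2 + g (th t) ^+ 2.
    by rewrite /Q (speed_sqr Ua P (thab t)) subrK.
  rewrite QE /phi0 /phi1 (powR_gam1 gam (r0 t)).
  transitivity (2^-1 * ((eps * eps) * (s2 * s2) * (r t * r t `^ (gam - 2)) ^+ 2 *
     ((Q (th t) ^+ 2 + g (th t) ^+ 2) * (cos (th t) ^+ 2 + sin (th t) ^+ 2)))).
    by ring.
  by rewrite eps2 s22 cos2Dsin2; field.
- have [N1 [_ H1]] := (cvgryPge _).1 rp (r 0).
  have [N2 [_ H2]] := (cvgryPge _).1 rm (r 0).
  pose A := Num.min (N2 - 1) 0; pose B := Num.max (N1 + 1) 0.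
  have A0 : A <= 0 by rewrite ge_min lexx orbT.
  have B0 : 0 <= B by rewrite le_max lexx orbT.
  have AB : A <= B by exact: le_trans B0.
  have [c cAB cmin] := EVT_min AB (continuous_subspaceT cr).
  exists c; first exact: r0.
  have rc0 : r c <= r 0 by apply: cmin; rewrite in_itv /= A0 B0.
  move=> t; have [tA|At] := ltP t A.
    apply: (le_trans rc0); apply: H2; move: tA; rewrite lt_min => /andP[? _]; lra.
  have [Bt|tB] := ltP B t.
    apply: (le_trans rc0); apply: H1; move: Bt; rewrite gt_max => /andP[? _]; lra.
  by apply: cmin; rewrite in_itv /= At tB.
Qed.

End flow_trajectory.

Section profile_trajectory.
Variables (R : realType) (U : R -> R) (mu Ca Cb M alpha gam a b : R) (g : R -> R).
Hypothesis Up : forall t, U (t + 2 * pi) = U t.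
Hypothesis dU : forall t : R, derivable U t 1.
Hypothesis Ua : well U mu Ca M a.
Hypothesis Ub : well U mu Cb M b.
Hypothesis gam01 : 0 < gam < 1.
Hypothesis gamE : gam = 1 - alpha / 2.
Hypothesis P : profile U mu gam a b g.
Let Q := speed U a b g.
Let s2 : R := Num.sqrt 2.

Lemma flow_with_limits : exists th r : R -> R,
  [/\ forall t, a < th t < b, forall t, 1 <= r t,
     forall t : R, is_derive t 1 th (s2 * r t `^ (gam - 2) * Q (th t)),
     forall t : R, is_derive t 1 r (s2 * r t `^ (gam - 2) * r t * g (th t)) &
     [/\ r t @[t --> -oo%R] --> +oo%R, r t @[t --> +oo%R] --> +oo%R,
         th t @[t --> -oo%R] --> a & th t @[t --> +oo%R] --> b]].
Proof.
have mu0 := well_mu Ua; have /andP[ga0 ga1] := gam01.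
have [th [r [th0 gth0 r1 Dth Dr]]] := flow_exists Ua Ub gam01 P.
have thab := flow_trapped Ua Ub gam01 P th0 r1 Dth.
have gb := profile_bound mu0 P.
have mono := profile_homo Ua Ub gam01 P.
have Qpos := speed_gt0 Ua P; have Qc := speed_cont Ua P.
have Dgth (t : R) := is_derive1_chain (Dth t) (profile_slope Ua Ub P (th t)).
have s20 : 0 < s2 by rewrite sqrtr_gt0.
have r0 t : 0 < r t := lt_le_trans ltr01 (r1 t).
have glt s t : s < t -> g (th s) < g (th t).
  move=> st; apply: (derive_gt0_lt st (fun x _ => Dgth x) _ (within_derive_itv Dgth)).
  move=> x _; apply: mulr_gt0; first by rewrite mulr_gt0 // Qpos.
  by rewrite mulr_gt0 ?Qpos // mulr_gt0 // powR_gt0.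
have gp1 : 0 < g (th 1) by rewrite -gth0; exact: glt.
have gm1 : 0 < - g (th (- 1)).
  by rewrite oppr_gt0 -gth0; apply: glt; rewrite oppr_lt0.
exists th, r; split => //.
have Rp := @flow_r_cvg R gam a b Q g th r ga1 mono Qpos r1 Dth Dr thab (ex_intro _ 1 gp1).
have Tp := @flow_th_cvg R mu gam a b Q g th r ga1 mu0 (fun x => proj2 (andP (gb x))) mono Qc Qpos
  r1 Dth Dr thab (ex_intro _ 1 gp1).
(* Reflecting both time and angle turns the limits at -oo into limits at +oo for the data Q', g';
   this is why the limit lemmas are stated for abstract Q and g. *)
pose Q' x := Q (- x); pose g' x := - g (- x).
pose th' t := - th (- t); pose r' t := r (- t).
have mono' x y : x <= y -> g' x <= g' y by move=> xy; rewrite lerN2; apply: mono; rewrite lerN2.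
have Qpos' x : - b < x < - a -> 0 < Q' x.
  by move=> xab; apply: Qpos; rewrite ltrNr ltrNl andbC.
have r1' t : 1 <= r' t by exact: r1.
have Dth' (t : R) : is_derive t 1 th' (s2 * r' t `^ (gam - 2) * Q' (th' t)).
  apply: (is_derive1_ext (is_derive1_opp (is_derive1_opparg (Dth (- t))))) => //.
  by rewrite opprK /Q' /th' opprK.
have Dr' (t : R) : is_derive t 1 r' (s2 * r' t `^ (gam - 2) * r' t * g' (th' t)).
  apply: (is_derive1_ext (is_derive1_opparg (Dr (- t)))) => //.
  by rewrite /g' /th' opprK mulrN.
have thab' t : - b < th' t < - a by rewrite !ltrN2 andbC thab.
have gt' : exists t, 0 < g' (th' t) by exists 1; rewrite /g' /th' opprK.
have gmu' x : g' x <= mu by rewrite /g'; have := gb (- x); lra.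
have Qc' : continuous Q'.
  move=> x; apply: (@continuous_comp _ _ _ (-%R) Q); [exact: opp_continuous|exact: Qc].
have Rm := @flow_r_cvg R gam (- b) (- a) Q' g' th' r' ga1 mono' Qpos' r1' Dth' Dr' thab' gt'.
have Tm := @flow_th_cvg R mu gam (- b) (- a) Q' g' th' r' ga1 mu0 gmu' mono' Qc' Qpos'
  r1' Dth' Dr' thab' gt'.
split => //; first exact/cvgNy_compNP.
apply/cvgNy_compNP.
have -> : th \o -%R = (fun t => - th' t) by apply/funext => t; rewrite /th' opprK.
have : - th' t @[t --> +oo%R] --> - - a by exact: cvgN Tm.
by rewrite opprK.
Qed.

Lemma profile_trajectory : exists r th, parabolic_trajectory U alpha a b r th.
Proof.
have [th [r [thab r1 Dth Dr [rm rp tm tp]]]] := flow_with_limits.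
exists r, th.
have D1 (t : R) : is_derive t 1 th (1 * (s2 * r t `^ (gam - 2) * Q (th t))).
  by rewrite mul1r; exact: Dth.
have D2 (t : R) : is_derive t 1 r (1 * (s2 * r t `^ (gam - 2) * r t * g (th t))).
  by rewrite mul1r; exact: Dr.
exact: (flow_parabolic Up dU Ua Ub gamE P (or_introl erefl) thab r1 D1 D2 rm rp tm tp).
Qed.

Lemma profile_trajectory_rev : exists r th, parabolic_trajectory U alpha b a r th.
Proof.
have [th [r [thab r1 Dth Dr [rm rp tm tp]]]] := flow_with_limits.
exists (fun t => r (- t)), (fun t => th (- t)).
have D1 (t : R) : is_derive t 1 (fun t => th (- t))
    (-1 * (s2 * r (- t) `^ (gam - 2) * Q (th (- t)))).
  by rewrite mulN1r; exact: is_derive1_opparg (Dth (- t)).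
have D2 (t : R) : is_derive t 1 (fun t => r (- t))
    (-1 * (s2 * r (- t) `^ (gam - 2) * r (- t) * g (th (- t)))).
  by rewrite mulN1r; exact: is_derive1_opparg (Dr (- t)).
apply: (flow_parabolic Up dU Ua Ub gamE P (or_intror erefl) (fun t => thab (- t)) (fun t => r1 (- t))
  D1 D2); by [exact/cvgy_compNP|exact/cvgNy_compNP].
Qed.

End profile_trajectory.

(** * Calibration *)

(* In polar coordinates, a solution of the eikonal inequality |grad S|^2 <= 2 V. *)
Definition caction (R : realType) (gam : R) (g : R -> R) (rho zeta : R) :=
  Num.sqrt 2 / gam * rho `^ gam * g zeta.

Section segment.
Variables (R : realType) (U : R -> R) (alpha gam : R) (g q : R -> R).
Hypothesis gam0 : 0 < gam.
Hypothesis gamE : gam = 1 - alpha / 2.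
Hypothesis Dg : forall z : R, is_derive z 1 g (gam * q z).
Hypothesis gqU : forall z, g z ^+ 2 + q z ^+ 2 <= U z.

Let s2 : R := Num.sqrt 2.

Lemma caction_derive (th : R) (x : R -> 'rV[R]_2) (t a b : R) :
  0 < x t 0 0 * cos th + x t 0 1 * sin th ->
  is_derive t 1 (fun s => x s 0 0) a -> is_derive t 1 (fun s => x s 0 1) b ->
  let rho := enorm (x t) in let zeta := lift th (x t) in
  is_derive t 1 (fun s => caction gam g (enorm (x s)) (lift th (x s)))
    (a * (s2 * rho `^ (gam - 2) * (g zeta * x t 0 0 - q zeta * x t 0 1)) +
     b * (s2 * rho `^ (gam - 2) * (g zeta * x t 0 1 + q zeta * x t 0 0))).
Proof.
move=> d0 Da Db /=.
have e0 : 0 < enorm (x t).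
  rewrite lt_neqAle sqrtr_ge0 andbT eq_sym; apply/eqP => n0.
  have xE := polar_lift d0.
  by move: d0; rewrite {1 2}xE n0 polar_x polar_y !mul0r addr0 ltxx.
have D1 := is_derive1_enorm e0 Da Db.
have D2 := is_derive1_lift d0 Da Db.
have D3 := is_derive1_mul (is_derive1_cmul (s2 / gam) (is_derive1_pow gam D1 e0))
  (is_derive1_chain D2 (Dg _)).
apply: (is_derive1_ext D3) => //.
rewrite (powR_gam1 gam e0) (powR_gam gam e0).
have : enorm (x t) != 0 by rewrite gt_eqF.
have : gam != 0 by rewrite gt_eqF.
move: (enorm (x t)) (lift th (x t)) => rr z.
move: (rr `^ (gam - 2)) (g z) (q z) (x t 0 0) (x t 0 1) => p G Q x0 x1 n1 n2.
by field; rewrite n1 n2.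
Qed.

(** The left side is |grad S|^2, with radial part from g and angular part from q; the rotation by
    zeta drops out and leaves 2 (g^2 + q^2) / rho^alpha. *)
Lemma caction_grad_le (rho zeta : R) : 0 < rho ->
  (s2 * rho `^ (gam - 2) * (g zeta * (rho * cos zeta) - q zeta * (rho * sin zeta))) ^+ 2 +
  (s2 * rho `^ (gam - 2) * (g zeta * (rho * sin zeta) + q zeta * (rho * cos zeta))) ^+ 2 <=
  2 * (U zeta / rho `^ alpha).
Proof.
move=> r0; have cs := cos2Dsin2 zeta.
have s22 : s2 ^+ 2 = 2 by rewrite sqr_sqrtr.
rewrite (powR_alpha r0 gamE).
set p := rho `^ _.
apply: (@le_trans _ _ (2 * ((g zeta ^+ 2 + q zeta ^+ 2) * (rho ^+ 2 * p ^+ 2)))).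
  rewrite -s22 -[leRHS]mulr1 -cs le_eqVlt; apply/orP; left; apply/eqP; ring.
by rewrite ler_pM2l // ler_wpM2r // mulr_ge0 ?sqr_ge0.
Qed.

(* The hypothesis keeps the whole segment in a half-plane where the lifted
   angle is smooth. *)
Lemma caction_mvt (th : R) (p0 p1 : 'rV[R]_2) :
  (forall p : 'rV[R]_2, p = p0 \/ p = p1 -> 0 < p 0 0 * cos th + p 0 1 * sin th) ->
  exists d0 d1 lam : R, [/\ 0 <= lam <= 1,
    caction gam g (enorm p1) (lift th p1) - caction gam g (enorm p0) (lift th p0) =
      d0 * (p1 0 0 - p0 0 0) + d1 * (p1 0 1 - p0 0 1) &
    let p := p0 + lam *: (p1 - p0) in
    d0 ^+ 2 + d1 ^+ 2 <= 2 * (U (lift th p) / enorm p `^ alpha)].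
Proof.
move=> H; pose x t := p0 + t *: (p1 - p0).
have Dx (t : R) i : is_derive t 1 (fun s => x s 0 i) (p1 0 i - p0 0 i).
  have D := is_derive1_add (is_derive1_cst (p0 0 i) t) (is_derive1_cmul (p1 0 i - p0 0 i) (is_derive1_id t)).
  apply: (is_derive1_ext D) => [s|]; first by rewrite !mxE mulrC.
  by rewrite add0r mulr1.
have pos t : 0 <= t <= 1 -> 0 < x t 0 0 * cos th + x t 0 1 * sin th.
  move=> /andP[t0 t1]; have h0 := H p0 (or_introl erefl); have h1 := H p1 (or_intror erefl).
  have -> : x t 0 0 * cos th + x t 0 1 * sin th =
    (1 - t) * (p0 0 0 * cos th + p0 0 1 * sin th) + t * (p1 0 0 * cos th + p1 0 1 * sin th).
    by rewrite !mxE; ring.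
  have [->|tn0] := eqVneq t 0; first by rewrite subr0 mul1r mul0r addr0.
  have tp : 0 < t by rewrite lt_neqAle eq_sym tn0.
  by apply: ltr_wpDl; [apply: mulr_ge0; [rewrite subr_ge0|exact: ltW]|exact: mulr_gt0].
have DF t : 0 <= t <= 1 -> _ := fun h => caction_derive (pos t h) (Dx t 0) (Dx t 1).
pose F t := caction gam g (enorm (x t)) (lift th (x t)).
have [lam] := MVT ltr01 (fun t h => DF t (ltac:(move: h; rewrite in_itv /= => /andP[? ?]; rewrite !ltW //)))
   (within_itv_continuous (fun t h => is_derive1_cont (DF t h))).
rewrite in_itv /= => /andP[l0 l1]; rewrite subr0 mulr1 => E.
have l01 : 0 <= lam <= 1 by rewrite !ltW.
have x0E : x 0 = p0 by rewrite /x scale0r addr0.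
have x1E : x 1 = p1 by rewrite /x scale1r addrC subrK.
eexists; eexists; exists lam; split => //.
- move: E; rewrite x0E x1E => ->.
  by rewrite mulrC [in X in _ + X]mulrC; reflexivity.
- rewrite -/(x lam); set p := x lam; have dp : 0 < p 0 0 * cos th + p 0 1 * sin th := pos lam l01.
  have pE : p = polar (enorm p) (lift th p) by exact: polar_lift.
  have e0 : 0 < enorm p.
    rewrite lt_neqAle sqrtr_ge0 andbT eq_sym; apply/eqP => n0.
    by move: dp; rewrite {1 2}pE n0 polar_x polar_y !mul0r addr0 ltxx.
  have E0 : p 0 0 = enorm p * cos (lift th p) by rewrite {1}pE polar_x.
  have E1 : p 0 1 = enorm p * sin (lift th p) by rewrite {1}pE polar_y.
  rewrite E0 E1; exact: caction_grad_le.
Qed.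

End segment.

(** The hypothesis compares h(u) only with the value at the centre [t], which is all that a local
    estimate provides. The supremum of the points where h is at least h(a) is itself such a point
    and cannot lie before [b]. *)
Lemma locally_homo (R : realType) (h : R -> R) (a b : R) : a <= b ->
  (forall t, a <= t <= b -> exists2 del, 0 < del & forall u, a <= u <= b ->
     `|u - t| < del -> (t <= u -> h t <= h u) /\ (u <= t -> h u <= h t)) ->
  h a <= h b.
Proof.
move=> ab H.
pose A := [set t | a <= t <= b /\ h a <= h t].
have Aa : A a by split; rewrite ?lexx.
have sA : has_sup A by split; [exists a|exists b => t [/andP[]]].
pose c := sup A.
have cub x : A x -> x <= c by move=> Ax; apply: (sup_upper_bound sA).
have ac : a <= c by exact: cub.
have cb : c <= b by apply: ge_sup => [|x [/andP[]//]]; case: sA.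
have [del del0 Hc] := H c (introT andP (conj ac cb)).
have hc : h a <= h c.
  have [x Ax xc] := sup_adherent del0 sA; have [xab hx] := Ax.
  have xlec := cub x Ax.
  have [|_ /(_ xlec)] := Hc x xab; last exact: le_trans.
  by rewrite distrC ger0_norm ?subr_ge0 // ltrBlDr -ltrBlDl.
have [bc|cb'] := leP b c; first by have -> : b = c by apply/eqP; rewrite eq_le bc cb.
pose u := Num.min b (c + del / 2).
have cu : c < u by rewrite lt_min cb' ltrDl divr_gt0.
have ub : u <= b by rewrite ge_min lexx.
have ud : u <= c + del / 2 by rewrite ge_min lexx orbT.
have uab : a <= u <= b by rewrite ub andbT (le_trans ac) // ltW.
have [|hu _] := Hc u uab; first by rewrite gtr0_norm ?subr_gt0 //; lra.
have : u <= c by apply: cub; split => //; exact: le_trans (hu (ltW cu)).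
by rewrite leNgt cu.
Qed.

Lemma within_itv_epsP (R : realType) (f : R -> R) (a b t e : R) :
  {within `[a, b], continuous f} -> a <= t <= b -> 0 < e ->
  exists2 del, 0 < del & forall u, a <= u <= b -> `|u - t| < del -> `|f u - f t| < e.
Proof.
move=> /subspace_continuousP cf tab e0.
have := cf t; rewrite /= in_itv /= => /(_ tab) /cvgrPdist_lt /(_ e e0).
rewrite near_withinE => N.
have [del /= del0 Hd] := (nbhs_ballP _ _).1 N.
exists del => // u uab ut; rewrite distrC; apply: Hd; last by rewrite /= in_itv.
by rewrite /ball /= distrC.
Qed.

Lemma norm_row2_lt (R : realType) (p : 'rV[R]_2) (e : R) : 0 < e ->
  `|p 0 0| < e -> `|p 0 1| < e -> `|p| < e.
Proof.
move=> e0 h0 h1; rewrite /Num.norm /= mx_normrE.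
apply/bigmax_ltP; split => // -[i j] _ /=; rewrite (ord1 i).
by case: (ord2P j) => ->.
Qed.

Lemma Rintegral_itv_sub (R : realType) (f : R -> R) (a b u v : R) :
  (@lebesgue_measure R).-integrable `[a, b] (EFin \o f) ->
  a <= u -> u <= v -> v <= b ->
  \int[@lebesgue_measure R]_(x in `[a, v]) f x -
  \int[@lebesgue_measure R]_(x in `[a, u]) f x =
  \int[@lebesgue_measure R]_(x in `]u, v]) f x.
Proof.
move=> fi au uv vb; apply: Rintegral_itvB => //.
by apply: integrableS fi => //; apply: subset_itvl; rewrite bnd_simp.
Qed.

Lemma itv_integrableD (R : realType) (i : interval R) (f h : R -> R) :
  (@lebesgue_measure R).-integrable [set` i] (EFin \o f) ->
  (@lebesgue_measure R).-integrable [set` i] (EFin \o h) ->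
  (@lebesgue_measure R).-integrable [set` i] (EFin \o (fun x => f x + h x)).
Proof.
move=> fi hi.
have K : (@lebesgue_measure R).-integrable [set` i] ((EFin \o f) \+ (EFin \o h))%E.
  by apply: integrableD.
exact: K.
Qed.

Lemma itv_integrableZ (R : realType) (i : interval R) (k : R) (f : R -> R) :
  (@lebesgue_measure R).-integrable [set` i] (EFin \o f) ->
  (@lebesgue_measure R).-integrable [set` i] (EFin \o (fun x => k * f x)).
Proof.
move=> fi.
have K : (@lebesgue_measure R).-integrable [set` i] (fun x => k%:E * (EFin \o f) x)%E.
  by apply: integrableZl.
exact: K.
Qed.

Lemma itv_integrable_cst (R : realType) (a b k : R) :
  (@lebesgue_measure R).-integrable `[a, b] (EFin \o (fun=> k)).
Proof.
apply: continuous_compact_integrable; first exact: segment_compact.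
by apply: continuous_subspaceT => u; exact: cvg_cst.
Qed.

Lemma Rintegral_itv_cst (R : realType) (a b k : R) : a <= b ->
  \int[@lebesgue_measure R]_(x in `[a, b]) k = k * (b - a).
Proof.
move=> ab; rewrite Rintegral_cst //=.
rewrite lebesgue_measure_itv /= lte_fin.
case: ltP => [h|h]; first by rewrite -EFinD.
by have -> : b = a by [apply/eqP; rewrite eq_le h ab]; rewrite subrr.
Qed.

Section calibration.
Variables (R : realType) (U : R -> R) (alpha gam : R) (g q : R -> R).
Hypothesis Uc : continuous U.
Hypothesis gam0 : 0 < gam.
Hypothesis gamE : gam = 1 - alpha / 2.
Hypothesis Dg : forall z : R, is_derive z 1 g (gam * q z).
Hypothesis gqU : forall z, g z ^+ 2 + q z ^+ 2 <= U z.

Definition local_potential (th : R) (p : 'rV[R]_2) := U (lift th p) / enorm p `^ alpha.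

Lemma local_potential_near (p : 'rV[R]_2) (th r e : R) : 0 < r -> p = polar r th -> 0 < e ->
  exists2 eta, 0 < eta & forall p', `|p' - p| < eta ->
    0 < p' 0 0 * cos th + p' 0 1 * sin th /\
    `|local_potential th p' - local_potential th p| < e.
Proof.
move=> r0 pE e0.
have c0 : {for p, continuous (fun p : 'rV[R]_2 => p 0 0)} by exact: coord_continuous.
have c1 : {for p, continuous (fun p : 'rV[R]_2 => p 0 1)} by exact: coord_continuous.
have cdot : {for p, continuous (fun p : 'rV[R]_2 => p 0 0 * cos th + p 0 1 * sin th)}.
  exact: (cvgD (cvgM c0 (cvg_cst (cos th))) (cvgM c1 (cvg_cst (sin th)))).
have ccr : {for p, continuous (fun p : 'rV[R]_2 => p 0 1 * cos th - p 0 0 * sin th)}.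
  exact: (cvgB (cvgM c1 (cvg_cst (cos th))) (cvgM c0 (cvg_cst (sin th)))).
have dot0 : 0 < p 0 0 * cos th + p 0 1 * sin th.
  rewrite pE polar_x polar_y.
  have -> : r * cos th * cos th + r * sin th * sin th = r * (cos th ^+ 2 + sin th ^+ 2) by ring.
  by rewrite cos2Dsin2 mulr1.
have cl : {for p, continuous (lift th)}.
  have n0 : p 0 0 * cos th + p 0 1 * sin th != 0 by rewrite gt_eqF.
  exact: (cvgD (cvg_cst th) (continuous_comp (cvgM ccr (cvgV n0 cdot)) (@continuous_atan R _))).
have ce : {for p, continuous (@enorm R)}.
  apply: (@continuous_comp _ _ _ (@sqnorm R) Num.sqrt); last exact: sqrt_continuous.
  have -> : @sqnorm R = (fun p => p 0 0 * p 0 0 + p 0 1 * p 0 1).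
    by apply/funext => y; rewrite sqnormE !expr2.
  exact: (cvgD (cvgM c0 c0) (cvgM c1 c1)).
have ep : enorm p = r by rewrite pE enorm_polar // ltW.
have cV : {for p, continuous (local_potential th)}.
  have n0 : enorm p `^ alpha != 0 by rewrite ep gt_eqF // powR_gt0.
  have cp : {for enorm p, continuous (fun y : R => y `^ alpha)}.
    by apply: is_derive1_cont (is_derive1_powR alpha _); rewrite ep.
  exact: (cvgM (continuous_comp cl (@Uc _)) (cvgV n0 (continuous_comp ce cp))).
have N1 := cvgr_gt _ cdot _ dot0.
have N2 := cvgr_dist_lt _ _ cV _ e0.
have [eta /= eta0 Heta] := (nbhs_ballP _ _).1 (filterI (N1 _) (N2 _)).
exists eta => // p' pp'; have [] := Heta p'.
  by rewrite -ball_normE /= distrC.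
by move=> h1 h2; rewrite distrC.
Qed.

Variables (s t : R) (rho zeta : R -> R) (w : R -> 'rV[R]_2).
Let z := planar rho zeta.
Hypothesis st : s <= t.
Hypothesis rho0 : forall u, s <= u <= t -> 0 < rho u.
Hypothesis zetac : {within `[s, t], continuous zeta}.
Hypothesis wi : forall i, (@lebesgue_measure R).-integrable `[s, t] (EFin \o (fun u => w u 0 i)).
Hypothesis w2 : forall i, (@lebesgue_measure R).-integrable `[s, t] (EFin \o (fun u => w u 0 i ^+ 2)).
Hypothesis zw : forall u i, s <= u <= t -> z u 0 i = z s 0 i +
  \int[@lebesgue_measure R]_(x in `[s, u]) w x 0 i.

Lemma path_coord_cont i : {within `[s, t], continuous (fun u => z u 0 i)}.
Proof.
have C := parameterized_integral_continuous st (wi i).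
have C2 : {within `[s, t], continuous (fun u => z s 0 i + \int[@lebesgue_measure R]_(x in `[s, u]) w x 0 i)}.
  by move=> u'; apply: cvgD; [exact: cvg_cst|exact: C].
apply: (subspace_eq_continuous _ C2) => u' /set_mem /=; rewrite in_itv /= => su.
by rewrite [RHS]zw.
Qed.

Let zn u : s <= u <= t -> enorm (z u) = rho u.
Proof. by move=> /rho0 h; rewrite enorm_polar // ltW. Qed.

Lemma path_near (u e : R) : s <= u <= t -> 0 < e ->
  exists2 del, 0 < del & forall u', s <= u' <= t -> `|u' - u| < del ->
    `|z u' - z u| < e /\ `|zeta u' - zeta u| < pi / 2.
Proof.
move=> su e0; have pi0 : 0 < (pi : R) / 2 by rewrite divr_gt0 // pi_gt0.
have [d1 p1 H1] := within_itv_epsP (path_coord_cont (i := 0)) su e0.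
have [d2 p2 H2] := within_itv_epsP (path_coord_cont (i := 1)) su e0.
have [d3 p3 H3] := within_itv_epsP zetac su pi0.
exists (Num.min d1 (Num.min d2 d3)); first by rewrite !lt_min p1 p2.
move=> u' su'; rewrite !lt_min => /and3P[h1 h2 h3]; split; last exact: H3.
have zE i : (z u' - z u) 0 i = z u' 0 i - z u 0 i by rewrite !mxE.
by apply: norm_row2_lt => //; rewrite zE; [exact: H1|exact: H2].
Qed.

Let A u := caction gam g (rho u) (zeta u).
Let V u := U (zeta u) / rho u `^ alpha.
Let L u := 2^-1 * sqnorm (w u) + V u.

(** Instead of a chain rule along an H^1 path, the mean value theorem is applied along the chord
    from z u0 to z u. It yields a constant covector (d0, d1), bounded through the potential at a
    point of the chord and hence, by continuity, through V u0. *)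
Lemma path_local u0 e : s <= u0 <= t -> 0 < e ->
  exists2 del, 0 < del & forall u, s <= u <= t -> `|u - u0| < del ->
    `|V u - V u0| < e /\ exists d0 d1 : R, [/\
      A u - A u0 = d0 * (z u 0 0 - z u0 0 0) + d1 * (z u 0 1 - z u0 0 1) &
      2^-1 * (d0 ^+ 2 + d1 ^+ 2) <= V u0 + e].
Proof.
move=> su0 e0; have r0 := rho0 su0.
have [eta eta0 Heta] := local_potential_near r0 (erefl (z u0)) e0.
have [del del0 Hdel] := path_near su0 eta0.
exists del => // u su uu0; have [zz tt] := Hdel u su uu0.
have ru := rho0 su.
have lu : lift (zeta u0) (z u) = zeta u by exact: esym (polar_lift_near ru tt).
have l0 : lift (zeta u0) (z u0) = zeta u0.
  by apply/esym/(polar_lift_near r0); rewrite subrr normr0 divr_gt0 // pi_gt0.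
have Vu : local_potential (zeta u0) (z u) = V u by rewrite /local_potential lu zn.
have V0 : local_potential (zeta u0) (z u0) = V u0 by rewrite /local_potential l0 zn.
have [dotu Veu] := Heta _ zz.
split; first by rewrite -Vu -V0.
have zz0 : `|z u0 - z u0| < eta by rewrite subrr normr0.
have [dot0 _] := Heta _ zz0.
have [|d0 [d1 [lam [/andP[l1 l2] E B]]]] := @caction_mvt R U alpha gam g q gam0 gamE Dg gqU (zeta u0) (z u0) (z u).
  by move=> p [->|->].
exists d0, d1; split.
  by move: E; rewrite lu l0 !zn.
have [|_] := Heta (z u0 + lam *: (z u - z u0)).
  rewrite addrC addKr normrZ (ger0_norm l1) (le_lt_trans _ zz) // ler_piMl //.
rewrite V0 ltr_norml => /andP[_].
have {B} : d0 ^+ 2 + d1 ^+ 2 <= 2 * local_potential (zeta u0) (z u0 + lam *: (z u - z u0)) := B.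
move: (local_potential _ _) (d0 ^+ 2 + d1 ^+ 2) => a b h1 h2; lra.
Qed.

Lemma V_cont : {within `[s, t], continuous V}.
Proof.
apply/subspace_continuousP => u; rewrite /= in_itv /= => su.
apply/cvgrPdist_lt => e e0; have [del del0 H] := path_local su e0.
rewrite near_withinE; apply/nbhs_ballP; exists del => // u' uu' /=.
rewrite in_itv /= => su'; rewrite distrC; have [] := H u' su' => //.
by rewrite distrC.
Qed.

Lemma L_integrable : (@lebesgue_measure R).-integrable `[s, t] (EFin \o L).
Proof.
have iV : (@lebesgue_measure R).-integrable `[s, t] (EFin \o V).
  by apply: continuous_compact_integrable; [exact: segment_compact|exact: V_cont].
have I := itv_integrableD (itv_integrableZ 2^-1 (itv_integrableD (w2 0) (w2 1))) iV.
by apply: eq_integrable I => // u _; rewrite /= /L sqnormE.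
Qed.

Lemma path_increment u v i : s <= u -> u <= v -> v <= t ->
  z v 0 i - z u 0 i = \int[@lebesgue_measure R]_(x in `]u, v]) w x 0 i.
Proof.
move=> su uv vt; rewrite -(Rintegral_itv_sub (wi i) su uv vt).
rewrite [in LHS]zw ?su ?(le_trans uv) ?vt ?(le_trans su) //.
by rewrite [in X in _ - X]zw ?su ?(le_trans uv) // opprD addrACA subrr add0r.
Qed.

(** On a short interval A v - A u is the integral of d . w with a constant covector d, and d . w <=
    |d|^2 / 2 + |w|^2 / 2 <= L + e. So the integral of L + e minus A is locally monotone around each
    point, hence monotone between the endpoints, and e is arbitrary. *)
Lemma caction_le : A t - A s <= \int[@lebesgue_measure R]_(x in `[s, t]) L x.
Proof.
apply/ler_addgt0Pr => e0 e00.
have [e e_gt0 eE] : exists2 e, 0 < e & e * (t - s) <= e0.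
  exists (e0 / (t - s + 1)); first by rewrite divr_gt0 // ltr_wpDl // subr_ge0.
  rewrite mulrAC ler_pdivrMr ?ltr_wpDl ?subr_ge0 //.
  by rewrite ler_pM2l // lerDl.
pose Le u := L u + e.
have ie := itv_integrable_cst s t e.
have iLe : (@lebesgue_measure R).-integrable `[s, t] (EFin \o Le) := itv_integrableD L_integrable ie.
pose I u := \int[@lebesgue_measure R]_(x in `[s, u]) Le x.
have key u v d0 d1 : s <= u -> u <= v -> v <= t ->
    A v - A u = d0 * (z v 0 0 - z u 0 0) + d1 * (z v 0 1 - z u 0 1) ->
    (forall x, u < x <= v -> 2^-1 * (d0 ^+ 2 + d1 ^+ 2) <= V x + e) ->
    I u - A u <= I v - A v.
  move=> su uv vt AE dV.
  have sub : `]u, v] `<=` `[s, t].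
    move=> x /=; rewrite !in_itv /= => /andP[ux xv].
    by rewrite (le_trans xv) // (le_trans su) // ltW.
  have iw i : (@lebesgue_measure R).-integrable `]u, v] (EFin \o (fun x => w x 0 i)).
    by apply: integrableS (wi i) => //; exact: sub.
  have iwd (d : R) i : (@lebesgue_measure R).-integrable `]u, v] (EFin \o (fun x => d * w x 0 i)).
    exact: itv_integrableZ.
  have : A v - A u <= I v - I u.
    rewrite AE (Rintegral_itv_sub iLe su uv vt) !path_increment //.
    rewrite -!RintegralZl // -RintegralD //.
    apply: le_Rintegral => //.
    - exact: (itv_integrableD (iwd d0 0) (iwd d1 1)).
    - by apply: integrableS iLe => //; exact: sub.
    - move=> x /=; rewrite in_itv /= => /dV; rewrite /Le /L sqnormE.
      have := sqr_ge0 (w x 0 0 - d0); have := sqr_ge0 (w x 0 1 - d1); lra.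
  lra.
have : I s - A s <= I t - A t.
  apply: (@locally_homo _ (fun u => I u - A u)) => // u0 su0.
  have e2 : 0 < e / 2 by rewrite divr_gt0.
  have [del del0 H] := path_local su0 e2; exists del => // u su uu0.
  have [Vu [d0 [d1 [AE dV]]]] := H u su uu0.
  have /andP[s0 t0] := su0; have /andP[s1 t1] := su.
  have dVx x : s <= x <= t -> `|x - u0| < del -> 2^-1 * (d0 ^+ 2 + d1 ^+ 2) <= V x + e.
    move=> sx xu; have [+ _] := H x sx xu; rewrite ltr_norml => /andP[? ?]; lra.
  split => [u0u|uu].
  - apply: (@key u0 u d0 d1) => // x /andP[x1 x2]; apply: dVx.
      by rewrite (le_trans x2) // (le_trans s0) // ltW.
    apply: le_lt_trans uu0; rewrite !ger0_norm ?subr_ge0 ?(ltW x1) // ?lerD2r //.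
  - apply: (@key u u0 d0 d1) => //.
      by rewrite -opprB AE; ring.
    move=> x /andP[x1 x2]; apply: dVx.
      by rewrite (le_trans x2) // (le_trans s1) // ltW.
    apply: le_lt_trans uu0; rewrite distrC (distrC u) !ger0_norm ?subr_ge0 // ?lerD2l ?lerN2 // ltW //.
have -> : I s = 0 by rewrite /I set_itv1 Rintegral_set1.
have -> : I t = \int[@lebesgue_measure R]_(x in `[s, t]) L x + e * (t - s).
  rewrite /I RintegralD //; last exact: L_integrable.
  by congr (_ + _); exact: Rintegral_itv_cst.
lra.
Qed.

End calibration.

(** * Competitors with collisions *)

Lemma first_hit (R : realType) (f : R -> R) (a b d : R) : a <= b ->
  (forall t e, a <= t <= b -> 0 < e -> exists2 del, 0 < del &
     forall u, a <= u <= b -> `|u - t| < del -> `|f u - f t| < e) ->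
  d < f a -> f b <= d ->
  exists t, [/\ a <= t <= b, f t = d & forall u, a <= u <= t -> d <= f u].
Proof.
move=> ab fc fa fb.
pose S := [set t | a <= t <= b /\ f t <= d].
have Sb : S b by split; rewrite ?ab ?lexx.
have iS : has_inf S by split; [exists b|exists a => t [/andP[]]].
pose c := inf S.
have clb x : S x -> c <= x by move=> Sx; apply: (ge_inf iS.2).
have cb : c <= b by exact: clb.
have ac : a <= c by apply: lb_le_inf => [|x [/andP[]//]]; exists b.
have cab : a <= c <= b by rewrite ac.
have below u : a <= u -> u < c -> d < f u.
  move=> au uc; rewrite ltNge; apply/negP => fu.
  have : c <= u by apply: clb; split; rewrite ?au ?(le_trans (ltW uc)).
  by rewrite leNgt uc.
have fc1 : f c <= d.
  rewrite leNgt; apply/negP => h; have e0 : 0 < f c - d by rewrite subr_gt0.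
  have [del del0 H] := fc c _ cab e0; have [x Sx xc] := inf_adherent del0 iS.
  have [xab fx] := Sx; have cx := clb x Sx.
  have : `|f x - f c| < f c - d.
    by apply: H => //; rewrite ger0_norm ?subr_ge0 // ltrBlDl.
  rewrite ltr_norml => /andP[]; lra.
have fc2 : d <= f c.
  rewrite leNgt; apply/negP => h; have e0 : 0 < d - f c by rewrite subr_gt0.
  have ac' : a < c by rewrite lt_neqAle ac andbT; apply/eqP => ca; move: h; rewrite -ca; lra.
  have [del del0 H] := fc c _ cab e0.
  pose u := Num.max a (c - del / 2).
  have au : a <= u by rewrite le_max lexx.
  have uc : u < c by rewrite gt_max ac' /=; lra.
  have cu : c - del / 2 <= u by rewrite le_max lexx orbT.
  have : `|f u - f c| < d - f c.
    apply: H; first by rewrite au (le_trans (ltW uc)).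
    by rewrite distrC ger0_norm ?subr_ge0 ?(ltW uc) //; lra.
  have := below u au uc; rewrite ltr_norml => ? /andP[]; lra.
exists c; split => //; first by apply/eqP; rewrite eq_le fc1.
move=> u /andP[au]; rewrite le_eqVlt => /orP[/eqP -> //|uc].
by rewrite ltW // below.
Qed.

Lemma last_hit (R : realType) (f : R -> R) (a b d : R) : a <= b ->
  (forall t e, a <= t <= b -> 0 < e -> exists2 del, 0 < del &
     forall u, a <= u <= b -> `|u - t| < del -> `|f u - f t| < e) ->
  f a <= d -> d < f b ->
  exists t, [/\ a <= t <= b, f t = d & forall u, t <= u <= b -> d <= f u].
Proof.
move=> ab fc fa fb.
have [||||t [tab ft tmin]] := @first_hit R (fun u => f (- u)) (- b) (- a) d.
- by rewrite lerN2.
- move=> t e tab e0; have tab' : a <= - t <= b by rewrite lerNr andbC lerNl.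
  have [del del0 H] := fc _ _ tab' e0; exists del => // u uab ut; apply: H.
    by rewrite lerNr andbC lerNl.
  by rewrite -opprD normrN -[t]opprK opprK.
- by rewrite opprK.
- by rewrite opprK.
exists (- t); split => //; first by rewrite lerNr andbC lerNl.
move=> u /andP[tu ub]; rewrite -[u]opprK; apply: tmin.
by rewrite lerN2 ub lerNl.
Qed.

Lemma square_integrable_integrable (R : realType) (a b : R) (f : R -> R) :
  measurable_fun `[a, b] f ->
  (@lebesgue_measure R).-integrable `[a, b] (EFin \o (fun x => f x ^+ 2)) ->
  (@lebesgue_measure R).-integrable `[a, b] (EFin \o f).
Proof.
move=> mf f2.
have I := itv_integrableD (itv_integrable_cst a b 1) f2.
apply: le_integrable I => //; first exact/measurable_EFinP.
move=> x _ /=; rewrite lee_fin (@ger0_norm _ (1 + _)) ?addr_ge0 ?sqr_ge0 //.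
rewrite -[f x ^+ 2]real_normK ?num_real //.
have := sqr_ge0 (`|f x| - 1); have := normr_ge0 (f x); nra.
Qed.

Section collisions.
Variables (R : realType) (U : R -> R) (alpha gam mu : R) (g q : R -> R).
Hypothesis Up : forall t, U (t + 2 * pi) = U t.
Hypothesis Uc : continuous U.
Hypothesis gam0 : 0 < gam.
Hypothesis gamE : gam = 1 - alpha / 2.
Hypothesis Dg : forall z : R, is_derive z 1 g (gam * q z).
Hypothesis gqU : forall z, g z ^+ 2 + q z ^+ 2 <= U z.
Hypothesis gmu : forall z, `|g z| <= mu.

Variables (a b : R) (rho zeta : R -> R) (w : R -> 'rV[R]_2).
Let z := planar rho zeta.
Hypothesis ab : a < b.
Hypothesis pp : polar_path `[a, b] rho zeta.
Hypothesis wv : weak_velocity a b z w.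
Let mu_L := @lebesgue_measure R.
Let A u := caction gam g (rho u) (zeta u).
Let V u := U (zeta u) / rho u `^ alpha.
Let L u := 2^-1 * sqnorm (w u) + V u.
Let F u := ((2^-1 * sqnorm (w u))%:E + potentialE U alpha (z u))%E.

Let rho_ge0 u : a <= u <= b -> 0 <= rho u.
Proof. by move=> h; apply: pp.1; rewrite /= in_itv. Qed.

Let zn u : a <= u <= b -> enorm (z u) = rho u.
Proof. by move=> h; rewrite enorm_polar // rho_ge0. Qed.

Let w2 i : mu_L.-integrable `[a, b] (EFin \o (fun u => w u 0 i ^+ 2)).
Proof. by have [_ h _] := wv i. Qed.

Let wi i : mu_L.-integrable `[a, b] (EFin \o (fun u => w u 0 i)).
Proof. by have [h1 h2 _] := wv i; exact: square_integrable_integrable. Qed.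

Let zw u i : a <= u <= b -> z u 0 i = z a 0 i + \int[mu_L]_(x in `[a, u]) w x 0 i.
Proof. by move=> h; have [_ _ H] := wv i; apply: H; apply/mem_set; rewrite /= in_itv. Qed.

Let z_cont i : {within `[a, b], continuous (fun u => z u 0 i)}.
Proof. exact: path_coord_cont (ltW ab) wi zw i. Qed.

Lemma collision_path_cont : {within `[a, b], continuous rho}.
Proof.
have C : {within `[a, b], continuous (fun u => Num.sqrt (z u 0 0 * z u 0 0 + z u 0 1 * z u 0 1))}.
  have C2 : {within `[a, b], continuous (fun u => z u 0 0 * z u 0 0 + z u 0 1 * z u 0 1)}.
    by move=> u; exact: (cvgD (cvgM (@z_cont 0 u) (@z_cont 0 u)) (cvgM (@z_cont 1 u) (@z_cont 1 u))).
  by move=> u; exact: (continuous_comp (C2 u) (@sqrt_continuous _ _)).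
apply: (subspace_eq_continuous _ C) => u /set_mem /=; rewrite in_itv /= => uab.
by have := zn uab; rewrite /enorm sqnormE !expr2.
Qed.

Let pot_pos u : 0 < rho u -> potentialE U alpha (z u) = (V u)%:E.
Proof.
move=> r0; rewrite /potentialE polar_eq0 ?(ltW r0) // gt_eqF //.
by rewrite potential_polar.
Qed.

Let pot_0 u : rho u = 0 -> potentialE U alpha (z u) = +oo%E.
Proof. by move=> r0; rewrite /potentialE polar_eq0 r0 // eqxx. Qed.

(** The angle is continuous only off the collisions, so measurability is checked separately where
    rho > 0 and where rho = 0; on the latter set the integrand is constantly +oo. *)
Lemma action_integrand_measurable : measurable_fun `[a, b] F.
Proof.
have mI : measurable (`[a, b]%classic : set R) by exact: measurable_itv.
have mrho : measurable_fun `[a, b] rho.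
  exact: subspace_continuous_measurable_fun mI collision_path_cont.
have m1 : measurable_fun `[a, b] (fun u => 2^-1 * sqnorm (w u)).
  apply: (@eq_measurable_fun _ _ _ _ _ (fun u => 2^-1 * (w u 0 0 ^+ 2 + w u 0 1 ^+ 2))).
    by move=> u _; rewrite sqnormE.
  apply: measurable_funM => //; apply: measurable_funD; apply: measurable_funX.
    by have [] := wv 0.
  by have [] := wv 1.
pose D := `[a, b] `&` [set t | 0 < rho t].
pose E := `[a, b] `&` [set t | rho t = 0].
have mD : measurable D.
  have := mrho mI `]0, +oo[%classic (measurable_itv _).
  by congr measurable; congr (_ `&` _); apply/seteqP; split => u /=; rewrite in_itv /= andbT.
have mE : measurable E.
  have := mrho mI [set 0] (measurable_set1 0).
  by congr measurable.
have -> : `[a, b]%classic = D `|` E.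
  apply/seteqP; split => u; last by move=> [] [].
  move=> uab; have := pp.1 u uab; rewrite le_eqVlt => /orP[/eqP h|h]; [right|left]; split => //.
have sD : D `<=` `[a, b] by move=> u [].
apply/(measurable_funU _ mD mE); split.
- apply: (@eq_measurable_fun _ _ _ _ _ (EFin \o L)).
    by move=> u /set_mem[_ /= u0]; rewrite /F pot_pos.
  apply/measurable_EFinP; apply: measurable_funD; first exact: measurable_funS m1.
  have mz : measurable_fun D zeta := subspace_continuous_measurable_fun mD pp.2.
  apply: (@eq_measurable_fun _ _ _ _ _ (fun u => U (zeta u) * rho u `^ (- alpha))).
    by move=> u _; rewrite powRN.
  apply: measurable_funM.
    by apply: measurableT_comp mz; exact: continuous_measurable_fun.
  by apply: measurableT_comp (measurable_powR _) _; exact: measurable_funS mrho.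
- apply: (@eq_measurable_fun _ _ _ _ _ (cst +oo%E)); last exact: measurable_cst.
  by move=> u /set_mem[_ /= u0]; rewrite /F pot_0.
Qed.

Let U0 x : 0 <= U x.
Proof. by apply: le_trans (gqU x); rewrite addr_ge0 ?sqr_ge0. Qed.

Let sq0 u : 0 <= 2^-1 * sqnorm (w u).
Proof. by rewrite mulr_ge0 // sqnormE addr_ge0 ?sqr_ge0. Qed.

Let F_ge0 u : a <= u <= b -> (0 <= F u)%E.
Proof.
move=> uab; rewrite /F; have := rho_ge0 uab; rewrite le_eqVlt => /orP[/eqP h|h].
  by rewrite pot_0 // addey // leey.
rewrite pot_pos // -EFinD lee_fin addr_ge0 // divr_ge0 //.
by rewrite powR_ge0.
Qed.

Lemma caction_le_free s t : a <= s -> s <= t -> t <= b ->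
  (forall u, s <= u <= t -> 0 < rho u) ->
  ((A t - A s)%:E <= \int[mu_L]_(u in `[s, t]) F u)%E.
Proof.
move=> as_ st tb r0.
have sub : `[s, t]%classic `<=` `[a, b] by apply: subset_itv; rewrite bnd_simp.
have abS u : s <= u <= t -> a <= u <= b.
  by move=> /andP[su ut]; rewrite (le_trans as_) // (le_trans ut).
have zc : {within `[s, t], continuous zeta}.
  apply: (continuous_subspaceW _ pp.2) => u ust; split; first exact: sub.
  by apply: r0; move: ust; rewrite /= in_itv.
have wi' i : mu_L.-integrable `[s, t] (EFin \o (fun u => w u 0 i)).
  by apply: integrableS (wi i) => //; exact: sub.
have w2' i : mu_L.-integrable `[s, t] (EFin \o (fun u => w u 0 i ^+ 2)).
  by apply: integrableS (w2 i) => //; exact: sub.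
have zw' u i : s <= u <= t -> z u 0 i = z s 0 i + \int[mu_L]_(x in `[s, u]) w x 0 i.
  move=> /andP[su ut]; apply/eqP; rewrite addrC -subr_eq; apply/eqP.
  rewrite (path_increment wi zw i as_ su (le_trans ut tb)).
  rewrite Rintegral_itv_obnd_cbnd //.
  apply: integrableS (wi' i) => //.
  by apply: subset_itv; rewrite bnd_simp.
have key := caction_le Uc gam0 gamE Dg gqU st r0 zc wi' w2' zw'.
have LI := L_integrable Uc gam0 gamE Dg gqU st r0 zc wi' w2' zw'.
rewrite (@eq_integral _ _ _ mu_L _ (EFin \o L)); last first.
  move=> u /set_mem /=; rewrite in_itv /= => ust.
  by rewrite /F pot_pos ?r0.
rewrite -(fineK (integrable_fin_num _ LI)) //.
Qed.

(** The angle may jump at a collision, so A cannot be followed through it. At radius d, however, |A|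
    <= (sqrt 2 / gam) d^gam mu whatever the angle: replacing A by 0 at both cuts costs at most e,
    and the piece in between is dropped because the integrand is nonnegative. *)
Lemma caction_le_action : 0 < rho a -> 0 < rho b ->
  ((A b - A a)%:E <= \int[mu_L]_(u in `[a, b]) F u)%E.
Proof.
move=> ra rb.
have [free|] := pselect (forall u, a <= u <= b -> 0 < rho u).
  by apply: caction_le_free => //; exact: ltW.
move=> /existsNP[u0 /not_implyP[u0ab /negP]]; rewrite -leNgt => ru0.
have {}ru0 : rho u0 = 0 by apply/eqP; rewrite eq_le ru0 rho_ge0.
have [au0 u0b] := andP u0ab.
have rc (t e : R) : a <= t <= b -> 0 < e -> exists2 del : R, 0 < del &
    forall u : R, a <= u <= b -> `|u - t| < del -> `|rho u - rho t| < e := @within_itv_epsP R rho a b t e collision_path_cont.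
pose s2 : R := Num.sqrt 2.
have s20 : 0 < s2 by rewrite sqrtr_gt0.
have mu0 : 0 <= mu by exact: le_trans (normr_ge0 _) (gmu 0).
have small (e : R) : 0 < e -> exists2 del : R, 0 < del & s2 / gam * del `^ gam * mu <= e.
  move=> e0; pose k := s2 / gam * mu + 1.
  have k0 : 0 < k by rewrite ltr_wpDl // mulr_ge0 // divr_ge0 // ltW.
  exists ((e / k) `^ gam^-1); first by apply: powR_gt0; exact: divr_gt0.
  rewrite -powRrM mulVf ?gt_eqF // powRr1 ?divr_ge0 ?(ltW e0) ?(ltW k0) //.
  rewrite mulrAC mulrA ler_pdivrMr // mulrC ler_pM2l // /k lerDl //.
have Ab (u d : R) : 0 < d -> rho u <= d -> a <= u <= b -> `|A u| <= s2 / gam * d `^ gam * mu.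
  move=> d0 rd uab; rewrite /A /caction -/s2 normrM.
  have p0 := powR_ge0 (rho u) gam; have c0 : 0 <= s2 / gam by rewrite divr_ge0 // ltW.
  have pd : rho u `^ gam <= d `^ gam.
    by apply: ge0_ler_powR; rewrite ?nnegrE ?rho_ge0 ?(ltW gam0) ?(ltW d0).
  rewrite (ger0_norm (mulr_ge0 c0 p0)).
  exact: ler_pM (mulr_ge0 c0 p0) (normr_ge0 _) (ler_wpM2l c0 pd) (gmu _).
(* An infinite action satisfies the bound trivially; otherwise the inequality is one between reals
   and may be proved up to [e]. *)
have [fin|] := boolP ((\int[mu_L]_(u in `[a, b]) F u)%E \is a fin_num); last first.
  rewrite ge0_fin_numE; last by apply: integral_ge0 => u; rewrite /= in_itv; exact: F_ge0.
  by rewrite ltey negbK => /eqP ->; rewrite leey.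
rewrite -(fineK fin) lee_fin; apply/ler_addgt0Pr => e e0.
have e2 : 0 < e / 2 by rewrite divr_gt0.
have [d0 d00 Hd0] := small _ e2.
(* Below both end radii, so that the level d is crossed on each side of the collision [u0]. *)
pose d := Num.min d0 (Num.min (rho a / 2) (rho b / 2)).
have d_gt0 : 0 < d by rewrite !lt_min d00 !divr_gt0.
have da : d < rho a by rewrite (@le_lt_trans _ _ (rho a / 2)) ?ge_min ?lexx ?orbT //; lra.
have db : d < rho b by rewrite (@le_lt_trans _ _ (rho b / 2)) ?ge_min ?lexx ?orbT //; lra.
have dd0 : d <= d0 by rewrite ge_min lexx.
have Ad u : rho u = d -> a <= u <= b -> `|A u| <= e / 2.
  by move=> ru uab; apply: le_trans Hd0; apply: Ab => //; rewrite ru.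
have [||t1 [/andP[at1 t1u] rt1 f1]] := @first_hit R rho a u0 d au0 _ da.
- move=> t e' /andP[at_ tu] e'0; have [|del del0 H] := rc t e' _ e'0.
    by rewrite at_ (le_trans tu).
  by exists del => // u /andP[au uu]; apply: H; rewrite au (le_trans uu).
- by rewrite ru0 ltW.
have [||t2 [/andP[ut2 t2b] rt2 f2]] := @last_hit R rho u0 b d u0b _ _ db.
- move=> t e' /andP[ut tb] e'0; have [|del del0 H] := rc t e' _ e'0.
    by rewrite tb (le_trans au0).
  by exists del => // u /andP[uu ub]; apply: H; rewrite ub (le_trans au0).
- by rewrite ru0 ltW.
have t1b := le_trans t1u u0b; have at2 := le_trans au0 ut2.
have t12 : t1 < t2.
  rewrite lt_neqAle (le_trans t1u) // andbT; apply/eqP => t12.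
  have E : t1 = u0 by apply/eqP; rewrite eq_le t1u t12.
  by move: d_gt0; rewrite -rt1 E ru0 ltxx.
have K1 : ((A t1 - A a)%:E <= \int[mu_L]_(u in `[a, t1]) F u)%E.
  by apply: caction_le_free => // u /f1; exact: lt_le_trans.
have K2 : ((A b - A t2)%:E <= \int[mu_L]_(u in `[t2, b]) F u)%E.
  by apply: caction_le_free => // u /f2; exact: lt_le_trans.
have mF := action_integrand_measurable.
have sub : `[a, t1] `|` `[t2, b] `<=` `[a, b].
  by move=> u [] /=; rewrite !in_itv /= => /andP[h1 h2]; [rewrite h1 (le_trans h2)|rewrite h2 (le_trans at2)].
have F0 u : (`[a, b])%classic u -> (0 <= F u)%E by rewrite /= in_itv; exact: F_ge0.
have mU : measurable (`[a, t1] `|` `[t2, b] : set R) by apply: measurableU.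
have S : (\int[mu_L]_(u in `[a, t1]) F u + \int[mu_L]_(u in `[t2, b]) F u <=
    \int[mu_L]_(u in `[a, b]) F u)%E.
  rewrite -ge0_integral_setU //.
  - by apply: ge0_subset_integral.
  - exact: measurable_funS mF.
  - by move=> u /sub; exact: F0.
  - apply/disj_setPLR => u /=; rewrite !in_itv /= => /andP[_ ut1] /andP[t2u _].
    by move: t12; rewrite ltNge (le_trans t2u).
have := le_trans (leeD K1 K2) S; rewrite -(fineK fin) -EFinD lee_fin.
have t1ab : a <= t1 <= b by rewrite at1. have t2ab : a <= t2 <= b by rewrite at2.
have := Ad _ rt1 t1ab; have := Ad _ rt2 t2ab.
rewrite !ler_norml => /andP[? ?] /andP[? ?] ?; lra.
Qed.

End collisions.

(** * The action of a trajectory *)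

Lemma weak_velocity_integrable (R : realType) (a b : R) (x w : R -> 'rV[R]_2) i :
  weak_velocity a b x w ->
  (@lebesgue_measure R).-integrable `[a, b] (EFin \o (fun t => w t 0 i)).
Proof.
by move=> /(_ i)[h1 h2 _]; exact: square_integrable_integrable.
Qed.

(** [velocity] is an arbitrary choice among the weak derivatives; Lebesgue's differentiation theorem
    identifies it almost everywhere with the classical derivative. *)
Lemma weak_velocity_derive (R : realType) (a b : R) (x w : R -> 'rV[R]_2) (c : R -> R) i :
  weak_velocity a b x w ->
  (forall t : R, a < t < b -> is_derive t 1 (fun s => x s 0 i) (c t)) ->
  {ae @lebesgue_measure R, forall t, a < t < b -> w t 0 i = c t}.
Proof.
move=> wv Dx; have wi := weak_velocity_integrable i wv.
have [_ _ xE] := wv i.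
pose f := (fun t => w t 0 i) \_ `[a, b].
have fE t : a <= t <= b -> f t = w t 0 i.
  by move=> tab; rewrite /f patchE mem_set //= in_itv.
have fi : (@lebesgue_measure R).-integrable `[a, b] (EFin \o f).
  apply: eq_integrable wi => //.
  by move=> t /set_mem /=; rewrite in_itv /= => /fE ->.
have lf : locally_integrable [set: R] f by apply: integrable_locally_restrict.
have := lebesgue_differentiation lf.
apply: filterS; first exact: (ae_filter_ringOfSetsType (@lebesgue_measure R)).
move=> t lp /andP[at_ tb].
have [|dF F'] := @FTC1_lebesgue_pt R f (BLeft a) t b tb fi _ lp.
  by rewrite /= lte_fin.
rewrite -fE ?ltW ?at_ ?tb // -F'.
have D : is_derive t 1 (fun y => \int[@lebesgue_measure R]_(s in `[a, y]) f s) (c t - 0).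
  have tab : a < t < b by rewrite at_.
  apply: is_derive1_near (is_derive1_sub (Dx t tab) (is_derive1_cst (x a 0 i) t)) => //.
  near=> s; have sab : a < s < b.
    apply/andP; split; near: s; [exact: lt_nbhsr|exact: lt_nbhsl].
  have sab' : s \in `[a, b] by apply/mem_set; rewrite /= in_itv /= !ltW; case/andP: sab.
  rewrite xE // addrAC subrr add0r; apply: eq_Rintegral => u /set_mem /=.
  rewrite in_itv /= => /andP[au us]; rewrite fE // au (le_trans us) // ltW //.
  by case/andP: sab.
by rewrite derive1E -[RHS]subr0; case: D => _ <-.
Unshelve. all: by end_near. Qed.

Section trajectory_action.
Variables (R : realType) (U : R -> R) (alpha gam thm thp : R) (r th v : R -> R).
Hypothesis Up : forall t, U (t + 2 * pi) = U t.
Hypothesis dU : forall t, derivable U t 1.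
Hypothesis gam0 : 0 < gam.
Hypothesis gamE : gam = 1 - alpha / 2.
Hypothesis tr : parabolic_trajectory U alpha thm thp r th.
Hypothesis red : reduced U gam r th v.
Let s2 : R := Num.sqrt 2.
Let A t := s2 / gam * r t `^ gam * v t.
Let B t := 2 * (U (th t) / r t `^ alpha).

Let r_gt0 t : 0 < r t.
Proof. by have [r0 r00 /(_ t)] := traj_r_gt0 tr; exact: lt_le_trans. Qed.

Let Uc : continuous U.
Proof. by move=> t; apply: is_derive1_cont; exact: derivableP. Qed.

(** [A] is S along the trajectory, written with v in place of g(th). The terms in v^2 cancel and
    leave 2 V, which is the Lagrangian by the energy relation: the calibration is exact here. *)
Lemma trajectory_action_derive (t : R) : is_derive t 1 A (B t).
Proof.
have [_ Dr Dv _] := red.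
have s22 : s2 ^+ 2 = 2 by rewrite sqr_sqrtr.
apply: (is_derive1_ext (is_derive1_mul (is_derive1_cmul (s2 / gam) (is_derive1_pow gam (Dr t) (r_gt0 t))) (Dv t))) => //.
rewrite /B (powR_gam1 gam (r_gt0 t)) (powR_gam gam (r_gt0 t)) (powR_alpha (r_gt0 t) gamE) -/s2 -s22.
have : gam != 0 by rewrite gt_eqF.
move: (r t) (v t) (U (th t)) (r t `^ (gam - 2)) => rr vv u p g0.
by field.
Qed.

Let B_cont : continuous B.
Proof.
move=> t; have [_ Dr _ [w _ Dth]] := red.
have cU : {for t, continuous (fun t => U (th t))}.
  by apply: continuous_comp; [exact: is_derive1_cont (Dth t).1|exact: Uc].
have n0 : r t `^ alpha != 0 by rewrite gt_eqF // powR_gt0.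
have cr : {for t, continuous (fun t => r t `^ alpha)}.
  exact: is_derive1_cont (is_derive1_pow alpha (Dr t) (r_gt0 t)).
exact: (cvgM (cvg_cst (2 : R)) (cvgM cU (cvgV n0 cr))).
Qed.

Lemma trajectory_action t1 t2 : t1 < t2 ->
  action U alpha t1 t2 (planar r th) = (A t2 - A t1)%:E.
Proof.
move=> t12; have [[pp H1x] dx en _ _] := tr.
have wv : weak_velocity t1 t2 (planar r th) (velocity t1 t2 (planar r th)).
  exact: (xgetPex (fun=> 0) (H1x _ _ t12)).
rewrite /action; set w := velocity _ _ _ in wv *.
have pI : polar_path `[t1, t2] r th.
  split => [t _|]; first exact: pp.1.
  by apply: continuous_subspaceT; exact: traj_th_continuous tr.
have mF := action_integrand_measurable alpha Up Uc t12 pI wv.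
have wE i : {ae @lebesgue_measure R, forall t, t1 < t < t2 -> w t 0 i = derive1 (planar r th) t 0 i}.
  apply: (weak_velocity_derive wv) => t _.
  by have [d _ _] := dx t; exact: is_derive1_coord.
have mB : measurable_fun `]t1, t2[ (EFin \o B).
  by apply/measurable_EFinP; apply: measurable_funTS; exact: continuous_measurable_fun.
have mFo : measurable_fun `]t1, t2[ (fun t => ((2^-1 * sqnorm (w t))%:E + potentialE U alpha (planar r th t))%E).
  by apply: measurable_funS mF => //; apply: subset_itv; rewrite bnd_simp.
rewrite integral_itv_bndoo //.
transitivity (\int[@lebesgue_measure R]_(t in `]t1, t2[) (EFin \o B) t)%E.
  apply: ae_eq_integral => //.
  move: (wE 0) (wE 1).
  apply: filterS2; first exact: (ae_filter_ringOfSetsType (@lebesgue_measure R)).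
  move=> t w0 w1 /=; rewrite in_itv /= => t12'.
  rewrite /potentialE polar_eq0 ?(ltW (r_gt0 t)) // gt_eqF // -EFinD.
  have := en t; rewrite !sqnormE w0 // w1 // => ->.
  by rewrite potential_polar // /B mulr2n mulrDl mul1r.
rewrite -(@integral_itv_bndoo R t1 t2 (EFin \o B) true false) //.
rewrite (@continuous_FTC2 _ B A) //.
- by apply: continuous_subspaceT.
- have cA t : {for t, continuous A} := is_derive1_cont (trajectory_action_derive t).
  split => [t _||]; first by case: (trajectory_action_derive t).
    by apply: cvg_at_right_filter; exact: cA.
  by apply: cvg_at_left_filter; exact: cA.
- by move=> t _; rewrite derive1E; case: (trajectory_action_derive t).
Qed.

End trajectory_action.

(** * Minimality, uniqueness and existence of the exponent *)

Lemma reduced_transition (R : realType) (U : R -> R) (alpha gam thm thp : R)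
    (r th v : R -> R) : 0 < gam < 1 ->
  parabolic_trajectory U alpha thm thp r th -> reduced U gam r th v ->
  exists K0 w m, transition U gam K0 thm thp r th v w m.
Proof.
move=> /andP[gam0 gam1] [_ _ _ _ [rm rp tm tp]] [[r0 r00 r0le] Dr Dv [w wc Dth]].
have r_gt0 t : 0 < r t by exact: lt_le_trans (r0le t).
have s20 : 0 < Num.sqrt 2 :> R by rewrite sqrtr_gt0.
(* As gam - 2 < 0, the factor m is largest where r is smallest. *)
exists (Num.sqrt 2 * r0 `^ (gam - 2)), w, (fun t => Num.sqrt 2 * r t `^ (gam - 2)).
split => //.
- move=> t; rewrite mulr_gt0 ?powR_gt0 //= ler_pM2l //.
  rewrite -opprB !powRN lef_pV2 ?posrE ?powR_gt0 //.
  by apply: ge0_ler_powR; rewrite ?nnegrE ?(ltW r00) ?(ltW (r_gt0 t)) ?subr_ge0 //; lra.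
- by move=> t; case: (Dth t).
- by move=> t; case: (Dth t).
Qed.

(** A profile always runs over increasing angles; a trajectory with decreasing angle is reversed
    first, which produces eps = -1. The profiles of two trajectories with the same ends thus live on
    the same interval and can be compared. *)
Lemma trajectory_profile (R : realType) (U : R -> R) (mu C M alpha gam thm thp : R)
    (r th v : R -> R) : well U mu C M thm -> well U mu C M thp -> thm <> thp ->
  0 < gam < 1 ->
  parabolic_trajectory U alpha thm thp r th -> reduced U gam r th v ->
  exists2 g, profile U mu gam (Num.min thm thp) (Num.max thm thp) g &
    exists2 eps, eps ^+ 2 = 1 & forall t, eps * g (th t) = v t.
Proof.
move=> Wm Wp /eqP neq g01 tr red; have [K0 [w [m T]]] := reduced_transition g01 tr red.
have [lt|gt|eq] := ltgtP thm thp; last by rewrite eq eqxx in neq.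
  have [g [P gE]] := transition_profile Wm Wp T lt; exists g => //.
  by exists 1 => [|t]; rewrite ?expr1n ?mul1r.
have [g [P gE]] := transition_profile Wp Wm (transition_rev T) gt; exists g => //.
exists (- 1) => [|t]; first by rewrite sqrrN expr1n.
by have := gE (- t); rewrite opprK mulN1r => ->; rewrite opprK.
Qed.

Lemma parabolic_minimizer (R : realType) (U : R -> R) (mu C M alpha thm thp : R)
    (r th : R -> R) :
  (forall t, U (t + 2 * pi) = U t) -> (forall t, derivable U t 1) ->
  well U mu C M thm -> well U mu C M thp -> thm <> thp -> 0 < alpha < 2 ->
  parabolic_trajectory U alpha thm thp r th ->
  parabolic_Morse_minimizer U alpha thm thp r th.
Proof.
move=> Up dU Wm Wp neq /andP[al0 al2] tr; split; first exact: tr.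
move=> t1 t2 s1 s2 rho zeta t12 s12 pp H1z r1 z1 r2 z2.
pose gam := 1 - alpha / 2; have gamE : gam = 1 - alpha / 2 by [].
have gam01 : 0 < gam < 1 by apply/andP; split; rewrite gamE; lra.
have gam0 : 0 < gam by case/andP: gam01.
have [v red] := traj_reduced Up dU tr gamE.
have [g P [eps eps2 gE]] := trajectory_profile Wm Wp neq gam01 tr red.
have r_gt0 t : 0 < r t by have [r0 r00 /(_ t)] := traj_r_gt0 tr; exact: lt_le_trans.
move: P; set a := Num.min _ _; set b := Num.max _ _ => P.
have Wa : well U mu C M a by rewrite /a minEle; case: ifP.
have Wb : well U mu C M b by rewrite /b maxEle; case: ifP.
have mu0 := well_mu Wa.
have epsn : `|eps| = 1.
  by apply/eqP; rewrite -sqrp_eq1 // -normrX eps2 normr1.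
have Dg (z : R) : is_derive z 1 (fun z => eps * g z) (gam * (eps * speed U a b g z)).
  by apply: (is_derive1_ext (is_derive1_cmul eps (profile_slope Wa Wb P z))) => //; rewrite mulrCA.
(* A competitor may leave the interval [a, b]. There the slope of g vanishes, |g| <= mu, and the
   eikonal inequality reduces to mu^2 <= U; inside it is an equality. *)
have gqU z : (eps * g z) ^+ 2 + (eps * speed U a b g z) ^+ 2 <= U z.
  rewrite !exprMn eps2 !mul1r; have [zab|zab] := boolP (a < z < b).
    by rewrite (speed_sqr Wa P zab) addrC subrK.
  rewrite (speed_out Wa Wb P zab) expr0n addr0 -real_normK ?num_real //.
  apply: le_trans (well_ge Wa z); rewrite lerXn2r ?nnegrE ?(ltW mu0) //.
  by rewrite ler_norml; exact: profile_bound mu0 P z.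
have gmu z : `|eps * g z| <= mu by rewrite normrM epsn mul1r ler_norml; exact: profile_bound mu0 P z.
have wv : weak_velocity s1 s2 (planar rho zeta) (velocity s1 s2 (planar rho zeta)).
  exact: (xgetPex (fun=> 0) H1z).
rewrite (trajectory_action Up dU gam0 gamE tr red t12) /=.
have K := @caction_le_action R U alpha gam mu (fun z => eps * g z) (fun z => eps * speed U a b g z)
  Up (well_cont Wa) gam0 gamE Dg gqU gmu s1 s2 rho zeta _ s12 pp wv.
(* The lifted angles agree at the ends, so S takes there the same values on the competitor as on the
   trajectory, and the bound becomes the action of the latter. *)
rewrite /caction /= r1 r2 z1 z2 !gE in K.
exact: K.
Qed.

Lemma trajectory_exponent_le (R : realType) (U : R -> R) (mu C M alpha beta thm thp : R) r th r' th' :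
  (forall t, U (t + 2 * pi) = U t) -> (forall t, derivable U t 1) ->
  well U mu C M thm -> well U mu C M thp -> thm <> thp ->
  0 < alpha < 2 -> 0 < beta < 2 ->
  parabolic_trajectory U alpha thm thp r th ->
  parabolic_trajectory U beta thm thp r' th' -> alpha <= beta.
Proof.
move=> Up dU Wm Wp neq /andP[al0 al2] /andP[be0 be2] tr tr'; rewrite leNgt; apply/negP => ba.
pose ga := 1 - alpha / 2; pose gb := 1 - beta / 2.
have gaE : ga = 1 - alpha / 2 by []. have gbE : gb = 1 - beta / 2 by [].
have ga01 : 0 < ga < 1 by apply/andP; split; rewrite gaE; lra.
have gb01 : 0 < gb < 1 by apply/andP; split; rewrite gbE; lra.
have [v red] := traj_reduced Up dU tr gaE.
have [v' red'] := traj_reduced Up dU tr' gbE.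
have [g P _] := trajectory_profile Wm Wp neq ga01 tr red.
have [g' P' _] := trajectory_profile Wm Wp neq gb01 tr' red'.
apply: (profile_gam_lt_absurd (well_mu Wm) (well_ge Wm) _ _ P P').
- by case/andP: ga01.
- by rewrite gaE gbE; lra.
Qed.

Lemma minimizer_exponent_exists (R : realType) (th1 th2 : R) (U : R -> R) (thm thp : R) :
  classU th1 th2 U -> Theta th1 th2 thm -> Theta th1 th2 thp -> pi < `|thp - thm| ->
  exists2 alpha, 0 < alpha < 2 & exists r th, parabolic_trajectory U alpha thm thp r th.
Proof.
move=> hU hm hp gap; have [C [M W]] := classU_wells hU.
have [Up [dU _ _] _ _ _] := hU.
have flat_a a : Theta th1 th2 a -> forall t, a < t -> ~ (forall x, a < x < t -> U x = umin th1 U ^+ 2).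
  by move=> Ta t at_; rewrite (umin_sqr hU); apply: (classU_not_flat hU Ta at_); rewrite lexx ltW.
have flat_b b : Theta th1 th2 b -> forall t, t < b -> ~ (forall x, t < x < b -> U x = umin th1 U ^+ 2).
  by move=> Tb t tb; rewrite (umin_sqr hU); apply: (classU_not_flat hU Tb tb); rewrite lexx ltW.
have [lt|gt|eq] := ltgtP thm thp; last by move: gap; rewrite eq subrr normr0 ltNge pi_ge0.
- rewrite gtr0_norm ?subr_gt0 // in gap.
  have [gam gam01 [g P]] := profile_exists (W _ hm) lt (flat_a _ hm) (flat_b _ hp) gap.
  exists (2 - 2 * gam); first by case/andP: gam01 => ? ?; lra.
  by apply: (profile_trajectory Up dU (W _ hm) (W _ hp) gam01 _ P); lra.
- rewrite ltr0_norm ?subr_lt0 // opprB in gap.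
  have [gam gam01 [g P]] := profile_exists (W _ hp) gt (flat_a _ hp) (flat_b _ hm) gap.
  exists (2 - 2 * gam); first by case/andP: gam01 => ? ?; lra.
  by apply: (profile_trajectory_rev Up dU (W _ hp) (W _ hm) gam01 _ P); lra.
Qed.

Unset Implicit Arguments.

Theorem theorem1p2 (R : realType) (th1 th2 : R) (U : R -> R) (thm thp : R)
    (hth1 : 0 <= th1) (hth12 : th1 <= th2) (hth2 : th2 < 2 * pi)
    (hU : classU th1 th2 U)
    (hthm : Theta th1 th2 thm) (hthp : Theta th1 th2 thp)
    (hneq : thm <> thp) :
  (forall alpha beta : R,
     0 < alpha < 2 -> 0 < beta < 2 ->
     (exists r th : R -> R, parabolic_trajectory U alpha thm thp r th) ->
     (exists r th : R -> R, parabolic_trajectory U beta thm thp r th) ->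
     alpha = beta)
  /\
  (forall (alpha : R) (r th : R -> R),
     0 < alpha < 2 ->
     parabolic_trajectory U alpha thm thp r th ->
     parabolic_Morse_minimizer U alpha thm thp r th)
  /\
  (pi < `|thp - thm| ->
   exists! abar : R,
     0 < abar < 2 /\
     forall alpha : R, 0 < alpha < 2 ->
       ((exists r th : R -> R,
           parabolic_Morse_minimizer U alpha thm thp r th) <->
        alpha = abar)).
Proof.
have [C [M W]] := classU_wells hU; have [Up [dU _ _] _ _ _] := hU.
have Wm := W _ hthm; have Wp := W _ hthp.
have uniq (alpha beta : R) : 0 < alpha < 2 -> 0 < beta < 2 ->
    (exists r th : R -> R, parabolic_trajectory U alpha thm thp r th) ->
    (exists r th : R -> R, parabolic_trajectory U beta thm thp r th) -> alpha = beta.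
  move=> al be [r [th tr]] [r' [th' tr']]; apply/eqP; rewrite eq_le.
  apply/andP; split.
    exact: (trajectory_exponent_le Up dU Wm Wp hneq al be tr tr').
  exact: (trajectory_exponent_le Up dU Wm Wp hneq be al tr' tr).
have mini (alpha : R) (r th : R -> R) : 0 < alpha < 2 ->
    parabolic_trajectory U alpha thm thp r th -> parabolic_Morse_minimizer U alpha thm thp r th.
  exact: (parabolic_minimizer Up dU Wm Wp hneq).
split; first exact: uniq.
split; first exact: mini.
move=> gap.
have [abar ab02 [r [th tr]]] := minimizer_exponent_exists hU hthm hthp gap.
exists abar; split.
  split=> // alpha al02; split=> [[r' [th' [tr' _]]]|->].
    by apply: uniq => //; [exists r', th'|exists r, th].
  by exists r, th; exact: mini.
move=> beta [be02 H]; apply/(H _ ab02).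
by exists r, th; exact: mini.
Qed.
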